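(* Let $\mathcal{G}_4$ be the set of germs $(M,p)\in\mathcal{G}$ such that $p$ is in the Lorentzian region of $M$ and is a singularity of the $MCNC$. For generic $(M,p)\in\mathcal{G}_4$ the following hold. (1) The $MCNC$ has an $A_1$-singularity at $p$. (2) In a generic 1-parameter family of surfaces $M_t$ with $M_0=M$, the $A_1$-singularity of the $MCNC$ at $p$ is $\mathcal{R}$-versally deformed (by the family of curves $MCNC_t$).
   Context: Minkowski space $\mathbb{R}^3_1$ is $\mathbb{R}^3$ with $\langle \mathbf{u},\mathbf{v}\rangle=u_0v_0+u_1v_1-u_2v_2$. The vector product is defined by $\langle \mathbf a\times \mathbf b,\mathbf c\rangle=\det(\mathbf a,\mathbf b,\mathbf c)$. For a smooth regular surface $M\subset\mathbb{R}^3_1$ with local parametrization $\mathbf{x}(u,v)$, put $E=\langle \mathbf{x}_u,\mathbf{x}_u\rangle$, $F=\langle \mathbf{x}_u,\mathbf{x}_v\rangle$, $G=\langle \mathbf{x}_v,\mathbf{x}_v\rangle$, $\bar l=\langle \mathbf{x}_u\times\mathbf{x}_v,\mathbf{x}_{uu}\rangle$, $\bar m=\langle \mathbf{x}_u\times\mathbf{x}_v,\mathbf{x}_{uv}\rangle$, $\bar n=\langle \mathbf{x}_u\times\mathbf{x}_v,\mathbf{x}_{vv}\rangle$, $\delta=F^2-EG$, $\bar H=\bar lG-2\bar mF+\bar nE$. The Lorentzian region is $\{\delta>0\}$. The $MCNC$ (mean curvature null curve) is the zero set of $\bar H$. A singularity of the $MCNC$ is a point where $\bar H=0$ and $d\bar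 H=0$; it is of type $A_1$ if the germ of $\bar H$ is, up to a diffeomorphism germ of the source, $\pm(x^2\pm y^2)$. Genericity: $\mathcal{G}$ is the set of germs $(M,p)$ of smooth surfaces $M\subset\mathbb{R}^3_1$ at $p\in M$, identified with the set of germs of local parametrizations $(\mathbb{R}^2,0)\to(\mathbb{R}^3_1,p)$, $p\in \mathbb{R}^3_1$, with the Whitney topology, modulo diffeomorphism germs of the source $(\mathbb{R}^2,0)$ (quotient topology). A property holds for generic $(M,p)$ in a subset $\tilde{\mathcal{G}}\subset\mathcal{G}$ if the set of $(M,p)\in\tilde{\mathcal{G}}$ satisfying it is open and dense in $\tilde{\mathcal{G}}$ (induced topology). Families: a 1-parameter family $M_t$, $t\in(\mathbb{R},0)$, with $M_0=M$ is a family of surfaces given, when $M$ is the graph of $f$ over a coordinate plane (Monge form), by the graphs of $f+h(\cdot,\cdot,t)$ with $h$ smooth and $h(\cdot,\cdot,0)=0$; it is generic if $h$ satisfies suitable open and dense conditions. $MCNC_t$ is the zero set of the function $\bar H_t$ of $M_t$. The deformation is $\mathcal{R}$-versal if the germ at $p$ of $(q,t)\mapsto\bar H_t(q)$ is an $\mathcal{R}$-versal unfolding of the germ of $\bar H_0$ ($\mathcal{R}$ denoting the group of diffeomorphism germs of the source; the constant term is counted as an unfolding term, so that e.g. $x^2\pm y^2+t$ is an $\mathcal{R}$-versal unfolding of $x^2\pm y^2$). *)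

(* Defs.v *)
From HB Require Import structures.
From mathcomp Require Import all_boot all_order all_algebra generic_quotient ring.
From mathcomp Require Import all_classical all_reals.
From mathcomp Require Import topology normedtype landau derive.
Set Implicit Arguments.
Unset Strict Implicit.
Unset Printing Implicit Defensive.
Import Order.TTheory GRing.Theory Num.Theory.
Import numFieldNormedType.Exports.
Local Open Scope classical_set_scope.
Local Open Scope ring_scope.

Notation "''e_' i" := (delta_mx 0 i) (at level 8, i at level 2, format "''e_' i").

Fixpoint partials {R : realType} n (W : normedModType R) (f : 'rV[R]_n -> W)
    (s : seq 'I_n) : 'rV[R]_n -> W :=
  if s is i :: s' then partials (fun x => 'D_('e_i) f x) s' else f.

(* C^infty near a: the neighbourhood does not depend on the order of
   differentiation.  Frechet differentiability of all the iterated partial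
   derivatives includes their existence and their continuity. *)
Definition smooth_at {R : realType} n (W : normedModType R) (f : 'rV[R]_n -> W)
    (a : 'rV[R]_n) :=
  \forall x \near a, forall s, differentiable (partials f s) x.

Section SmoothTheory.
Context {R : realType}.

Definition smooth_on n (W : normedModType R) (U : set 'rV[R]_n) (k : nat)
    (f : 'rV[R]_n -> W) :=
  forall s, (size s <= k)%N -> forall x, U x -> differentiable (partials f s) x.

Lemma smooth_onS n (W : normedModType R) U k (f : 'rV[R]_n -> W) :
  smooth_on U k.+1 f <->
  (forall x, U x -> differentiable f x) /\
  (forall i, smooth_on U k (fun x => 'D_('e_i) f x)).
Proof.
split=> [sf|[df sf]].
  by split=> [x Ux|i s sk x Ux]; [exact: (sf [::])|exact: (sf (i :: s))].
by case=> [|i s] /= sk x Ux; [exact: df|exact: sf].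
Qed.

Lemma smooth_on0 n (W : normedModType R) U (f : 'rV[R]_n -> W) :
  smooth_on U 0 f <-> (forall x, U x -> differentiable f x).
Proof. by split=> [sf x|df [|//]]; [exact: (sf [::])|]. Qed.

Lemma smooth_on_diff n (W : normedModType R) U k (f : 'rV[R]_n -> W) x :
  smooth_on U k f -> U x -> differentiable f x.
Proof. by move=> sf; apply: (sf [::]). Qed.

Lemma smooth_onW n (W : normedModType R) U k (f : 'rV[R]_n -> W) :
  smooth_on U k.+1 f -> smooth_on U k f.
Proof. by move=> sf s sk; apply: sf; apply: leqW. Qed.

Lemma near_eq_differentiable (V W : normedModType R) (f g : V -> W) x :
  {near x, f =1 g} -> differentiable f x -> differentiable g x.
Proof.
move=> fg df.
have cdf : continuous ('d f x) by exact: diff_continuous.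
have gE : g \o shift x = cst (g x) + 'd f x +o_ 0 id.
  have fE := diff_locally df; apply/eqaddoP => e e0.
  have /eqaddoP/(_ _ e0) := fE.
  have : \forall h \near (0 : V), f (h + x) = g (h + x).
    rewrite (near_shift x).
    by near=> y; rewrite /= sub0r addrNK; near: y.
  apply: filterS2 => h fgh; rewrite !fctE /= /cst /shift /= fgh.
  by rewrite (nbhs_singleton fg).
apply/diff_locallyP; rewrite (diff_unique cdf gE); split=> //.
Unshelve. all: by end_near. Qed.

Lemma eq_in_nearby (T : topologicalType) (W : Type) (U : set T) (f g : T -> W) x :
  open U -> (forall y, U y -> f y = g y) -> U x -> {near x, f =1 g}.
Proof. by move=> oU fg Ux; apply: (filterS fg); exact: open_nbhs_nbhs. Qed.

Lemma eq_smooth_on n (W : normedModType R) (U : set 'rV[R]_n) k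
    (f g : 'rV[R]_n -> W) : open U -> (forall x, U x -> f x = g x) ->
  smooth_on U k f -> smooth_on U k g.
Proof.
move=> oU; elim: k f g => [|k IH] f g fg.
  rewrite !smooth_on0 => df x Ux.
  by apply: near_eq_differentiable (df _ Ux); exact: eq_in_nearby Ux.
rewrite !smooth_onS => -[df sf]; split=> [x Ux|i].
  by apply: near_eq_differentiable (df _ Ux); exact: eq_in_nearby Ux.
apply: IH (sf i) => x Ux.
by apply: near_eq_derive; exact: eq_in_nearby Ux.
Qed.

Lemma smooth_on_cst n (W : normedModType R) (U : set 'rV[R]_n) k (w : W) :
  smooth_on U k (cst w).
Proof.
elim: k w => [|k IH] w; first by rewrite smooth_on0.
rewrite smooth_onS; split=> // i.
have -> : (fun x : 'rV[R]_n => 'D_('e_i) (cst w) x) = cst 0.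
  by apply/funext => x; rewrite derive_cst.
exact: IH.
Qed.

Lemma smooth_onD n (W : normedModType R) (U : set 'rV[R]_n) k
    (f g : 'rV[R]_n -> W) : open U ->
  smooth_on U k f -> smooth_on U k g -> smooth_on U k (f + g).
Proof.
move=> oU; elim: k f g => [|k IH] f g.
  by rewrite !smooth_on0 => df dg x Ux; apply: differentiableD; auto.
rewrite !smooth_onS => -[df sf] [dg sg]; split=> [x Ux|i].
  by apply: differentiableD; auto.
apply: eq_smooth_on (IH _ _ (sf i) (sg i)) => // x Ux.
by rewrite deriveD//; apply: diff_derivable; auto.
Qed.

Lemma smooth_on_sum n (W : normedModType R) (U : set 'rV[R]_n) k m
    (f : 'I_m -> 'rV[R]_n -> W) : open U ->
  (forall i, smooth_on U k (f i)) -> smooth_on U k (\sum_i f i).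
Proof.
move=> oU sf; elim/big_ind : _ => //; last by move=> *; apply: smooth_onD.
exact: smooth_on_cst.
Qed.

Lemma smooth_onM n (U : set 'rV[R]_n) k (f g : 'rV[R]_n -> R) : open U ->
  smooth_on U k f -> smooth_on U k g -> smooth_on U k (f * g).
Proof.
move=> oU; elim: k f g => [|k IH] f g.
  by rewrite !smooth_on0 => df dg x Ux; apply: differentiableM; auto.
move=> sf sg; have [df dsf] := (smooth_onS _ _ _).1 sf.
have [dg dsg] := (smooth_onS _ _ _).1 sg.
rewrite smooth_onS; split=> [x Ux|i]; first by apply: differentiableM; auto.
apply: (eq_smooth_on (f :=
    f * (fun x => 'D_('e_i) g x) + g * (fun x => 'D_('e_i) f x))) => //.
  by move=> x Ux; rewrite deriveM//; apply: diff_derivable; auto.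
by apply: smooth_onD => //; apply: IH => //; exact: smooth_onW.
Qed.

Lemma smooth_on_linear n (V W : normedModType R) (U : set 'rV[R]_n) k
    (L : {linear V -> W}) (f : 'rV[R]_n -> V) : open U -> continuous L ->
  smooth_on U k f -> smooth_on U k (L \o f).
Proof.
move=> oU cL; have dL x : differentiable L x by exact: linear_differentiable.
elim: k f => [|k IH] f.
  by rewrite !smooth_on0 => df x Ux; apply: differentiable_comp; auto.
rewrite !smooth_onS => -[df sf]; split=> [x Ux|i].
  by apply: differentiable_comp; auto.
apply: eq_smooth_on (IH _ (sf i)) => // x Ux.
have dfx := df _ Ux.
have -> : 'D_('e_i) (L \o f) x = 'd (L \o f) x 'e_i.
  by apply: deriveE; exact: differentiable_comp.
have -> : (L \o (fun y => 'D_('e_i) f y)) x = L ('d f x 'e_i).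
  by rewrite -deriveE.
by rewrite (diff_comp dfx (dL (f x))) (diff_lin _ cL).
Qed.

Lemma smooth_on_coord n m (U : set 'rV[R]_n) k (f : 'rV[R]_n -> 'rV[R]_m) :
  open U ->
  smooth_on U k f <-> (forall j, smooth_on U k (fun x => f x 0 j)).
Proof.
move=> oU; split=> [sf j|sf].
  have @L : {linear 'rV[R]_m -> R}.
    by exists (fun v : 'rV[R]_m => v 0 j); do 2![eexists]; do ?[constructor];
       rewrite ?mxE// => ? *; rewrite ?mxE//; move=> ?; rewrite !mxE.
  exact: (@smooth_on_linear _ _ _ _ _ L _ oU (@coord_continuous _ _ _ 0 j)).
have -> : f = \sum_j
    ((fun r : R => r *: ('e_j : 'rV[R]_m)) \o (fun x => f x 0 j)).
  by apply/funext => x; rewrite fct_sumE {1}(row_sum_delta (f x)).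
apply: smooth_on_sum => // j.
have @L : {linear R -> 'rV[R]_m}.
  exists (fun r : R => r *: ('e_j : 'rV[R]_m)); do 2![eexists]; do ?[constructor].
  - exact: scale0r.
  - by move=> x y; rewrite scalerDl.
  - by move=> a x; rewrite scalerA.
apply: (@smooth_on_linear _ _ _ _ _ L) => // x.
exact: (@cvgZr_tmp).
Qed.

Lemma smooth_on_comp n m (U : set 'rV[R]_n) (V : set 'rV[R]_m) k
    (f : 'rV[R]_m -> R) (p : 'rV[R]_n -> 'rV[R]_m) : open U ->
  (forall x, U x -> V (p x)) ->
  smooth_on V k f -> smooth_on U k p -> smooth_on U k (f \o p).
Proof.
move=> oU UV; elim: k f => [|k IH] f.
  rewrite !smooth_on0 => df dp x Ux.
  by apply: differentiable_comp; [exact: dp|exact/df/UV].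
move=> sf sp; have [df dsf] := (smooth_onS _ _ _).1 sf.
have [dp dsp] := (smooth_onS _ _ _).1 sp.
rewrite smooth_onS; split=> [x Ux|i].
  by apply: differentiable_comp; [exact: dp|exact/df/UV].
apply: (eq_smooth_on (f := \sum_j (((fun x => 'D_('e_j) f x) \o p) *
    (fun x => ('D_('e_i) p x) 0 j)))) => //.
  move=> x Ux; have dfp := df _ (UV _ Ux); have dpx := dp _ Ux.
  rewrite fct_sumE [RHS]deriveE; last exact: differentiable_comp.
  rewrite diff_comp//= (row_sum_delta ('d p x 'e_i)) linear_sum.
  apply: eq_bigr => j _; rewrite linearZ /= !fctE /= !deriveE//.
  by rewrite mulrC.
apply: smooth_on_sum => // j; apply: smooth_onM => //.
  by apply: IH; [exact: dsf|exact: smooth_onW].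
by move/smooth_on_coord : (dsp i); apply.
Qed.

End SmoothTheory.

Section SmoothAt.
Context {R : realType}.

Lemma smooth_atP n (W : normedModType R) (f : 'rV[R]_n -> W) a :
  smooth_at f a <->
  exists U : set 'rV[R]_n, [/\ open U, U a & forall k, smooth_on U k f].
Proof.
split=> [sf|[U [oU Ua sf]]].
  exists ([set x | forall s, differentiable (partials f s) x]°); split.
  - exact: open_interior.
  - exact: sf.
  - by move=> k s _ x /interior_subset; apply.
apply: (@filterS _ _ _ U) => [x Ux s|]; first exact: sf (leqnn _) _ Ux.
exact: open_nbhs_nbhs.
Qed.

Lemma smooth_at_continuous n (W : normedModType R) (f : 'rV[R]_n -> W) a :
  smooth_at f a -> {for a, continuous f}.
Proof.
by move=> /nbhs_singleton /(_ [::]); exact: differentiable_continuous.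
Qed.

Lemma smooth_at_id n (a : 'rV[R]_n) : smooth_at id a.
Proof.
apply/smooth_atP; exists setT; split=> //; first exact: openT.
case=> [|k]; first by rewrite smooth_on0.
rewrite smooth_onS; split=> // i.
have -> : (fun x : 'rV[R]_n => 'D_('e_i) id x) = cst 'e_i.
  by apply/funext => x; rewrite derive_id.
exact: smooth_on_cst.
Qed.

Lemma smooth_at_comp n m l (f : 'rV[R]_m -> 'rV[R]_l) (p : 'rV[R]_n -> 'rV[R]_m)
    a : smooth_at p a -> smooth_at f (p a) -> smooth_at (f \o p) a.
Proof.
move=> sp /smooth_atP[V [oV Vpa sf]].
have cp := smooth_at_continuous sp; move/smooth_atP : sp => [U [oU Ua sp]].
have /nbhs_interior : nbhs a (U `&` p @^-1` V).
  by apply: filterI; [exact: open_nbhs_nbhs|apply: cp; exact: open_nbhs_nbhs].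
rewrite nbhsE => -[U' [oU' U'a] U'U].
apply/smooth_atP; exists U'; split=> // k; apply/smooth_on_coord => // j.
apply: (@smooth_on_comp _ _ _ _ V _ (fun y => f y 0 j) p) => //.
- by move=> x /U'U/interior_subset[].
- by move/smooth_on_coord : (sf k); apply.
- by move=> s sk x /U'U/interior_subset[Ux _]; exact: (sp k).
Qed.

Definition diffeo_germ n (p : 'rV[R]_n -> 'rV[R]_n) :=
  [/\ p 0 = 0, smooth_at p 0 & exists p' : 'rV[R]_n -> 'rV[R]_n,
    [/\ p' 0 = 0, smooth_at p' 0,
        \forall q \near (0 : 'rV[R]_n), p' (p q) = q &
        \forall q \near (0 : 'rV[R]_n), p (p' q) = q]].

Lemma near_pullback n m (p : 'rV[R]_n -> 'rV[R]_m) (P : set 'rV[R]_m) :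
  p 0 = 0 -> smooth_at p 0 -> (\forall q \near (0 : 'rV[R]_m), P q) ->
  \forall q \near (0 : 'rV[R]_n), P (p q).
Proof. by move=> p0 /smooth_at_continuous cp nP; apply: cp; rewrite p0. Qed.

Lemma diffeo_germ_id n : diffeo_germ (@id 'rV[R]_n).
Proof.
split=> //; first exact: smooth_at_id.
by exists id; split=> //; [exact: smooth_at_id|exact: filterE|exact: filterE].
Qed.

Lemma diffeo_germ_comp n (p r : 'rV[R]_n -> 'rV[R]_n) :
  diffeo_germ p -> diffeo_germ r -> diffeo_germ (p \o r).
Proof.
move=> [p0 sp [p' [p'0 sp' p'p pp']]] [r0 sr [r' [r'0 sr' r'r rr']]]; split.
- by rewrite /= r0.
- by apply: smooth_at_comp; rewrite ?r0.
- exists (r' \o p'); split; first by rewrite /= p'0.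
  + by apply: smooth_at_comp; rewrite ?p'0.
  + by apply: filterS2 r'r (near_pullback r0 sr p'p) => q /= r'rq ->.
  + by apply: filterS2 pp' (near_pullback p'0 sp' rr') => q /= pp'q ->.
Qed.

End SmoothAt.

(* A space of germs at 0 of smooth maps, represented by maps defined on the
   whole of R^n.  The Whitney topology on germs at 0 is the coarsest one for
   which the k-jets at 0 are continuous for all k, that is, for which all the
   iterated partial derivatives at 0 are continuous.  It does not separate maps
   having the same germ, so passing to the quotient by equality of germs would
   not change the notions of open and of dense subset. *)
Record germs (R : realType) n (W : normedModType R) (P : set ('rV[R]_n -> W)) :=
  Germ { germ_fun :> 'rV[R]_n -> W ; germP : P germ_fun }.

Section WhitneyTopology.
Context (R : realType) n (W : normedModType R) (P : set ('rV[R]_n -> W)).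

Definition jet (f : germs P) : {ptws seq 'I_n -> W} := fun s => partials f s 0.

HB.instance Definition _ := gen_eqMixin (germs P).
HB.instance Definition _ := gen_choiceMixin (germs P).
HB.instance Definition _ := Topological.copy (germs P) (initial_topology jet).

End WhitneyTopology.

Definition generic {T : topologicalType} (A : set T) := open A /\ dense A.

Section Surfaces.
Context {R : realType}.
Local Notation plane := 'rV[R]_2.
Local Notation space := 'rV[R]_3.

Definition mdot (u v : space) : R := u 0 0 * v 0 0 + u 0 1 * v 0 1 - u 0 2 * v 0 2.

Definition det3 (a b c : space) : R := \det (col_mx a (col_mx b c) : 'M_3).

Definition mcross (a b : space) : space :=
  \row_j (mdot 'e_j 'e_j * det3 a b 'e_j).

Lemma mcrossP (a b c : space) : mdot (mcross a b) c = det3 a b c.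
Proof.
pose i2 : 'I_(1 + (1 + 1)) := rshift 1 (rshift 1 0).
pose M (v : space) : 'M[R]_(1 + (1 + 1), 3) := col_mx a (col_mx b v).
have M2 v j : M v i2 j = v 0 j by rewrite /M !col_mxEd.
have cofM v j : cofactor (M v) i2 j = cofactor (M 0) i2 j.
  congr (_ * \det _); apply/matrixP => i k; rewrite !mxE.
  case: splitP => // l; rewrite !mxE; case: splitP => // m; rewrite !ord1.
  by move=> le ie; have := neq_lift i2 i; rewrite -val_eqE [X in _ != X]ie le.
have detM v : det3 a b v = \sum_j v 0 j * cofactor (M 0) i2 j.
  by rewrite /det3 (expand_det_row _ i2); apply: eq_bigr => j _; rewrite cofM M2.
have e1 : lift ord0 ord0 = 1 :> 'I_3 by exact: val_inj.
have e2 : lift ord0 (lift ord0 ord0) = 2 :> 'I_3 by exact: val_inj.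
rewrite /mdot !mxE !detM !big_ord_recl !big_ord0 !e1 !e2 /mdot !mxE /=.
ring.
Qed.

Definition immersion_germ (x : plane -> space) :=
  smooth_at x 0 /\ row_free (\matrix_(i < 2) 'D_('e_i) x 0).

Definition param := germs immersion_germ.

Definition reparam (x y : param) :=
  exists2 p : plane -> plane, diffeo_germ p & \forall q \near (0 : plane), y q = x (p q).

Lemma reparam_refl x : reparam x x.
Proof. by exists id; [exact: diffeo_germ_id|exact: filterE]. Qed.

Lemma reparam_sym x y : reparam x y -> reparam y x.
Proof.
move=> [p [p0 sp [p' [p'0 sp' p'p pp']]] yx]; exists p'.
  by split=> //; exists p; split.
by apply: filterS2 pp' (near_pullback p'0 sp' yx) => q pp'q /= ->; rewrite pp'q.
Qed.

Lemma reparam_trans y x z : reparam x y -> reparam y z -> reparam x z.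
Proof.
move=> [p dp yx] [r dr zy]; exists (p \o r); first exact: diffeo_germ_comp.
have [r0 sr _] := dr.
by apply: filterS2 zy (near_pullback r0 sr yx) => q -> ->.
Qed.

Definition reparamb : rel param := fun x y => `[< reparam x y >].

Lemma reparamb_refl : reflexive reparamb.
Proof. by move=> x; apply/asboolP; exact: reparam_refl. Qed.

Lemma reparamb_sym : symmetric reparamb.
Proof.
by move=> x y; apply/asboolP/asboolP; exact: reparam_sym.
Qed.

Lemma reparamb_trans : transitive reparamb.
Proof.
by move=> y x z /asboolP xy /asboolP yz; apply/asboolP; exact: reparam_trans yz.
Qed.

Canonical reparam_equiv :=
  EquivRel reparamb reparamb_refl reparamb_sym reparamb_trans.

Definition surface_germ := quotient_topology {eq_quot reparam_equiv}%qT.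

Definition is_param_of (x : param) (M : surface_germ) :=
  (\pi_surface_germ x)%qT = M.

Definition Efun (x : plane -> space) q := mdot ('D_('e_0) x q) ('D_('e_0) x q).
Definition Ffun (x : plane -> space) q := mdot ('D_('e_0) x q) ('D_('e_1) x q).
Definition Gfun (x : plane -> space) q := mdot ('D_('e_1) x q) ('D_('e_1) x q).

Definition normal (x : plane -> space) q := mcross ('D_('e_0) x q) ('D_('e_1) x q).
Definition lbar (x : plane -> space) q := mdot (normal x q) (partials x [:: 0; 0] q).
Definition mbar (x : plane -> space) q := mdot (normal x q) (partials x [:: 0; 1] q).
Definition nbar (x : plane -> space) q := mdot (normal x q) (partials x [:: 1; 1] q).

Definition delta (x : plane -> space) q := Ffun x q ^+ 2 - Efun x q * Gfun x q.
Definition Hbar (x : plane -> space) q :=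
  lbar x q * Gfun x q - 2 * mbar x q * Ffun x q + nbar x q * Efun x q.

Definition singular_germ (g : plane -> R) :=
  g 0 = 0 /\ 'd g (0 : plane) = cst 0 :> (plane -> R).

Definition A1_germ (g : plane -> R) :=
  exists2 p : plane -> plane, diffeo_germ p & exists s1 s2 : bool,
    \forall q \near (0 : plane),
      g (p q) = (-1) ^+ s1 * (q 0 0 ^+ 2 + (-1) ^+ s2 * q 0 1 ^+ 2).

Definition G4 : set surface_germ :=
  [set M | exists x : param,
    [/\ is_param_of x M, 0 < delta x 0 & singular_germ (Hbar x)]].

Definition MCNC_A1 (M : surface_germ) :=
  forall x : param, is_param_of x M -> A1_germ (Hbar x).

(* The graph of a function over the coordinate plane spanned by the axes other
   than the i-th one; a is the projection of the base point to that plane, and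
   g q is the value of the function at a + q. *)
Definition monge (i : 'I_3) (a : plane) (g : plane -> R) (q : plane) : space :=
  \row_j (if unlift i j is Some k then (a + q) 0 k else g q).

Definition deformation_germ (h : 'rV[R]_(2 + 1) -> R) :=
  smooth_at h 0 /\ \forall q \near (0 : plane), h (row_mx q 0) = 0.

Definition deformation := germs deformation_germ.

(* (q, t) |-> Hbar_t q, where M_t is the graph of g + h(., t). *)
Definition Hbar_family (i : 'I_3) (a : plane) (g : plane -> R)
    (h : 'rV[R]_(2 + 1) -> R) (z : 'rV[R]_(2 + 1)) : R :=
  Hbar (monge i a (fun q => g q + h (row_mx q (rsubmx z)))) (lsubmx z).

(* F : (R^2 x R^m, 0) -> R is an R-versal unfolding of F(., 0) if every
   unfolding of F(., 0) is induced from F; no additive function of the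
   parameters is allowed, so constants count as unfolding terms. *)
Definition R_versal m (F : 'rV[R]_(2 + m) -> R) :=
  forall k (G : 'rV[R]_(2 + k) -> R), smooth_at G 0 ->
    (\forall q \near (0 : plane), G (row_mx q 0) = F (row_mx q 0)) ->
  exists (p : 'rV[R]_(2 + k) -> plane) (b : 'rV[R]_k -> 'rV[R]_m),
    [/\ smooth_at p 0, \forall q \near (0 : plane), p (row_mx q 0) = q,
        smooth_at b 0, b 0 = 0 &
        \forall z \near (0 : 'rV[R]_(2 + k)), G z = F (row_mx (p z) (b (rsubmx z)))].

Definition MCNC_generically_versal (M : surface_germ) :=
  forall (i : 'I_3) (a : plane) (g : plane -> R) (x : param),
    is_param_of x M -> germ_fun x = monge i a g ->
    generic [set h : deformation | R_versal (Hbar_family i a g h)].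

End Surfaces.

Arguments surface_germ R : clear implicits.
Arguments G4 R : clear implicits.

(* Main.v *)
Require Import Defs.
From mathcomp Require Import all_boot all_order all_algebra.
From mathcomp Require Import all_classical all_reals topology.
From mathcomp Require Import generic_quotient ring lra.
From mathcomp Require Import normedtype landau derive realfun.
Set Implicit Arguments.
Unset Strict Implicit.
Unset Printing Implicit Defensive.
Import Order.TTheory GRing.Theory Num.Theory.
Import numFieldNormedType.Exports.
Local Open Scope classical_set_scope.
Local Open Scope ring_scope.

(* Under a reparametrization p the function Hbar becomes J^3 (Hbar o p), with J the
   Jacobian determinant of p; hence at a singularity of the MCNC the nondegeneracy of
   the Hessian of Hbar does not depend on the parametrization, and by the Morse lemma
   it is equivalent to having type A1.  It is an open condition on the 4-jet, and it is
   dense because adding s u^2 v^2 N to a parametrization keeps the 1-jet of Hbar and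
   turns the determinant of its Hessian into a polynomial of degree 2 in s, whose
   leading coefficient is a nonzero multiple of EG - 4F^2 < 0.
   For a Monge family, the Morse lemma with parameters shows that the unfolding is
   versal if and only if the t-derivative of Hbar_t at the singularity is nonzero.
   This is again open, and perturbing h by s t (G u^2 / 2 - F u v + E v^2 / 2) changes
   this derivative by a nonzero multiple of s (E^2 + 2 F^2 + G^2). *)

(** Smoothness means differentiability of all iterated partials, so a constructed function
    (reciprocal, square root, implicit function, Hadamard quotient) is shown smooth by finding a
    class of differentiable functions that contains it and is stable under partial derivatives.
    Every coordinate change that is constructed is a composite of maps altering a single coordinate.
    The inverse function theorem then needs only monotonicity and intermediate values on a line, and
    the parameters of the Morse lemma are simply coordinates left alone. The Hessian determinant of
    Hbar is not a function of the surface germ; only its vanishing at a critical germ is. Hence the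
    exceptional set consists of the critical germs with zero determinant: it is closed among all
    parametrizations and invariant under reparametrization, so it descends to the quotient. This set
    controls both claims: once the Hessian is nondegenerate, versality is a condition on the
    deformation alone, and its density rests on delta being nonzero, which prevents E, F and G from
    vanishing together. *)

Section SmoothGerms.
Context {R : realType}.
Implicit Types n m : nat.

(** * Closure properties of smooth germs and rules for their derivatives *)

Lemma near_openP (T : topologicalType) (a : T) (P : set T) :
  (\forall x \near a, P x) ->
  exists U : set T, [/\ open U, U a & forall x, U x -> P x].
Proof. by rewrite /prop_near1 nbhsE => -[U [oU Ua] UP]; exists U. Qed.

Lemma near_partials n (W : normedModType R) (f g : 'rV[R]_n -> W) (a : 'rV[R]_n) s :
  {near a, f =1 g} -> {near a, partials f s =1 partials g s}.
Proof.
elim: s f g => [//|i s IH] f g /= fg; apply: IH.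
apply: filterS (near_join fg) => x fgx.
exact: near_eq_derive.
Qed.

Lemma eq_smooth_at n (W : normedModType R) (f g : 'rV[R]_n -> W) (a : 'rV[R]_n) :
  {near a, f =1 g} -> smooth_at f a -> smooth_at g a.
Proof.
move=> fg sf; apply: filterS2 (near_join fg) sf => x fgx sf s.
exact: near_eq_differentiable (near_partials s fgx) (sf s).
Qed.

Lemma smooth_at_near n (W : normedModType R) (f : 'rV[R]_n -> W) a :
  smooth_at f a -> \forall x \near a, smooth_at f x.
Proof. exact: near_join. Qed.

Lemma smooth_at_diff n (W : normedModType R) (f : 'rV[R]_n -> W) a :
  smooth_at f a -> differentiable f a.
Proof. by move=> /nbhs_singleton /(_ [::]). Qed.

Lemma smooth_at_derivable n (W : normedModType R) (f : 'rV[R]_n -> W) a v :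
  smooth_at f a -> derivable f a v.
Proof. by move=> sf; apply/diff_derivable/smooth_at_diff. Qed.

Lemma smooth_at_partial n (W : normedModType R) (f : 'rV[R]_n -> W) a i :
  smooth_at f a -> smooth_at (fun x => 'D_('e_i) f x) a.
Proof. by apply: filterS => x sf s; exact: (sf (i :: s)). Qed.

Lemma smooth_at_partials n (W : normedModType R) (f : 'rV[R]_n -> W) a s :
  smooth_at f a -> smooth_at (partials f s) a.
Proof. by elim: s f => [//|i s IH] f sf; apply/IH/smooth_at_partial. Qed.

Lemma smooth_at_partial_diff n (W : normedModType R) (f : 'rV[R]_n -> W) a i :
  smooth_at f a -> differentiable (fun x => 'D_('e_i) f x) a.
Proof. by move=> sf; exact/smooth_at_diff/smooth_at_partial. Qed.

(** Smoothness by coinduction: every iterated partial of a member of [C] agrees on [U] with a member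
    of [C], hence is differentiable there. The same [U] serves all orders. *)
Lemma smooth_at_coind n (W : normedModType R) (C : set ('rV[R]_n -> W))
    (U : set 'rV[R]_n) a f : open U ->
  (forall g, C g -> forall x, U x -> differentiable g x) ->
  (forall g i, C g ->
     exists2 h, C h & forall x, U x -> 'D_('e_i) g x = h x) ->
  U a -> C f -> smooth_at f a.
Proof.
move=> oU dC DC Ua Cf; apply/smooth_atP; exists U; split=> // k.
elim: k f Cf => [|k IH] f Cf; first by rewrite smooth_on0; exact: dC.
rewrite smooth_onS; split=> [|i]; first exact: dC.
have [h Ch fh] := DC _ i Cf.
by apply: eq_smooth_on (IH h Ch) => // x Ux; rewrite fh.
Qed.

Lemma smooth_at_cst n (W : normedModType R) (w : W) (a : 'rV[R]_n) :
  smooth_at (fun=> w) a.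
Proof.
by apply/smooth_atP; exists setT; split=> // [|k]; [exact: openT|exact: smooth_on_cst].
Qed.

Lemma smooth_at2P n (V W : normedModType R) (f : 'rV[R]_n -> V)
    (g : 'rV[R]_n -> W) a : smooth_at f a -> smooth_at g a ->
  exists U : set 'rV[R]_n, [/\ open U, U a, forall k, smooth_on U k f
    & forall k, smooth_on U k g].
Proof.
move=> /smooth_atP[U [oU Ua sf]] /smooth_atP[V' [oV Va sg]].
exists (U `&` V'); split=> [||k s sk x [Ux _]|k s sk x [_ Vx]] //.
- exact: openI.
- exact: (sf k).
- exact: (sg k).
Qed.

Lemma smooth_atD n (W : normedModType R) (f g : 'rV[R]_n -> W) a :
  smooth_at f a -> smooth_at g a -> smooth_at (fun x => f x + g x) a.
Proof.
move=> sf sg; have [U [oU Ua {}sf {}sg]] := smooth_at2P sf sg.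
by apply/smooth_atP; exists U; split=> // k; exact: smooth_onD.
Qed.

Lemma smooth_atM n (f g : 'rV[R]_n -> R) a :
  smooth_at f a -> smooth_at g a -> smooth_at (fun x => f x * g x) a.
Proof.
move=> sf sg; have [U [oU Ua {}sf {}sg]] := smooth_at2P sf sg.
by apply/smooth_atP; exists U; split=> // k; exact: smooth_onM.
Qed.

Lemma smooth_atN n (f : 'rV[R]_n -> R) a :
  smooth_at f a -> smooth_at (fun x => - f x) a.
Proof.
move=> sf; apply: eq_smooth_at (smooth_atM (smooth_at_cst (-1 : R) a) sf).
by apply: filterE => x; rewrite mulN1r.
Qed.

Lemma smooth_atB n (f g : 'rV[R]_n -> R) a :
  smooth_at f a -> smooth_at g a -> smooth_at (fun x => f x - g x) a.
Proof. by move=> sf sg; apply: smooth_atD => //; exact: smooth_atN. Qed.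

Lemma smooth_atX n (f : 'rV[R]_n -> R) a k :
  smooth_at f a -> smooth_at (fun x => f x ^+ k) a.
Proof.
move=> sf; elim: k => [|k IH]; first exact: smooth_at_cst.
by apply: eq_smooth_at (smooth_atM sf IH); apply: filterE => x; rewrite exprS.
Qed.

Lemma smooth_at_sum n m (f : 'I_m -> 'rV[R]_n -> R) a :
  (forall i, smooth_at (f i) a) -> smooth_at (fun x => \sum_i f i x) a.
Proof.
move=> sf; have -> : (fun x => \sum_i f i x) = \sum_i f i.
  by apply/funext => x; rewrite fct_sumE.
elim/big_ind : _ => //; first exact: smooth_at_cst.
by move=> g h sg sh; exact: smooth_atD.
Qed.

Lemma smooth_at_rowP n m (f : 'rV[R]_n -> 'rV[R]_m) a :
  smooth_at f a <-> (forall j, smooth_at (fun x => f x 0 j) a).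
Proof.
split=> [/smooth_atP[U [oU Ua sf]] j|sf].
  by apply/smooth_atP; exists U; split=> // k; move/smooth_on_coord: (sf k); apply.
have : \forall x \near a, forall j s, differentiable (partials (fun y => f y 0 j) s) x.
  by apply: (@filter_forall _ _ _ (nbhs a)) => j; exact: sf.
move=> /near_openP[U [oU Ua UP]].
apply/smooth_atP; exists U; split=> // k; apply/smooth_on_coord => // j s _ x Ux.
exact: UP.
Qed.

Lemma smooth_at_coord n m (f : 'rV[R]_n -> 'rV[R]_m) a j :
  smooth_at f a -> smooth_at (fun x => f x 0 j) a.
Proof. by move/smooth_at_rowP; apply. Qed.

Lemma smooth_at_proj n (a : 'rV[R]_n) j : smooth_at (fun x : 'rV[R]_n => x 0 j) a.
Proof. by apply: (@smooth_at_coord _ _ id); exact: smooth_at_id. Qed.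

Lemma smooth_at_scalarcomp n m (f : 'rV[R]_m -> R) (p : 'rV[R]_n -> 'rV[R]_m) a :
  smooth_at p a -> smooth_at f (p a) -> smooth_at (fun x => f (p x)) a.
Proof.
(* [smooth_at_comp] speaks of row-vector values, so the scalar function is viewed as a row of length
   1. *)
move=> sp sf; have : smooth_at ((fun y => f y *: ('e_0 : 'rV[R]_1)) \o p) a.
  apply: smooth_at_comp => //; apply/smooth_at_rowP => j.
  apply: eq_smooth_at (smooth_atM sf (smooth_at_cst (('e_0 : 'rV[R]_1) 0 j) _)).
  by apply: filterE => x; rewrite !mxE.
move=> /(smooth_at_coord 0); apply: eq_smooth_at; apply: filterE => x.
by rewrite !mxE !eqxx mulr1.
Qed.

Lemma deriveM_at n (f g : 'rV[R]_n -> R) x v :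
  differentiable f x -> differentiable g x ->
  'D_v (fun y => f y * g y) x = f x * 'D_v g x + g x * 'D_v f x.
Proof. by move=> df dg; rewrite -[RHS]deriveM//; exact: diff_derivable. Qed.

Lemma differentiableX_at n (f : 'rV[R]_n -> R) x k :
  differentiable f x -> differentiable (fun y => f y ^+ k) x.
Proof.
move=> df; elim: k => [|k IH]; first exact: differentiable_cst.
have -> : (fun y => f y ^+ k.+1) = f * (fun y => f y ^+ k).
  by apply/funext => y; rewrite exprS.
exact: differentiableM.
Qed.

Lemma deriveX_at n (f : 'rV[R]_n -> R) x v k : differentiable f x ->
  'D_v (fun y => f y ^+ k) x = k%:R * f x ^+ k.-1 * 'D_v f x.
Proof.
move=> df; elim: k => [|k IH]; first by rewrite [LHS]derive_cst !mul0r.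
have -> : (fun y => f y ^+ k.+1) = fun y => f y * f y ^+ k.
  by apply/funext => y; rewrite exprS.
rewrite deriveM_at ?IH//=; last exact: differentiableX_at.
by case: k {IH} => [|k] /=; rewrite ?exprS -?natr1; ring.
Qed.

Lemma deriveD_at n (W : normedModType R) (f g : 'rV[R]_n -> W) x v :
  differentiable f x -> differentiable g x ->
  'D_v (fun y => f y + g y) x = 'D_v f x + 'D_v g x.
Proof. by move=> df dg; rewrite -[RHS]deriveD//; exact: diff_derivable. Qed.

Lemma derive_chain n m (f : 'rV[R]_m -> R) (p : 'rV[R]_n -> 'rV[R]_m) x v :
  differentiable p x -> differentiable f (p x) ->
  'D_v (fun y => f (p y)) x =
  \sum_j 'D_('e_j) f (p x) * 'D_v (fun y => p y 0 j) x.
Proof.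
move=> dp df; rewrite [LHS](@deriveE _ _ _ (f \o p)); last exact: differentiable_comp.
rewrite diff_comp//= (row_sum_delta ('d p x v)) linear_sum.
apply: eq_bigr => j _; rewrite linearZ /= [RHS]mulrC.
have -> : 'D_v (fun y => p y 0 j) x = 'd p x v 0 j.
  by rewrite -deriveE// derive_mx ?mxE//; exact: diff_derivable.
by rewrite -(deriveE _ df).
Qed.

Lemma derive_proj n (x v : 'rV[R]_n) j : 'D_v (fun y : 'rV[R]_n => y 0 j) x = v 0 j.
Proof.
have := @derive_mx _ _ _ _ id x v (@derivable_id _ _ x v).
by rewrite derive_id => /rowP/(_ j); rewrite mxE.
Qed.

Lemma derive_coord n m (f : 'rV[R]_n -> 'rV[R]_m) x v j :
  differentiable f x -> 'D_v (fun y => f y 0 j) x = ('D_v f x) 0 j.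
Proof. by move=> df; rewrite derive_mx ?mxE//; exact: diff_derivable. Qed.

Lemma derive_sumE n (W : normedModType R) (f : 'rV[R]_n -> W) x v :
  differentiable f x -> 'D_v f x = \sum_j v 0 j *: 'D_('e_j) f x.
Proof.
move=> df; rewrite deriveE// {1}(row_sum_delta v) linear_sum.
by apply: eq_bigr => j _; rewrite linearZ /= -deriveE.
Qed.

Lemma smooth_atV n (f : 'rV[R]_n -> R) a :
  smooth_at f a -> f a != 0 -> smooth_at (fun x => (f x)^-1) a.
Proof.
move=> sf fa0; have cf := smooth_at_continuous sf.
have : \forall x \near a, smooth_at f x /\ f x != 0.
  by apply: filterI; [exact: smooth_at_near|exact: cvgr_neq0 cf fa0].
move=> /near_openP[U [oU Ua UP]].
(* Stable under derivatives, since D(h f^-k) = (Dh f - k h Df) f^-(k+1). *)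
pose C := [set g : 'rV[R]_n -> R | exists (h : 'rV[R]_n -> R) k,
  (forall x, U x -> smooth_at h x) /\ g = fun x => h x * (f x)^-1 ^+ k].
have df x : U x -> differentiable f x by move=> /UP[/smooth_at_diff].
have dV x : U x -> differentiable (fun y => (f y)^-1) x.
  by move=> Ux; have [_ fx0] := UP _ Ux; apply: differentiableV => //; exact: df.
have DV x v : U x -> 'D_v (fun y => (f y)^-1) x = - (f x)^-1 ^+ 2 * 'D_v f x.
  move=> Ux; have [_ fx0] := UP _ Ux.
  by rewrite [LHS]deriveV// ?exprVn//; exact/diff_derivable/df.
have dVX k x : U x -> differentiable (fun y => (f y)^-1 ^+ k) x.
  by move=> Ux; exact/differentiableX_at/dV.
apply: (@smooth_at_coind _ _ C U) => // [g [h [k [sh ->]]] x Ux|g i [h [k [sh ->]]]|].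
- by apply: differentiableM; [exact/smooth_at_diff/sh|exact: dVX].
- exists (fun x => ('D_('e_i) h x * f x - k%:R * h x * 'D_('e_i) f x)
     * (f x)^-1 ^+ k.+1).
    exists (fun x => 'D_('e_i) h x * f x - k%:R * h x * 'D_('e_i) f x), k.+1.
    split=> // x Ux; have [sfx _] := UP _ Ux; apply: smooth_atB; apply: smooth_atM => //.
    + exact/smooth_at_partial/sh.
    + by apply: smooth_atM; [exact: smooth_at_cst|exact: sh].
    + exact: smooth_at_partial.
  move=> x Ux; have [sfx fx0] := UP _ Ux.
  rewrite deriveM_at; [|exact/smooth_at_diff/sh|exact: dVX].
  rewrite (deriveX_at _ _ (dV _ Ux)) DV//=.
  by case: k => [|k] /=; rewrite !exprS -?natr1; field.
- by exists (fun=> 1 : R), 1%N; split=> [x _|]; [exact: smooth_at_cst|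
    apply/funext => x; rewrite mul1r expr1].
Qed.

End SmoothGerms.

(** * Mean value theorem on segments, and replacement of one coordinate *)

Section Segments.
Context {R : realType}.
Implicit Types n m : nat.

Lemma is_derive_line n (f : 'rV[R]_n -> R) (a v : 'rV[R]_n) (t : R) :
  differentiable f (a + t *: v) ->
  is_derive t 1 (fun s : R => f (a + s *: v)) ('D_v f (a + t *: v)).
Proof.
move=> df; have E : (fun h : R => h^-1 *: (f (a + (h *: 1 + t) *: v) - f (a + t *: v)))
   = (fun h : R => h^-1 *: ((f \o shift (a + t *: v)) (h *: v) - f (a + t *: v))).
  apply/funext => h /=; congr (_ *: (f _ - _)).
  by rewrite scalerDl /GRing.scale /= mulr1 addrCA.
split; last by rewrite /derive /= E.
by rewrite /derivable /= E; apply: (diff_derivable (v := v) df).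
Qed.

Lemma mvt_segment n (f : 'rV[R]_n -> R) (a v : 'rV[R]_n) :
  (forall t : R, 0 <= t <= 1 -> differentiable f (a + t *: v)) ->
  exists2 t : R, 0 <= t <= 1 & f (a + v) - f a = 'D_v f (a + t *: v).
Proof.
move=> df; pose g (s : R) := f (a + s *: v); pose D (s : R) : R := 'D_v f (a + s *: v).
have dg (t : R) : t \in `[0, 1] -> is_derive t 1 g (D t).
  by rewrite in_itv /= => t01; apply/is_derive_line/df.
have dg' (t : R) : t \in `]0, 1[ -> is_derive t 1 g (D t).
  by move=> t01; apply: dg; exact: subset_itv_oo_cc.
have cg : {within `[0, 1], continuous g}.
  by apply: derivable_within_continuous => t t01; have [] := dg t t01.
have [t t01] := MVT_segment ler01 dg' cg.
rewrite /g subr0 mulr1 scale1r scale0r addr0 => E.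
by exists t; rewrite ?in_itv// -E.
Qed.

Lemma derive_scale n (f : 'rV[R]_n -> R) (a v : 'rV[R]_n) (c : R) :
  differentiable f a -> 'D_(c *: v) f a = c * 'D_v f a.
Proof. by move=> df; rewrite !deriveE// linearZ. Qed.

Lemma diff_eq0 (V W : normedModType R) (r : V -> W) (a : V) : r a = 0 ->
  (forall e, 0 < e -> \forall x \near a, `|r x| <= e * `|x - a|) ->
  differentiable r a /\ forall v, 'd r a v = 0.
Proof.
move=> r0 re; pose Z : {linear V -> W} := \0.
have cZ : continuous Z by move=> x; exact: cvg_cst.
have rE : r \o shift a = cst (r a) + Z +o_ 0 id.
  apply/eqaddoP => e e0; have : \forall h \near (0 : V), `|r (h + a)| <= e * `|h|.
    rewrite (near_shift a); apply: filterS (re _ e0) => x.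
    by rewrite /= sub0r addrNK.
  by apply: filterS => h; rewrite !fctE /= /cst /= r0 add0r subr0.
have dZ := diff_unique cZ rE.
by split=> [|v]; [apply/diff_locallyP; rewrite dZ|rewrite dZ].
Qed.

Lemma differentiable_lipschitz (V W : normedModType R) (N : V -> W) (a : V) :
  differentiable N a ->
  exists2 C : R, 0 < C & \forall x \near a, `|N x - N a| <= C * `|x - a|.
Proof.
move=> dN; have cdN : continuous ('d N a) by exact: diff_continuous.
have [C C0 NC] := linear_lipschitz cdN.
exists (C + 1); first by rewrite addr_gt0.
have /eqaddoP/(_ _ (@ltr01 R)) := diff_locally dN.
move=> near0; have : \forall h \near (0 : V), 
    `|N (h + a) - (N a + 'd N a h)| <= `|h|.
  by apply: filterS near0 => h; rewrite !fctE /= /cst /= mul1r.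
rewrite (near_shift a); apply: filterS => x; rewrite /= sub0r addrNK => Nx.
rewrite -(subrK ('d N a (x - a)) (N x - N a)) (le_trans (ler_normD _ _))//.
by rewrite mulrDl mul1r [leRHS]addrC lerD// -addrA -opprD.
Qed.

(** N is Lipschitz at its zero a, so N (B - B a) is o(x - a) although B is only continuous, and the
    product behaves to first order like B a times N. This differentiates the implicit function and
    the Hadamard quotient, where one factor is known only by its continuity. *)
Lemma differentiable_mul0 n (N B : 'rV[R]_n -> R) (a : 'rV[R]_n) :
  differentiable N a -> N a = 0 -> {for a, continuous B} ->
  differentiable (fun x => N x * B x) a /\
  forall v, 'D_v (fun x => N x * B x) a = B a * 'D_v N a.
Proof.
move=> dN N0 cB; pose r x := N x * (B x - B a).
have [C C0 NC] := differentiable_lipschitz dN.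
have [||dr dr0] := @diff_eq0 _ _ r a; first by rewrite /r N0 mul0r.
  move=> e e0; have /cvgrPdist_le/(_ _ (divr_gt0 e0 C0)) := cB.
  apply: filterS2 NC => x; rewrite N0 subr0 => Nx Bx; rewrite normrM.
  rewrite [in leLHS]distrC (le_trans (ler_pM _ _ Nx Bx))//.
  by rewrite mulrC mulrA divfK ?gt_eqF.
have -> : (fun x => N x * B x) = r + (fun x => N x * cst (B a) x).
  by apply/funext => x; rewrite /r !fctE /=; ring.
have dc : differentiable (fun x => N x * cst (B a) x) a.
  by apply: differentiableM => //; exact: differentiable_cst.
split=> [|v]; first exact: differentiableD.
rewrite deriveD; [|exact: diff_derivable..].
rewrite (deriveM_at _ dN (@differentiable_cst _ _ _ (B a) a)).
by rewrite N0 mul0r add0r deriveE// dr0 add0r.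
Qed.

(** Slices, graphs and coordinate changes are all written with this map, so parameters remain
    coordinates of one fixed space instead of a factor of a product. *)
Definition upd n (i : 'I_n) (r : R) (q : 'rV[R]_n) : 'rV[R]_n :=
  \row_j if j == i then r else q 0 j.

Lemma updE n (i : 'I_n) r (q : 'rV[R]_n) j : upd i r q 0 j = if j == i then r else q 0 j.
Proof. by rewrite mxE. Qed.

Lemma upd_ii n (i : 'I_n) r (q : 'rV[R]_n) : upd i r q 0 i = r.
Proof. by rewrite updE eqxx. Qed.

Lemma upd_neq n (i j : 'I_n) r (q : 'rV[R]_n) : j != i -> upd i r q 0 j = q 0 j.
Proof. by rewrite updE => /negPf->. Qed.

Lemma upd_self n (i : 'I_n) (q : 'rV[R]_n) : upd i (q 0 i) q = q.
Proof. by apply/rowP => j; rewrite updE; case: eqP => // ->. Qed.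

Lemma upd_upd n (i : 'I_n) r s (q : 'rV[R]_n) : upd i r (upd i s q) = upd i r q.
Proof. by apply/rowP => j; rewrite !updE; case: eqP. Qed.

Lemma updC n (i j : 'I_n) r s (q : 'rV[R]_n) : i != j ->
  upd i r (upd j s q) = upd j s (upd i r q).
Proof.
move=> ij; apply/rowP => k; rewrite !updE; case: eqP => // ->.
by rewrite (negPf ij).
Qed.

Lemma upd0 n (i : 'I_n) : upd i 0 0 = 0.
Proof. by apply/rowP => j; rewrite updE !mxE if_same. Qed.

Lemma updD n (i : 'I_n) r s (q : 'rV[R]_n) : upd i (r + s) q = upd i r q + s *: 'e_i.
Proof.
apply/rowP => j; rewrite !mxE eqxx /=.
by case: eqP => _; rewrite ?mulr1 ?mulr0 ?addr0.
Qed.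

Lemma smooth_at_upd n m (i : 'I_m) (w : 'rV[R]_n -> R) (p : 'rV[R]_n -> 'rV[R]_m) a :
  smooth_at w a -> smooth_at p a -> smooth_at (fun q => upd i (w q) (p q)) a.
Proof.
move=> sw sp; apply/smooth_at_rowP => j.
have -> : (fun q => upd i (w q) (p q) 0 j) =
          if j == i then w else fun q => p q 0 j.
  by apply/funext => q; rewrite updE; case: eqP.
by case: eqP => // _; exact: smooth_at_coord.
Qed.

Lemma mvt_coord n (i : 'I_n) (f : 'rV[R]_n -> R) (q : 'rV[R]_n) (s t : R) :
  (forall u : R, 0 <= u <= 1 -> differentiable f (upd i (s + u * (t - s)) q)) ->
  exists2 u : R, 0 <= u <= 1 &
    f (upd i t q) - f (upd i s q) =
    (t - s) * 'D_('e_i) f (upd i (s + u * (t - s)) q).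
Proof.
move=> df; have E u : upd i s q + u *: ((t - s) *: 'e_i) = upd i (s + u * (t - s)) q.
  by rewrite scalerA -updD.
have [u u01|u u01] := @mvt_segment _ f (upd i s q) ((t - s) *: 'e_i).
  by rewrite E; exact: df.
have -> : upd i s q + (t - s) *: 'e_i = upd i t q by rewrite -updD subrKC.
by rewrite E => ->; exists u => //; rewrite derive_scale//; exact: df.
Qed.

Lemma norm_coord_le n (q : 'rV[R]_n) j : `|q 0 j| <= `|q|.
Proof.
have -> : `|q| = \big[Num.max/0]_ij `|q ij.1 ij.2| := mx_normrE q.
exact: (@le_bigmax_cond _ _ _ _ (0, j) xpredT (fun k => `|q k.1 k.2|)).
Qed.

Lemma norm_rV_lt n (q : 'rV[R]_n) (e : R) : 0 < e ->
  (`|q| < e) = [forall j, `|q 0 j| < e].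
Proof.
move=> e0; apply/idP/forallP => [qe j|qe]; first exact: le_lt_trans (norm_coord_le q j) qe.
have -> : `|q| = \big[Num.max/0]_ij `|q ij.1 ij.2| := mx_normrE q.
apply: bigmax_lt => // -[i j] _ /=.
by rewrite ord1.
Qed.

Lemma norm_upd_lt n (i : 'I_n) r (q : 'rV[R]_n) (e : R) :
  `|q| < e -> `|r| < e -> `|upd i r q| < e.
Proof.
move=> qe re; have e0 := le_lt_trans (normr_ge0 _) re.
rewrite norm_rV_lt//; apply/forallP => j; rewrite updE.
by case: eqP => // _; exact: le_lt_trans (norm_coord_le q j) qe.
Qed.

Lemma nbhs0_normP n (P : set 'rV[R]_n) :
  (\forall q \near (0 : 'rV[R]_n), P q) <->
  exists2 e : R, 0 < e & forall q, `|q| < e -> P q.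
Proof.
split=> [/nbhs_normP[e e0 eP]|[e e0 eP]].
  by exists e => // q qe; apply: eP; rewrite /= sub0r normrN.
by apply/nbhs_normP; exists e => // q /=; rewrite sub0r normrN; exact: eP.
Qed.

End Segments.

(** * Symmetry of second derivatives *)

Section Symmetry.
Context {R : realType}.
Implicit Types n : nat.

Lemma norm_delta_le1 n (i : 'I_n) : `|('e_i : 'rV[R]_n)| <= 1.
Proof.
have -> : `|('e_i : 'rV[R]_n)| = \big[Num.max/0]_ij `|'e_i ij.1 ij.2| :=
  mx_normrE ('e_i : 'rV[R]_n).
apply: bigmax_le => // -[k l] _ /=; rewrite mxE.
by case: (_ && _); rewrite ?normr1 ?normr0.
Qed.

Lemma derive_translate (V W : normedModType R) (f : V -> W) (x v b : V) :
  'D_v (fun y => f (y + b)) x = 'D_v f (x + b).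
Proof.
have E : (fun h : R => h^-1 *: (((fun y => f (y + b)) \o shift x) (h *: v) - f (x + b)))
   = (fun h : R => h^-1 *: ((f \o shift (x + b)) (h *: v) - f (x + b))).
  by apply/funext => h /=; rewrite addrA.
by rewrite /derive E.
Qed.

(** The mean value theorem is applied along ['e_i] to f(. + h e_j) - f, and then along ['e_j] to D_i
    f. *)
Lemma second_difference n (f : 'rV[R]_n -> R) a i j (h e : R) :
  (forall x, `|x - a| < e -> smooth_at f x) -> 0 < h -> 2 * h < e ->
  exists2 x, `|x - a| <= 2 * h &
    f (a + h *: 'e_i + h *: 'e_j) - f (a + h *: 'e_i) - (f (a + h *: 'e_j) - f a)
    = h * h * 'D_('e_j) (fun x => 'D_('e_i) f x) x.
Proof.
move=> sf h0 he.
have hn (u : R) k : 0 <= u <= 1 -> `|u *: (h *: ('e_k : 'rV[R]_n))| <= h.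
  move=> /andP[u0 u1]; rewrite !normrZ (ger0_norm u0) (gtr0_norm h0) -[leRHS]mul1r.
  by apply: ler_pM => //; [rewrite mulr_ge0// ltW|rewrite ler_piMr ?norm_delta_le1// ltW].
have hn1 k : `|h *: ('e_k : 'rV[R]_n)| <= h.
  by rewrite -[X in `|X|]scale1r hn// ler01 lexx.
have h2 : h + h = 2 * h by ring.
have H (u : R) : 0 <= u <= 1 ->
    `|a + u *: (h *: 'e_i) + h *: 'e_j - a| < e /\ `|a + u *: (h *: 'e_i) - a| < e.
  move=> u01; rewrite addrAC [a + _ - a]addrAC subrr add0r.
  split; last by rewrite (le_lt_trans (hn _ i u01))// (lt_trans _ he)// -h2 ltrDl.
  rewrite (le_lt_trans _ he)// -h2 (le_trans (ler_normD _ _))//.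
  by rewrite lerD// hn.
have ds x : differentiable (fun y : 'rV[R]_n => y + h *: 'e_j) x.
  by apply: differentiableD => //; exact: differentiable_cst.
have dfs x : `|x + h *: 'e_j - a| < e ->
    differentiable (fun y => f (y + h *: 'e_j)) x.
  by move=> xe; apply: (differentiable_comp (ds x)); apply/smooth_at_diff/sf.
have [|u u01] := @mvt_segment _ _ (fun x => f (x + h *: 'e_j) - f x) a (h *: 'e_i).
  move=> u /H[u1 u2].
  apply: differentiableB; [exact: dfs|exact/smooth_at_diff/sf].
have [u1 u2] := H _ u01.
rewrite deriveB; [|exact/diff_derivable/dfs|exact/smooth_at_derivable/sf].
have -> : 'D_(h *: 'e_i) (fun y => f (y + h *: 'e_j)) (a + u *: (h *: 'e_i)) =
          'D_(h *: 'e_i) f (a + u *: (h *: 'e_i) + h *: 'e_j).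
  exact: derive_translate.
rewrite !derive_scale; [|exact/smooth_at_diff/sf..].
rewrite -mulrBr.
have [|t t01] := @mvt_segment _ _ (fun x => 'D_('e_i) f x)
    (a + u *: (h *: 'e_i)) (h *: 'e_j).
  move=> t t01; apply: smooth_at_partial_diff; apply: sf.
  rewrite addrAC [a + _ - a]addrAC subrr add0r (le_lt_trans _ he)// -h2.
  by rewrite (le_trans (ler_normD _ _))// lerD// hn.
have xe : `|a + u *: (h *: 'e_i) + t *: (h *: 'e_j) - a| <= 2 * h.
  rewrite addrAC [a + _ - a]addrAC subrr add0r -h2.
  by rewrite (le_trans (ler_normD _ _))// lerD// hn.
rewrite derive_scale; last first.
  by apply: smooth_at_partial_diff; apply: sf; exact: le_lt_trans xe he.
move=> -> E; exists (a + u *: (h *: 'e_i) + t *: (h *: 'e_j)) => //.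
by rewrite -mulrA -E; ring.
Qed.

(** The second difference is symmetric in i and j, so the two mixed derivatives take a common value
    at two points close to a; their continuity at a concludes. *)
Lemma derive_comm n (f : 'rV[R]_n -> R) a i j : smooth_at f a ->
  'D_('e_j) (fun x => 'D_('e_i) f x) a = 'D_('e_i) (fun x => 'D_('e_j) f x) a.
Proof.
have alg (X A B C : R) : X - A - (B - C) = X - B - (A - C) by ring.
have close (A B X Y e : R) : `|A - X| <= e / 2 -> `|B - Y| <= e / 2 -> X = Y ->
    `|A - B| <= 0 + e.
  by rewrite !ler_norml => /andP[? ?] /andP[? ?] ?; lra.
move=> sf; apply/eqP; rewrite -subr_eq0 -normr_le0; apply/ler_addgt0Pr => e e0.
have cD k l : {for a, continuous (fun x => 'D_('e_l) (fun x => 'D_('e_k) f x) x)}.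
  exact/smooth_at_continuous/smooth_at_partial/smooth_at_partial.
have e2 : 0 < e / 2 by rewrite divr_gt0.
have near2 : \forall x \near a, [/\ smooth_at f x,
  `|'D_('e_j) (fun x => 'D_('e_i) f x) a - 'D_('e_j) (fun x => 'D_('e_i) f x) x| <= e / 2 &
  `|'D_('e_i) (fun x => 'D_('e_j) f x) a - 'D_('e_i) (fun x => 'D_('e_j) f x) x| <= e / 2].
  have /cvgrPdist_le/(_ _ e2) ij := cD i j.
  have /cvgrPdist_le/(_ _ e2) ji := cD j i.
  by apply: filterS3 (smooth_at_near sf) ij ji => x h1 h2 h3; exact: And3 h1 h2 h3.
have [d d0 dP] := (nbhs_normP _ _).1 near2.
have {}dP x : `|x - a| < d -> _ := fun xd => dP x (eq_ind _ (fun r => r < d) xd _ (distrC _ _)).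
(* [second_difference] yields points within 2h of a, and h = d/3 keeps them in the ball of radius
   d. *)
have h0 : 0 < d / 3 by rewrite divr_gt0.
have hd : 2 * (d / 3) < d by lra.
have sfd x : `|x - a| < d -> smooth_at f x by move=> /dP[].
have [x xa xE] := second_difference i j sfd h0 hd.
have [y ya yE] := second_difference j i sfd h0 hd.
have : 'D_('e_j) (fun x => 'D_('e_i) f x) x = 'D_('e_i) (fun x => 'D_('e_j) f x) y.
  apply: (mulfI (mulf_neq0 (lt0r_neq0 h0) (lt0r_neq0 h0))).
  apply: (eq_trans (esym xE) (eq_trans _ yE)).
  by rewrite [a + _ *: 'e_i + _]addrAC alg.
have [_ Ax _] := dP _ (le_lt_trans xa hd).
have [_ _ By] := dP _ (le_lt_trans ya hd).
exact: close Ax By.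
Qed.

End Symmetry.

Lemma near_norm_lt {R : realType} n (y : 'rV[R]_n) (c : R) :
  `|y| < c -> \forall x \near y, `|x| < c.
Proof.
move=> yc; apply/nbhs_normP; exists (c - `|y|) => [|x] /=; first by rewrite subr_gt0.
rewrite ltrBrDl distrC => /(le_lt_trans _); apply.
by rewrite -{1}(subrKC y x) ler_normD.
Qed.

Lemma smooth_at_gt0 {R : realType} n (f : 'rV[R]_n -> R) a :
  smooth_at f a -> 0 < f a -> \forall x \near a, 0 < f x.
Proof. by move=> /smooth_at_continuous cf fa; exact: cvgr_gt cf _ fa. Qed.

Lemma continuous_distP {R : realType} (V W : normedModType R) (f : V -> W) a :
  {for a, continuous f} <->
  forall e, 0 < e -> \forall x \near a, `|f a - f x| < e.
Proof. by split => [/cvgrPdist_lt|] cf //; apply/cvgrPdist_lt. Qed.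

Lemma derive_upd {R : realType} n (i k : 'I_n) (t : R) (y v : 'rV[R]_n) :
  'D_v (fun x => upd i t x 0 k) y = if k == i then 0 else v 0 k.
Proof.
have -> : (fun x : 'rV[R]_n => upd i t x 0 k) =
          if k == i then fun=> t else fun x => x 0 k.
  by apply/funext => x; rewrite updE; case: eqP.
by case: eqP => _; [rewrite derive_cst|rewrite derive_proj].
Qed.

Lemma open_norm_lt {R : realType} n (c : R) : open [set x : 'rV[R]_n | `|x| < c].
Proof. by rewrite openE => x xc; exact: near_norm_lt. Qed.

Lemma upd_addE {R : realType} n (i : 'I_n) (r : R) (q : 'rV[R]_n) :
  upd i r q = q + (r - q 0 i) *: 'e_i.
Proof. by rewrite -{2}(upd_self i q) -updD subrKC. Qed.

Lemma differentiable_upd {R : realType} n (i : 'I_n) (f : 'rV[R]_n -> R)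
    (x : 'rV[R]_n) :
  differentiable f x -> differentiable (fun y => upd i (f y) y) x.
Proof.
move=> df; rewrite (_ : (fun y => _) = id + (fun y => (f y - y 0 i) *: 'e_i)).
  apply: differentiableD => //; apply: differentiableZl.
  apply: differentiableB => //; exact/smooth_at_diff/smooth_at_proj.
by apply/funext => y; rewrite upd_addE.
Qed.

(** * Inverting a map that changes a single coordinate *)

Section ImplicitFunction.
Context {R : realType} {n : nat} (i : 'I_n) (w : 'rV[R]_n -> R) (e d r : R).
Context (sw : forall q : 'rV[R]_n, `|q| < e -> smooth_at w q).
Context (pw : forall q : 'rV[R]_n, `|q| < e -> 0 < 'D_('e_i) w q).
Context (r0 : 0 < r) (re : r < e) (de : d <= e).
Context (bw : forall y : 'rV[R]_n, `|y| < d ->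
  w (upd i (- r) y) < y 0 i /\ y 0 i < w (upd i r y)).

Let between (s t u : R) : `|s| < e -> `|t| < e -> 0 <= u <= 1 ->
  `|s + u * (t - s)| < e.
Proof.
move=> se te /andP[u0 u1].
have -> : s + u * (t - s) = (1 - u) * s + u * t by ring.
have [->|un] := eqVneq u 1; first by rewrite subrr mul0r add0r mul1r.
have u1' : 0 < 1 - u by rewrite subr_gt0 lt_neqAle un.
rewrite (le_lt_trans (ler_normD _ _))// !normrM (gtr0_norm u1') (ger0_norm u0).
rewrite [ltRHS](_ : _ = (1 - u) * e + u * e); last by ring.
by rewrite ltr_leD ?ltr_pM2l// ler_wpM2l// ltW.
Qed.

Lemma implicit_mvt (y : 'rV[R]_n) (s t : R) : `|y| < e -> `|s| < e -> `|t| < e ->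
  exists2 u : R, 0 <= u <= 1 & w (upd i t y) - w (upd i s y) =
    (t - s) * 'D_('e_i) w (upd i (s + u * (t - s)) y).
Proof.
move=> ye se te; apply: mvt_coord => u u01.
by apply/smooth_at_diff/sw/norm_upd_lt => //; exact: between.
Qed.

Lemma implicit_lt (y : 'rV[R]_n) (s t : R) : `|y| < e -> `|s| < e -> `|t| < e ->
  s < t -> w (upd i s y) < w (upd i t y).
Proof.
move=> ye se te st; rewrite -subr_gt0.
have [u u01 ->] := implicit_mvt ye se te.
by rewrite mulr_gt0 ?subr_gt0//; apply/pw/norm_upd_lt => //; exact: between.
Qed.

Lemma implicit_lt_inv (y : 'rV[R]_n) (s t : R) : `|y| < e -> `|s| < e -> `|t| < e ->
  w (upd i s y) < w (upd i t y) -> s < t.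
Proof.
move=> ye se te wst; rewrite ltNge; apply/negP; rewrite le_eqVlt => /orP[/eqP st|ts].
  by move: wst; rewrite st ltxx.
by have := lt_trans wst (implicit_lt ye te se ts); rewrite ltxx.
Qed.

(** Inverse of w along the i-th coordinate: on the ball of radius e, w is smooth and increasing in
    that coordinate, and for y in the ball of radius d the values at -r and r enclose [y 0 i]. The
    default 0 is taken only where no solution exists, which does not occur for |y| < d. *)
Definition implicit (y : 'rV[R]_n) : R :=
  xget 0 [set t | `|t| <= r /\ w (upd i t y) = y 0 i].

Lemma implicitP (y : 'rV[R]_n) : `|y| < d ->
  `|implicit y| <= r /\ w (upd i (implicit y) y) = y 0 i.
Proof.
move=> yd; rewrite /implicit; case: xgetP => [//|none].
have ye := lt_le_trans yd de; have [b1 b2] := bw yd.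
have rr : - r <= r by rewrite (@le_trans _ _ 0) ?oppr_le0 ?ltW.
pose g (t : R) := w (upd i t y).
have cg : {within `[- r, r], continuous g}.
  apply: derivable_within_continuous => t; rewrite in_itv /= -ler_norml => tr.
  have gE : g = fun s : R => w (upd i 0 y + s *: 'e_i).
    by apply/funext => s; rewrite -updD add0r.
  rewrite gE; have [] := @is_derive_line _ _ w (upd i 0 y) 'e_i t _ => //.
  rewrite -updD add0r; apply/smooth_at_diff/sw/norm_upd_lt => //.
  exact: le_lt_trans tr re.
have [|t] := @IVT R g (- r) r (y 0 i) rr cg.
  by rewrite ge_min le_max (ltW b1) (ltW b2) orbT.
by rewrite in_itv /= -ler_norml => tr gt; case: (none t).
Qed.

Let implicit_lte (y : 'rV[R]_n) : `|y| < d -> `|implicit y| < e.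
Proof. by move=> /implicitP[/le_lt_trans + _]; apply. Qed.

Lemma implicit_uniq (y : 'rV[R]_n) t : `|y| < d -> `|t| < e -> w (upd i t y) = y 0 i ->
  implicit y = t.
Proof.
move=> yd te wt; have ye := lt_le_trans yd de.
have [_ wi] := implicitP yd; have ie := implicit_lte yd.
have [it|ti|//] := ltgtP (implicit y) t.
  by have := implicit_lt ye ie te it; rewrite wi wt ltxx.
by have := implicit_lt ye te ie ti; rewrite wi wt ltxx.
Qed.

Let smooth_w_upd t (y : 'rV[R]_n) : `|y| < e -> `|t| < e -> smooth_at (fun x => w (upd i t x)) y.
Proof.
move=> ye te; apply: smooth_at_scalarcomp; last exact/sw/norm_upd_lt.
by apply: smooth_at_upd; [exact: smooth_at_cst|exact: smooth_at_id].
Qed.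

Lemma implicit_continuous (y : 'rV[R]_n) : `|y| < d -> {for y, continuous implicit}.
Proof.
move=> yd; have ye := lt_le_trans yd de.
have [ir wi] := implicitP yd; have ie := implicit_lte yd.
apply/continuous_distP => eps eps0.
(* With |t| <= r, the bound h < e - r keeps t - h and t + h where w is monotone. The strict
   inequalities at these two points persist for x near y and trap [implicit x] between them. *)
pose h := Num.min eps (e - r) / 2.
have m0 : 0 < Num.min eps (e - r) by rewrite lt_min eps0 subr_gt0.
have h0 : 0 < h by rewrite divr_gt0.
have heps : h < eps.
  have : h < Num.min eps (e - r) by rewrite ltr_pdivrMr// ltr_pMr// ltr1n.
  by rewrite lt_min => /andP[].
have her : h < e - r.
  have : h < Num.min eps (e - r) by rewrite ltr_pdivrMr// ltr_pMr// ltr1n.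
  by rewrite lt_min => /andP[].
set t := implicit y in ir wi ie *.
have t1e : `|t - h| < e.
  rewrite (le_lt_trans (ler_normB _ _))// (gtr0_norm h0).
  by rewrite (le_lt_trans (lerD ir (lexx h)))// addrC -ltrBrDr.
have t2e : `|t + h| < e.
  rewrite (le_lt_trans (ler_normD _ _))// (gtr0_norm h0).
  by rewrite (le_lt_trans (lerD ir (lexx h)))// addrC -ltrBrDr.
have n1 : \forall x \near y, 0 < (x : 'rV[R]_n) 0 i - w (upd i (t - h) x).
  apply: (smooth_at_gt0 (smooth_atB (smooth_at_proj y i) (smooth_w_upd ye t1e))).
  by rewrite /= -wi subr_gt0 implicit_lt// ltrBlDr ltrDl.
have n2 : \forall x \near y, 0 < w (upd i (t + h) x) - (x : 'rV[R]_n) 0 i.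
  apply: (smooth_at_gt0 (smooth_atB (smooth_w_upd ye t2e) (smooth_at_proj y i))).
  by rewrite /= -wi subr_gt0 implicit_lt// ltrDl.
apply: filterS3 (near_norm_lt yd) n1 n2 => x xd.
have xe := lt_le_trans xd de.
rewrite !subr_gt0; have [_ <-] := implicitP xd.
move=> /(implicit_lt_inv xe t1e (implicit_lte xd)) a1.
move=> /(implicit_lt_inv xe (implicit_lte xd) t2e) a2.
by rewrite (lt_trans _ heps)// ltr_norml ltrBrDr addrC ltrBlDr a2 ltrBlDr addrC -ltrBlDr a1.
Qed.

Definition implicit_graph (y : 'rV[R]_n) := upd i (implicit y) y.

Lemma implicit_graph_lt (y : 'rV[R]_n) : `|y| < d -> `|implicit_graph y| < e.
Proof.
by move=> yd; apply: norm_upd_lt; [exact: lt_le_trans yd de|exact: implicit_lte].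
Qed.

(** The mean value theorem gives [implicit x - t] = N x / D_i w (z x) with t = [implicit y]. Here N
    is smooth and vanishes at y while the other factor is merely continuous at y, which is the
    situation of [differentiable_mul0]. *)
Lemma implicit_diff (y : 'rV[R]_n) : `|y| < d -> differentiable implicit y /\
  forall j, 'D_('e_j) implicit y =
    (if j == i then 1 else - 'D_('e_j) w (implicit_graph y))
    / 'D_('e_i) w (implicit_graph y).
Proof.
move=> yd; have ye := lt_le_trans yd de; have ie := implicit_lte yd.
have [_ wi] := implicitP yd.
set t := implicit y in wi ie *.
have mvt (x : 'rV[R]_n) : exists u : R, `|x| < d -> 0 <= u <= 1 /\
    w (upd i (implicit x) x) - w (upd i t x) = (implicit x - t) *
      'D_('e_i) w (upd i (t + u * (implicit x - t)) x).
  have [xd|] := pselect (`|x| < d); last by exists 0.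
  have [u u01 uE] := implicit_mvt (lt_le_trans xd de) ie (implicit_lte xd).
  by exists u.
have [u uP] := choice mvt.
(* The mean value parameter u comes from choice and may be discontinuous; z is still continuous at y
   because u is bounded and [implicit x - t] tends to 0. *)
pose z x := upd i (t + u x * (implicit x - t)) x.
have zy : z y = implicit_graph y by rewrite /z -/t subrr mulr0 addr0.
pose N (x : 'rV[R]_n) := x 0 i - w (upd i t x).
pose B (x : 'rV[R]_n) := ('D_('e_i) w (z x))^-1.
have sN : smooth_at N y by apply: smooth_atB; [exact: smooth_at_proj|exact: smooth_w_upd].
have N0 : N y = 0 by rewrite /N wi subrr.
have ze x : `|x| < d -> `|z x| < e.
  move=> xd; have [u01 _] := uP x xd.
  by apply: norm_upd_lt; [exact: lt_le_trans xd de|exact: between (implicit_lte xd) _].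
have Dw0 x : `|x| < d -> 'D_('e_i) w (z x) != 0 by move=> /ze/pw/lt0r_neq0.
have cz : {for y, continuous z}.
  have ct := implicit_continuous yd.
  apply/continuous_distP => eps eps0; have /continuous_distP/(_ _ eps0) := ct.
  have : \forall x \near y, `|y - x| < eps.
    by have /continuous_distP/(_ _ eps0) : {for y, continuous (@id 'rV[R]_n)} by [].
  apply: filterS3 (near_norm_lt yd) => x xd yx tx; have [/andP[u0 u1] _] := uP x xd.
  rewrite zy norm_rV_lt//; apply/forallP => j; rewrite !mxE; case: eqP => _.
    rewrite opprD addrA subrr add0r normrN normrM (ger0_norm u0).
    by rewrite (le_lt_trans _ tx)// distrC ler_piMl.
  have := le_lt_trans (norm_coord_le (y - x) j) yx.
  by rewrite !mxE.
have cB : {for y, continuous B}.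
  apply: (continuous_comp (g := fun q => ('D_('e_i) w q)^-1)) => //.
  apply: smooth_at_continuous; apply: smooth_atV; last exact: Dw0.
  by apply/smooth_at_partial/sw/ze.
have [dNB DNB] := differentiable_mul0 (smooth_at_diff sN) N0 cB.
have E : {near y, (fun x => N x * B x + t) =1 implicit}.
  apply: filterS (near_norm_lt yd) => x xd; have [_] := uP x xd.
  have [_ ->] := implicitP xd; rewrite -/(N x) => ->.
  by rewrite /B mulfK ?subrK//; exact: Dw0.
have dt : differentiable (fun=> t : R) y := @differentiable_cst _ _ _ t y.
split.
  by apply: near_eq_differentiable E _; exact: differentiableD.
move=> j; rewrite -(near_eq_derive _ E) (deriveD_at _ dNB dt).
rewrite derive_cst addr0 DNB /B zy mulrC; congr (_ / _).
rewrite /N [LHS]deriveB; [|exact/smooth_at_derivable/smooth_at_proj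
  |exact/smooth_at_derivable/smooth_w_upd].
rewrite derive_proj mxE eqxx /=.
rewrite (derive_chain (p := upd i t)); last first.
- exact/smooth_at_diff/sw/implicit_graph_lt.
- apply: smooth_at_diff.
  by apply: smooth_at_upd; [exact: smooth_at_cst|exact: smooth_at_id].
rewrite (bigD1 j)//= big1 => [|k kj]; rewrite derive_upd; last first.
  by rewrite mxE (negPf kj) andbF if_same mulr0.
rewrite addr0 mxE !eqxx /=; have [_|ji] := eqVneq j i.
  by rewrite mulr0 subr0.
by rewrite mulr1 mulr0n sub0r.
Qed.

Lemma implicit_graph_smooth (y : 'rV[R]_n) :
  `|y| < d -> smooth_at implicit_graph y.
Proof.
move=> yd; pose U := [set x : 'rV[R]_n | `|x| < d].
(* The derivatives of the graph map are rational expressions in the partials of w evaluated on the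
   graph, so composites with the graph map are stable under derivatives. *)
pose C := [set g : 'rV[R]_n -> R | exists2 u : 'rV[R]_n -> R,
  (forall q, `|q| < e -> smooth_at u q) & g = fun x => u (implicit_graph x)].
have dG x : U x -> differentiable implicit_graph x.
  by move=> Ux; apply: differentiable_upd; case: (implicit_diff Ux).
have DG x k j : U x -> 'D_('e_j) (fun z => implicit_graph z 0 k) x =
    if k == i then (if j == i then 1 else - 'D_('e_j) w (implicit_graph x))
      / 'D_('e_i) w (implicit_graph x) else (k == j)%:R.
  move=> Ux; have [_ Dx] := implicit_diff Ux; rewrite -Dx.
  have -> : (fun z => implicit_graph z 0 k) =
      if k == i then implicit else fun z => z 0 k.
    by apply/funext => z; rewrite updE; case: eqP.
  by case: eqP => // _; rewrite derive_proj mxE eqxx.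
have CU g x : C g -> U x -> smooth_at g x.
  move=> Cg Ux; apply: (@smooth_at_coind _ _ _ C U) => //.
  - exact: open_norm_lt.
  - move=> _ [u su ->] z Uz; apply: differentiable_comp; first exact: dG.
    exact/smooth_at_diff/su/implicit_graph_lt.
  - move=> _ j [u su ->].
    exists (fun z => \sum_k 'D_('e_k) u (implicit_graph z) *
      if k == i then (if j == i then 1 else - 'D_('e_j) w (implicit_graph z))
      / 'D_('e_i) w (implicit_graph z) else (k == j)%:R).
      exists (fun z => \sum_k 'D_('e_k) u z *
        if k == i then (if j == i then 1 else - 'D_('e_j) w z)
        / 'D_('e_i) w z else (k == j)%:R) => // q qe.
      apply: smooth_at_sum => k; apply: smooth_atM; first exact/smooth_at_partial/su.
      case: eqP => _; last exact: smooth_at_cst.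
      apply: smooth_atM; last first.
        by apply: smooth_atV; [exact/smooth_at_partial/sw|exact/lt0r_neq0/pw].
      case: eqP => _; first exact: smooth_at_cst.
      exact/smooth_atN/smooth_at_partial/sw.
    move=> z Uz; rewrite (derive_chain _ (dG _ Uz) (smooth_at_diff (su _ (implicit_graph_lt Uz)))).
    by apply: eq_bigr => k _; rewrite DG.
apply/smooth_at_rowP => j; apply: CU => //.
by exists (fun q => q 0 j) => // q _; exact: smooth_at_proj.
Qed.

End ImplicitFunction.

Lemma upd_diffeo_gt0 {R : realType} n (i : 'I_n) (w : 'rV[R]_n -> R) :
  smooth_at w 0 -> w 0 = 0 -> 0 < 'D_('e_i) w 0 ->
  diffeo_germ (fun q => upd i (w q) q).
Proof.
move=> sw w0 Dw0.
have [e e0 eP] : exists2 e : R, 0 < e & forall q : 'rV[R]_n, `|q| < e ->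
    smooth_at w q /\ 0 < 'D_('e_i) w q.
  apply/nbhs0_normP; apply: filterI; first exact: smooth_at_near.
  by apply: smooth_at_gt0 => //; exact: smooth_at_partial.
have sw' q : `|q| < e -> smooth_at w q by move=> /eP[].
have pw q : `|q| < e -> 0 < 'D_('e_i) w q by move=> /eP[].
pose r := e / 2; have r0 : 0 < r by rewrite divr_gt0.
have re : r < e by rewrite ltr_pdivrMr// ltr_pMr// ltr1n.
have n0e : `|0 : 'rV[R]_n| < e by rewrite normr0.
have re' : `|r| < e by rewrite gtr0_norm.
have Nre : `|- r| < e by rewrite normrN.
have sP t : `|t| < e -> smooth_at (fun y => w (upd i t y)) 0.
  move=> te; apply: smooth_at_scalarcomp; last exact/sw'/norm_upd_lt.
  by apply: smooth_at_upd; [exact: smooth_at_cst|exact: smooth_at_id].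
have zero : `|0 : R| < e by rewrite normr0.
(* At y = 0 the inequalities read w(-r e_i) < 0 < w(r e_i), by monotonicity; continuity extends them
   to small y. *)
have [d' d'0 dP] : exists2 d : R, 0 < d & forall y : 'rV[R]_n, `|y| < d ->
    w (upd i (- r) y) < y 0 i /\ y 0 i < w (upd i r y).
  apply/nbhs0_normP; apply: filterI.
    have N0 : - r < 0 by rewrite oppr_lt0.
    have := implicit_lt sw' pw n0e Nre zero N0; rewrite upd0 w0 => wN.
    have S0 := smooth_atB (smooth_at_proj 0 i) (sP _ Nre).
    apply: filterS (smooth_at_gt0 S0 _) => [y|]; first by rewrite subr_gt0.
    by rewrite mxE subr_gt0.
  have := implicit_lt sw' pw n0e zero re' r0; rewrite upd0 w0 => wr.
  have S0 := smooth_atB (sP _ re') (smooth_at_proj 0 i).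
  apply: filterS (smooth_at_gt0 S0 _) => [y|]; first by rewrite subr_gt0.
  by rewrite mxE subr_gt0.
pose d := Num.min d' e; have d0 : 0 < d by rewrite lt_min d'0 e0.
have de : d <= e by rewrite ge_min lexx orbT.
have bw y : `|y| < d -> w (upd i (- r) y) < y 0 i /\ y 0 i < w (upd i r y).
  by rewrite lt_min => /andP[/dP].
pose P := implicit_graph i w r.
have n0d : `|0 : 'rV[R]_n| < d by rewrite normr0.
have P0 : P 0 = 0.
  rewrite /P /implicit_graph (implicit_uniq sw' pw r0 re de bw n0d zero) ?upd0//.
  by rewrite w0 mxE.
have sPhi : smooth_at (fun q : 'rV[R]_n => upd i (w q) q) 0.
  by apply: smooth_at_upd => //; exact: smooth_at_id.
have Phi0 : upd i (w 0) 0 = 0 by rewrite w0 upd0.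
split=> //; exists P; split => //.
- exact: (implicit_graph_smooth sw' pw r0 re de bw n0d).
- have near1 : \forall q \near (0 : 'rV[R]_n), `|upd i (w q) q| < d.
    exact: (near_pullback (p := fun q => upd i (w q) q) Phi0 sPhi (near_norm_lt n0d)).
  apply: filterS2 near1 (near_norm_lt n0e) => q qd qe.
  rewrite /P /implicit_graph.
  rewrite (implicit_uniq sw' pw r0 re de bw qd (t := q 0 i)).
  + by rewrite upd_upd upd_self.
  + exact: le_lt_trans (norm_coord_le q i) qe.
  + by rewrite upd_upd upd_self upd_ii.
- apply: filterS (near_norm_lt n0d) => q qd.
  have [_ wq] := implicitP sw' r0 re de bw qd.
  by rewrite /P /implicit_graph wq upd_upd upd_self.
Qed.

(** A negative derivative becomes positive after composition with the reflection of the i-th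
    coordinate. *)
Lemma upd_diffeo {R : realType} n (i : 'I_n) (w : 'rV[R]_n -> R) :
  smooth_at w 0 -> w 0 = 0 -> 'D_('e_i) w 0 != 0 ->
  diffeo_germ (fun q => upd i (w q) q).
Proof.
move=> sw w0; rewrite neq_lt => /orP[Dw|]; last exact: upd_diffeo_gt0.
have sN : smooth_at (fun q : 'rV[R]_n => upd i (- q 0 i) q) 0.
  apply: smooth_at_upd; last exact: smooth_at_id.
  exact/smooth_atN/smooth_at_proj.
have N0 : upd i (- (0 : 'rV[R]_n) 0 i) 0 = 0 by rewrite mxE oppr0 upd0.
have NN (q : 'rV[R]_n) :
    upd i (- (upd i (- q 0 i) q) 0 i) (upd i (- q 0 i) q) = q.
  by rewrite upd_ii opprK upd_upd upd_self.
have dN : diffeo_germ (fun q : 'rV[R]_n => upd i (- q 0 i) q).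
  split=> //; exists (fun q : 'rV[R]_n => upd i (- q 0 i) q).
  by split=> //; apply: filterE.
have dNw : diffeo_germ (fun q => upd i (- w q) q).
  apply: upd_diffeo_gt0; first exact: smooth_atN.
    by rewrite w0 oppr0.
  by rewrite [X in _ < X]deriveN ?oppr_gt0//; exact: smooth_at_derivable.
have := diffeo_germ_comp dN dNw; congr diffeo_germ; apply/funext => q /=.
by rewrite upd_ii opprK upd_upd.
Qed.

Lemma smooth_at_neq0 {R : realType} n (f : 'rV[R]_n -> R) a :
  smooth_at f a -> f a != 0 -> \forall x \near a, f x != 0.
Proof. by move=> /smooth_at_continuous cf; exact: cvgr_neq0 cf. Qed.

(** * Hadamard's lemma in one coordinate, without integrals *)

Section Hadamard.
Context {R : realType} {n : nat} (i : 'I_n) (e : R).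

Let U : set 'rV[R]_n := [set q | `|q| < e].

Let smooth_U (h : 'rV[R]_n -> R) := forall q, U q -> smooth_at h q.

Definition partial_iter k (h : 'rV[R]_n -> R) :=
  iter k (fun f x => 'D_('e_i) f x) h.

Let smooth_U_iter k h : smooth_U h -> smooth_U (partial_iter k h).
Proof. by move=> sh; elim: k => [//|k IH] q /IH; exact: smooth_at_partial. Qed.

Let nearU q : U q -> \forall x \near q, U x.
Proof. exact: near_norm_lt. Qed.

Let partial_iterC k h j q : smooth_U h -> U q ->
  'D_('e_j) (partial_iter k h) q = partial_iter k (fun x => 'D_('e_j) h x) q.
Proof.
move=> sh; elim: k q => [//|k IH] q Uq /=.
rewrite derive_comm; last exact: smooth_U_iter.
by apply: near_eq_derive; apply: filterS (nearU Uq) => x; exact: IH.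
Qed.

(* [moment k h q] is the integral of [s ^ k * D_i^(k+1) h] for the i-th
   coordinate [s] running from 0 to [q_i], integrated by parts. *)
Fixpoint moment k (h : 'rV[R]_n -> R) (q : 'rV[R]_n) : R :=
  if k is k'.+1 then q 0 i ^+ k * partial_iter k h q - k%:R * moment k' h q
  else h q - h (upd i 0 q).

(* The smooth extension of [moment k h q / q_i ^ (k+1)]. *)
Definition moment_quotient k (h : 'rV[R]_n -> R) (q : 'rV[R]_n) : R :=
  if q 0 i == 0 then partial_iter k.+1 h q / k.+1%:R
  else moment k h q / q 0 i ^+ k.+1.

Let Uupd q : U q -> U (upd i 0 q).
Proof. by move=> Uq; apply: norm_upd_lt; rewrite ?normr0 ?(le_lt_trans (normr_ge0 q)). Qed.

Let smooth_upd0 h q : smooth_U h -> U q -> smooth_at (fun x => h (upd i 0 x)) q.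
Proof.
move=> sh Uq; apply: smooth_at_scalarcomp; last exact/sh/Uupd.
by apply: smooth_at_upd; [exact: smooth_at_cst|exact: smooth_at_id].
Qed.

Let derive_upd0 h q j : smooth_U h -> U q ->
  'D_('e_j) (fun x => h (upd i 0 x)) q =
  if j == i then 0 else 'D_('e_j) h (upd i 0 q).
Proof.
move=> sh Uq; have su : smooth_at (upd i 0) q.
  by apply: smooth_at_upd; [exact: smooth_at_cst|exact: smooth_at_id].
rewrite (derive_chain _ (smooth_at_diff su) (smooth_at_diff (sh _ (Uupd Uq)))).
rewrite (bigD1 j)//= big1 => [|k kj]; rewrite derive_upd; last first.
  by rewrite mxE (negPf kj) andbF if_same mulr0.
by rewrite addr0 mxE !eqxx; case: eqP => _; rewrite ?mulr0 ?mulr1.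
Qed.

Lemma moment_smooth k h : smooth_U h -> smooth_U (moment k h).
Proof.
move=> sh; elim: k => [|k IH] q Uq /=.
  by apply: smooth_atB; [exact: sh|exact: smooth_upd0].
apply: smooth_atB; apply: smooth_atM.
- exact/smooth_atX/smooth_at_proj.
- exact: (@smooth_U_iter k.+1 h sh).
- exact: smooth_at_cst.
- exact: IH.
Qed.

Let deriveB_at (f g : 'rV[R]_n -> R) q v : smooth_at f q -> smooth_at g q ->
  'D_v (fun x => f x - g x) q = 'D_v f q - 'D_v g q.
Proof. by move=> sf sg; rewrite -[RHS]deriveB//; exact: smooth_at_derivable. Qed.

Let deriveZ_at (c : R) (f : 'rV[R]_n -> R) q v : smooth_at f q ->
  'D_v (fun x => c * f x) q = c * 'D_v f q.
Proof.
move=> sf; rewrite deriveM_at; [|exact/smooth_at_diff/smooth_at_cst|exact: smooth_at_diff].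
by rewrite derive_cst mulr0 addr0.
Qed.

Let sproj k q : smooth_at (fun x : 'rV[R]_n => x 0 i ^+ k) q.
Proof. exact/smooth_atX/smooth_at_proj. Qed.

Let derive_proj_pow k q j : 'D_('e_j) (fun x : 'rV[R]_n => x 0 i ^+ k) q =
  if j == i then k%:R * q 0 i ^+ k.-1 else 0.
Proof.
rewrite deriveX_at; last exact/smooth_at_diff/smooth_at_proj.
by rewrite derive_proj mxE eqxx eq_sym; case: eqP => _; rewrite ?mulr1 ?mulr0.
Qed.

Lemma derive_moment k h q : smooth_U h -> U q ->
  'D_('e_i) (moment k h) q = q 0 i ^+ k * partial_iter k.+1 h q.
Proof.
move=> sh Uq; elim: k => [|k IH].
  rewrite [LHS]deriveB_at; [|exact: sh|exact: smooth_upd0].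
  by rewrite derive_upd0// eqxx subr0 mul1r.
have smk := @smooth_U_iter k.+1 h sh q Uq; have mk := moment_smooth k sh Uq.
rewrite [LHS]deriveB_at; [|exact: smooth_atM|exact/smooth_atM/mk/smooth_at_cst].
rewrite deriveM_at; [|exact/smooth_at_diff|exact/smooth_at_diff].
rewrite deriveZ_at// IH derive_proj_pow eqxx /=.
set a := 'D_ _ _ _; set b := 'D_ _ _ _.
by ring.
Qed.

Lemma derive_moment_neq k h q j : smooth_U h -> U q -> j != i ->
  'D_('e_j) (moment k h) q = moment k (fun x => 'D_('e_j) h x) q.
Proof.
move=> sh Uq ji; elim: k => [|k IH].
  rewrite [LHS]deriveB_at; [|exact: sh|exact: smooth_upd0].
  by rewrite derive_upd0// (negPf ji).
have smk := @smooth_U_iter k.+1 h sh q Uq; have mk := moment_smooth k sh Uq.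
rewrite [LHS]deriveB_at; [|exact: smooth_atM|exact/smooth_atM/mk/smooth_at_cst].
rewrite deriveM_at; [|exact/smooth_at_diff|exact/smooth_at_diff].
rewrite deriveZ_at// IH derive_proj_pow (negPf ji) mulr0 addr0.
by rewrite (@partial_iterC k.+1).
Qed.

Lemma moment_upd0 k h q : moment k h (upd i 0 q) = 0.
Proof.
elim: k => [|k IH] /=; first by rewrite upd_upd subrr.
by rewrite IH upd_ii exprS !mul0r mulr0 subr0.
Qed.

Let Uscale q u : U q -> 0 <= u <= 1 -> U (upd i (u * q 0 i) q).
Proof.
move=> Uq /andP[u0 u1]; apply: norm_upd_lt => //.
rewrite normrM (ger0_norm u0) (le_lt_trans _ (le_lt_trans (norm_coord_le q i) Uq))//.
by rewrite ler_piMl.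
Qed.

(** Cauchy's mean value theorem for the moment at t q_i against t^(k+1): the powers of t cancel and
    leave the derivative of order k+1 at an intermediate point. This controls the quotient near q_i
    = 0. *)
Lemma moment_quotient_mean k h q : smooth_U h -> U q ->
  exists2 u : R, 0 <= u <= 1 &
    moment_quotient k h q = partial_iter k.+1 h (upd i (u * q 0 i) q) / k.+1%:R.
Proof.
move=> sh Uq; rewrite /moment_quotient; have [qi0|qi] := eqVneq (q 0 i) 0.
  have qE : upd i 0 q = q by rewrite -{1}qi0 upd_self.
  by exists 0; rewrite ?lexx ?ler01// mul0r qE.
pose f (t : R) := moment k h (upd i (t * q 0 i) q).
pose df (t : R) := q 0 i * ((t * q 0 i) ^+ k * partial_iter k.+1 h (upd i (t * q 0 i) q)).
pose g (t : R) := t ^+ k.+1.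
pose dg (t : R) := k.+1%:R * t ^+ k.
have fE : f = fun t => moment k h (upd i 0 q + t *: (q 0 i *: 'e_i)).
  by apply/funext => t; rewrite scalerA -updD add0r.
have fd (t : R) : t \in `[0, 1] -> is_derive t 1 f (df t).
  rewrite in_itv /= => t01; have Ut := Uscale Uq t01; rewrite fE.
  have Et : upd i 0 q + t *: (q 0 i *: 'e_i) = upd i (t * q 0 i) q.
    by rewrite scalerA -updD add0r.
  have := @is_derive_line _ _ (moment k h) (upd i 0 q) (q 0 i *: 'e_i) t.
  rewrite Et derive_scale ?derive_moment ?upd_ii//; last first.
    exact/smooth_at_diff/moment_smooth.
  by apply; exact/smooth_at_diff/moment_smooth.
have gd (t : R) : is_derive t 1 g (dg t).
  split; first exact: exprn_derivable.
  by rewrite [LHS]exp_derive /GRing.scale /= mulr1.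
have fd' (t : R) : t \in `]0, 1[ -> is_derive t 1 f (df t).
  by move=> t01; apply: fd; exact: subset_itv_oo_cc.
have gd' (t : R) : t \in `]0, 1[ -> is_derive t 1 g (dg t) by [].
have cf : {within `[0, 1], continuous f}.
  by apply: derivable_within_continuous => t t01; have [] := fd t t01.
have cg : {within `[0, 1], continuous g}.
  by apply: derivable_within_continuous => t t01; have [] := gd t.
have dg0 (t : R) : t \in `]0, 1[ -> dg t != 0.
  by rewrite in_itv /= => /andP[t0 _]; rewrite mulf_neq0 ?expf_neq0 ?gt_eqF.
have [u] := cauchy_MVT ltr01 cf cg fd' gd' dg0.
rewrite in_itv /= => /andP[u0 u1].
rewrite /f /g /df /dg !mul1r mul0r moment_upd0 upd_self expr1n expr0n !subr0 divr1.
move=> <-; exists u; first by rewrite !ltW.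
set D := partial_iter _ _ _.
have un0 := lt0r_neq0 u0; have kn0 : k.+1%:R != 0 :> R by rewrite pnatr_eq0.
transitivity (D / k.+1%:R); last by [].
by rewrite exprMn exprS; field; rewrite nat1r !expf_neq0 ?qi ?un0 ?kn0.
Qed.

(** The recursion of [moment] divided by q_i^(k+1). It writes the quotient as a smooth function plus
    q_i times a quotient that is continuous on q_i = 0, ready for [differentiable_mul0]. *)
Lemma moment_quotient_rec k h q :
  moment_quotient k h q = (partial_iter k.+1 h q - q 0 i * moment_quotient k.+1 h q)
    / k.+1%:R.
Proof.
rewrite /moment_quotient; have [->|qi] := eqVneq (q 0 i) 0.
  by rewrite mul0r subr0.
have -> : moment k.+1 h q = q 0 i ^+ k.+1 * partial_iter k.+1 h q - k.+1%:R * moment k h q by [].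
have kn0 : k.+1%:R != 0 :> R by rewrite pnatr_eq0.
set m := moment _ _ _; set D := partial_iter _ _ _.
by rewrite !exprS; field; rewrite ?nat1r ?kn0 ?expf_neq0 ?qi.
Qed.

Lemma moment_quotient_continuous0 k h a : smooth_U h -> U a -> a 0 i = 0 ->
  {for a, continuous (moment_quotient k h)}.
Proof.
move=> sh Ua ai; have mean (q : 'rV[R]_n) : exists u : R, U q -> 0 <= u <= 1 /\
    moment_quotient k h q = partial_iter k.+1 h (upd i (u * q 0 i) q) / k.+1%:R.
  have [Uq|nUq] := pselect (U q); last by exists 0.
  by have [u u01 uE] := moment_quotient_mean k sh Uq; exists u.
have [u uP] := choice mean.
(* No continuity of u is available, but |u q_i| <= |q_i| tends to a_i = 0, so z is continuous at
   a. *)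
pose z (q : 'rV[R]_n) := upd i (u q * q 0 i) q.
have za : z a = a by rewrite /z ai mulr0 -{2}(upd_self i a) ai.
have cz : {for a, continuous z}.
  apply/continuous_distP => eps eps0.
  have : \forall x \near a, `|a - x| < eps.
    by have /continuous_distP/(_ _ eps0) : {for a, continuous (@id 'rV[R]_n)} by [].
  apply: filterS2 (nearU Ua) => x Ux ax; have [/andP[u0 u1] _] := uP x Ux.
  rewrite za norm_rV_lt//; apply/forallP => j.
  have := le_lt_trans (norm_coord_le (a - x) j) ax.
  rewrite !mxE; case: eqP => [->|//]; rewrite ai !sub0r !normrN normrM (ger0_norm u0).
  by apply: le_lt_trans; rewrite ler_piMl.
pose G (q : 'rV[R]_n) := partial_iter k.+1 h q / k.+1%:R.
have cG : {for z a, continuous G}.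
  rewrite za; apply: smooth_at_continuous; apply: smooth_atM.
    exact: smooth_U_iter.
  exact: smooth_at_cst.
have cGz := continuous_comp cz cG.
apply/continuous_distP => eps eps0; have /continuous_distP/(_ _ eps0) := cGz.
apply: filterS2 (nearU Ua) => x Ux /=.
by have [_ ->] := uP x Ux; have [_ ->] := uP a Ua.
Qed.

(** The quotient stands for the integral over [0, 1] of s^k D_i^(k+1) h at s q_i: a derivative in
    direction i raises k, and any other derivative passes to h. Hence smoothness needs the whole
    family in k and h at once. *)
Lemma moment_quotient_diff k h a : smooth_U h -> U a ->
  differentiable (moment_quotient k h) a /\ forall j,
  'D_('e_j) (moment_quotient k h) a =
  if j == i then moment_quotient k.+1 h a
  else moment_quotient k (fun x => 'D_('e_j) h x) a.
Proof.
move=> sh Ua; have kn0 : k.+1%:R != 0 :> R by rewrite pnatr_eq0.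
have sD := @smooth_U_iter k.+1 h sh a Ua; have [ai|ai] := eqVneq (a 0 i) 0.
  have [dm Dm] := differentiable_mul0 (smooth_at_diff (smooth_at_proj a i)) ai
    (moment_quotient_continuous0 (k := k.+1) sh Ua ai).
  have -> : moment_quotient k h = fun q => k.+1%:R^-1 *
      (partial_iter k.+1 h q - q 0 i * moment_quotient k.+1 h q).
    by apply/funext => q; rewrite moment_quotient_rec mulrC.
  have dB : differentiable (fun q =>
      partial_iter k.+1 h q - q 0 i * moment_quotient k.+1 h q) a.
    by apply: differentiableB => //; exact: smooth_at_diff.
  have dc : differentiable (fun=> k.+1%:R^-1 : R) a by exact: differentiable_cst.
  split=> [|j]; first exact: differentiableM.
  rewrite (deriveM_at _ dc dB) derive_cst mulr0 addr0.
  rewrite [X in _ * X]deriveB; [|exact: smooth_at_derivable|exact: diff_derivable].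
  rewrite Dm derive_proj mxE eqxx eq_sym /moment_quotient ai eqxx.
  have [->|ji] := eqVneq j i; last first.
    by rewrite andbF mulr0n mulr0 subr0 partial_iterC// mulrC.
  have -> : 'D_('e_i) (partial_iter k.+1 h) a = partial_iter k.+2 h a by [].
  have kn1 : k.+2%:R != 0 :> R by rewrite pnatr_eq0.
  set D := partial_iter _ _ _; rewrite andbT mulr1n mulr1.
  by field; rewrite ?nat1r -?(natrD _ 2) !pnatr_eq0.
have near0 : \forall x \near a, U x /\ x 0 i != 0.
  apply: filterI; first exact: nearU.
  exact: smooth_at_neq0 (smooth_at_proj a i) ai.
have E : {near a, (fun q => moment k h q * (q 0 i ^+ k.+1)^-1) =1 moment_quotient k h}.
  by apply: filterS near0 => x [_ xi]; rewrite /moment_quotient (negPf xi).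
have sm := moment_smooth k sh Ua.
have sV : smooth_at (fun q : 'rV[R]_n => (q 0 i ^+ k.+1)^-1) a.
  by apply: smooth_atV; [exact: sproj|rewrite expf_neq0].
split=> [|j]; first exact: near_eq_differentiable E (smooth_at_diff (smooth_atM sm sV)).
rewrite -(near_eq_derive _ E) deriveM_at; [|exact: smooth_at_diff|exact: smooth_at_diff].
have -> : 'D_('e_j) (fun q : 'rV[R]_n => (q 0 i ^+ k.+1)^-1) a =
   - (a 0 i ^+ k.+1) ^- 2 * (if j == i then k.+1%:R * a 0 i ^+ k else 0).
  rewrite [LHS](@deriveV _ _ (fun q : 'rV[R]_n => q 0 i ^+ k.+1)).
  - by rewrite derive_proj_pow.
  - by rewrite expf_neq0.
  - exact/smooth_at_derivable/sproj.
rewrite /moment_quotient (negPf ai); have [->|ji] := eqVneq j i; last first.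
  by rewrite derive_moment_neq// !mulr0 add0r mulrC.
rewrite derive_moment//.
have -> : moment k.+1 h a = a 0 i ^+ k.+1 * partial_iter k.+1 h a - k.+1%:R * moment k h a by [].
set m := moment _ _ _; set D := partial_iter _ _ _.
by rewrite !exprS; field; rewrite ?nat1r ?kn0 ?expf_neq0 ?ai.
Qed.

Lemma moment_quotient_smooth k h a : smooth_U h -> U a ->
  smooth_at (moment_quotient k h) a.
Proof.
move=> sh Ua; pose C := [set g : 'rV[R]_n -> R | exists k h,
  smooth_U h /\ g = moment_quotient k h].
apply: (@smooth_at_coind _ _ _ C U _ _ (@open_norm_lt R n e)) => //.
- by move=> _ [m [f [sf ->]]] x Ux; have [] := moment_quotient_diff m sf Ux.
- move=> _ j [m [f [sf ->]]].
  exists (if j == i then moment_quotient m.+1 f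
          else moment_quotient m (fun x => 'D_('e_j) f x)).
    case: eqP => _; first by exists m.+1, f.
    exists m, (fun x => 'D_('e_j) f x); split=> // x Ux.
    exact/smooth_at_partial/sf.
  move=> x Ux; have [_ ->] := moment_quotient_diff m sf Ux.
  by case: eqP.
- by exists k, h.
Qed.

End Hadamard.

(** The function k stands for the mean of D_i g along the segment from [upd i 0 q] to q, which
    explains the factor 1/2 in its derivative at 0. *)
Lemma hadamard {R : realType} n (i : 'I_n) (g : 'rV[R]_n -> R) : smooth_at g 0 ->
  exists k : 'rV[R]_n -> R, [/\ smooth_at k 0,
    forall q, g q = g (upd i 0 q) + q 0 i * k q,
    forall q, k (upd i 0 q) = 'D_('e_i) g (upd i 0 q) &
    'D_('e_i) k 0 = 'D_('e_i) (fun x => 'D_('e_i) g x) 0 / 2].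
Proof.
move=> sg.
have /nbhs0_normP[e e0 eP] := smooth_at_near sg.
have n0 : `|0 : 'rV[R]_n| < e by rewrite normr0.
exists (moment_quotient i 0 g); split.
- exact: (@moment_quotient_smooth _ _ i e 0 g).
- move=> q; rewrite /moment_quotient; have [qi|qi] := eqVneq (q 0 i) 0.
    by rewrite qi mul0r addr0 -qi upd_self.
  by rewrite expr1 /= mulrC divfK// subrKC.
- by move=> q; rewrite /moment_quotient upd_ii eqxx divr1.
- have [_ ->] := @moment_quotient_diff _ _ i e 0 g 0 eP n0.
  by rewrite eqxx /moment_quotient mxE eqxx.
Qed.

(** * Completing a square with parameters *)

Section MorseLemma.
Context {R : realType}.
Implicit Types n : nat.

Lemma derive_scalar_comp n (s : R -> R) c (f : 'rV[R]_n -> R) x :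
  is_derive (f x) 1 s c -> differentiable f x ->
  differentiable (fun y => s (f y)) x /\
  forall v, 'D_v (fun y => s (f y)) x = c * 'D_v f x.
Proof.
move=> [ds <-] df; have ds' : differentiable s (f x) by exact/derivable1_diffP.
have dsf : differentiable (s \o f) x by exact: differentiable_comp.
split=> // v; rewrite [LHS](deriveE v dsf) diff_comp//= [RHS]mulrC [in RHS]deriveE//.
have -> : 'D_1 s (f x) = 'd s (f x) 1 by exact: deriveE.
set r : R := 'd f x v.
have -> : 'd s (f x) r = 'd s (f x) (r *: (1 : R)) by rewrite /GRing.scale /= mulr1.
by rewrite linearZ.
Qed.

Lemma derive_indep n (i : 'I_n) (f : 'rV[R]_n -> R) q :
  (forall r q, f (upd i r q) = f q) -> 'D_('e_i) f q = 0.
Proof.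
move=> fi; rewrite -[RHS](@derive_cst _ 'rV[R]_n _ (f q) q 'e_i) /derive.
have -> : (fun h : R => h^-1 *: ((f \o shift q) (h *: 'e_i) - f q)) =
  (fun h : R => h^-1 *: ((cst (f q) \o shift q) (h *: 'e_i) - cst (f q) q)).
  apply/funext => h /=; congr (_ *: (_ - _)).
  by rewrite addrC -{1}(upd_self i q) -updD fi.
by [].
Qed.

Lemma smooth_at_sqrt n (f : 'rV[R]_n -> R) a :
  smooth_at f a -> 0 < f a -> smooth_at (fun x => Num.sqrt (f x)) a.
Proof.
move=> sf fa0.
have : \forall x \near a, smooth_at f x /\ 0 < f x.
  by apply: filterI; [exact: smooth_at_near|exact: smooth_at_gt0].
move=> /near_openP[U [oU Ua UP]].
(* Stable under derivatives, since D(sqrt f) = Df / (2 f) times sqrt f. *)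
pose C := [set g : 'rV[R]_n -> R | exists2 u : 'rV[R]_n -> R,
  (forall x, U x -> smooth_at u x) & g = fun x => u x * Num.sqrt (f x)].
have dS x : U x -> differentiable (fun y => Num.sqrt (f y)) x /\
    forall v, 'D_v (fun y => Num.sqrt (f y)) x = (2 * Num.sqrt (f x))^-1 * 'D_v f x.
  move=> /UP[sfx fx0]; apply: derive_scalar_comp; last exact: smooth_at_diff.
  exact: is_derive1_sqrt.
apply: (@smooth_at_coind _ _ _ C U) => //.
- move=> _ [u su ->] x Ux; apply: differentiableM; first exact/smooth_at_diff/su.
  by have [] := dS _ Ux.
- move=> _ i [u su ->].
  exists (fun x => ('D_('e_i) u x + u x * 'D_('e_i) f x * (2 * f x)^-1) * Num.sqrt (f x)).
    exists (fun x => 'D_('e_i) u x + u x * 'D_('e_i) f x * (2 * f x)^-1) => // x Ux.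
    have [sfx fx0] := UP _ Ux; apply: smooth_atD; first exact/smooth_at_partial/su.
    apply: smooth_atM; first by apply: smooth_atM; [exact: su|exact: smooth_at_partial].
    apply: smooth_atV; first by apply: smooth_atM => //; exact: smooth_at_cst.
    by rewrite mulf_neq0 ?pnatr_eq0 ?gt_eqF.
  move=> x Ux; have [sfx fx0] := UP _ Ux; have [dsx Dsx] := dS _ Ux.
  rewrite deriveM_at//; last exact/smooth_at_diff/su.
  have s0 : Num.sqrt (f x) != 0 by rewrite sqrtr_eq0 -ltNge.
  have := sqr_sqrtr (ltW fx0); rewrite Dsx.
  set s := Num.sqrt _ in s0 *; set D := 'D_ _ _ _; set D' := 'D_ _ _ _ => <-.
  by field.
- exists (fun=> 1 : R); first by move=> x _; exact: smooth_at_cst.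
  by apply/funext => x; rewrite mul1r.
Qed.

Lemma derive_graph n (i j : 'I_n) (h c : 'rV[R]_n -> R) a :
  smooth_at c a -> smooth_at h (upd i (c a) a) ->
  'D_('e_j) (fun q => h (upd i (c q) q)) a =
  'D_('e_i) h (upd i (c a) a) * 'D_('e_j) c a +
  (if j == i then 0 else 'D_('e_j) h (upd i (c a) a)).
Proof.
move=> sc sh; have su : smooth_at (fun q => upd i (c q) q) a.
  by apply: smooth_at_upd => //; exact: smooth_at_id.
rewrite (derive_chain (p := fun q => upd i (c q) q) _ (smooth_at_diff su)
  (smooth_at_diff sh)).
have Du k : 'D_('e_j) (fun q => upd i (c q) q 0 k) a =
    if k == i then 'D_('e_j) c a else (k == j)%:R.
  have -> : (fun q => upd i (c q) q 0 k) = if k == i then c else fun q => q 0 k.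
    by apply/funext => q; rewrite updE; case: eqP.
  by case: eqP => // _; rewrite derive_proj mxE eqxx.
rewrite (bigD1 i)//= Du eqxx; congr (_ + _).
case: (eqVneq j i) => [ji|ji].
  by rewrite big1 => [//|k ki]; rewrite Du ji (negPf ki) mulr0.
rewrite (bigD1 j)//= Du (negPf ji) eqxx mulr1 big1 ?addr0// => k /andP[ki kj].
by rewrite Du (negPf ki) (negPf kj) mulr0.
Qed.

Lemma diffeo_germ_inv n (p : 'rV[R]_n -> 'rV[R]_n) : diffeo_germ p ->
  exists p', [/\ diffeo_germ p', \forall q \near (0 : 'rV[R]_n), p' (p q) = q
    & \forall q \near (0 : 'rV[R]_n), p (p' q) = q].
Proof.
move=> [p0 sp [p' [p'0 sp' p'p pp']]]; exists p'; split=> //.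
by split=> //; exists p.
Qed.

(** A map that leaves the other coordinates alone has an inverse that leaves them alone, so the
    inverse is again given by one function v. *)
Lemma upd_diffeo_inv n (i : 'I_n) (w : 'rV[R]_n -> R) :
  smooth_at w 0 -> w 0 = 0 -> 'D_('e_i) w 0 != 0 ->
  exists v : 'rV[R]_n -> R, [/\ smooth_at v 0, v 0 = 0, 'D_('e_i) v 0 != 0,
    \forall q \near (0 : 'rV[R]_n), w (upd i (v q) q) = q 0 i &
    \forall q \near (0 : 'rV[R]_n), v (upd i (w q) q) = q 0 i].
Proof.
move=> sw w0 Dw0; have [p [[p0 sp _] pw wp]] := diffeo_germ_inv (upd_diffeo sw w0 Dw0).
have pE : \forall q \near (0 : 'rV[R]_n), p q = upd i (p q 0 i) q.
  apply: filterS wp => q wpq; apply/rowP => j; rewrite updE; case: eqP => [->//|/eqP ji].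
  by rewrite -[in RHS]wpq upd_neq.
have sv : smooth_at (fun q => p q 0 i) 0 by exact: smooth_at_coord.
have near_w : \forall q \near (0 : 'rV[R]_n), w (upd i (p q 0 i) q) = q 0 i.
  by apply: filterS2 wp pE => q wpq {1}<-; rewrite -[in RHS]wpq upd_ii.
exists (fun q => p q 0 i); split=> //.
- by rewrite p0 mxE.
- have sw' : smooth_at w (upd i (p 0 0 i) 0) by rewrite p0 mxE upd0.
  have := derive_graph i sv sw'; rewrite p0 [(0 : 'rV__) _ _]mxE upd0 eqxx addr0.
  rewrite (near_eq_derive _ near_w) derive_proj mxE !eqxx => /eqP.
  by apply: contraTneq => ->; rewrite mulr0 oner_eq0.
- by apply: filterS pw => q ->.
Qed.

(* Solving D_i F = 0 for the i-th coordinate and completing the square. *)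
Lemma morse_split n (i : 'I_n) (F : 'rV[R]_n -> R) : smooth_at F 0 ->
  'D_('e_i) F 0 = 0 -> 'D_('e_i) (fun x => 'D_('e_i) F x) 0 != 0 ->
  exists (w F1 : 'rV[R]_n -> R) (s : bool),
  [/\ [/\ smooth_at w 0, w 0 = 0 & 'D_('e_i) w 0 != 0],
    smooth_at F1 0, forall r q, F1 (upd i r q) = F1 q,
    \forall q \near (0 : 'rV[R]_n),
      F (upd i (w q) q) = F1 q + (-1) ^+ s * q 0 i ^+ 2 &
    forall j, j != i ->
      'D_('e_j) F1 0 = 'D_('e_j) F 0 /\
      'D_('e_j) (fun x => 'D_('e_j) F1 x) 0 =
      'D_('e_j) (fun x => 'D_('e_j) F x) 0 -
      'D_('e_j) (fun x => 'D_('e_i) F x) 0 ^+ 2 /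
      'D_('e_i) (fun x => 'D_('e_i) F x) 0].
Proof.
have alg (A B C D : R) : A != 0 -> A * C + B = 0 -> B * C + D = D - B ^+ 2 / A.
  move=> A0 /eqP; rewrite addrC addr_eq0 => /eqP ->.
  by rewrite expr2; field.
move=> sF DF0 DDF0; have sD j : smooth_at (fun x => 'D_('e_j) F x) 0.
  exact: smooth_at_partial.
have [c' [sc' c'0 _ Dc' _]] := upd_diffeo_inv (sD i) DF0 DDF0.
(* c' solves D_i F = q_i; restricted to q_i = 0 it gives the critical point in direction i as a
   function of the other coordinates. *)
pose c q := c' (upd i 0 q).
have cupd r q : c (upd i r q) = c q by rewrite /c upd_upd.
have s0 : smooth_at (upd i 0) (0 : 'rV[R]_n).
  by apply: smooth_at_upd; [exact: smooth_at_cst|exact: smooth_at_id].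
have sc : smooth_at c 0.
  by apply: (smooth_at_scalarcomp s0); rewrite upd0.
have c0 : c 0 = 0 by rewrite /c upd0.
have Dc : \forall q \near (0 : 'rV[R]_n), 'D_('e_i) F (upd i (c q) q) = 0.
  have := near_pullback (upd0 i) s0 Dc'.
  by apply: filterS => q; rewrite upd_upd upd_ii.
(* Translation by c, so that the critical point of Ft in direction i lies on q_i = 0. *)
pose b (q : 'rV[R]_n) := q 0 i + c q.
have sb : smooth_at b 0 by apply: smooth_atD => //; exact: smooth_at_proj.
have b0 : b 0 = 0 by rewrite /b c0 mxE addr0.
have Dib : \forall q \near (0 : 'rV[R]_n), 'D_('e_i) b q = 1.
  apply: filterS (smooth_at_near sc) => q scq.
  rewrite [LHS]deriveD_at; [|exact/smooth_at_diff/smooth_at_proj|exact: smooth_at_diff].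
  by rewrite derive_proj mxE !eqxx (derive_indep _ cupd) addr0.
have graph_smooth (h g : 'rV[R]_n -> R) : smooth_at g 0 -> g 0 = 0 -> smooth_at h 0 ->
    smooth_at (fun q => h (upd i (g q) q)) 0 /\
    \forall q \near (0 : 'rV[R]_n), smooth_at g q /\ smooth_at h (upd i (g q) q).
  move=> sg g0 sh; have su : smooth_at (fun q => upd i (g q) q) 0.
    by apply: smooth_at_upd => //; exact: smooth_at_id.
  have u0 : upd i (g 0) 0 = 0 by rewrite g0 upd0.
  split; first by apply: (smooth_at_scalarcomp su); rewrite u0.
  apply: filterI; first exact: smooth_at_near.
  exact: (near_pullback (p := fun q => upd i (g q) q) u0 su (smooth_at_near sh)).
pose Ft q := F (upd i (b q) q).
have [sFt nFt] := graph_smooth F b sb b0 sF.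
have [_ nDF] := graph_smooth _ b sb b0 (sD i).
have DFt : {near (0 : 'rV[R]_n), (fun q => 'D_('e_i) Ft q) =1
    (fun q => 'D_('e_i) F (upd i (b q) q))}.
  apply: filterS2 nFt Dib => q [sbq sFq] Dbq.
  by rewrite [LHS]derive_graph// Dbq mulr1 eqxx addr0.
have DDFt : 'D_('e_i) (fun q => 'D_('e_i) Ft q) 0 = 'D_('e_i) (fun q => 'D_('e_i) F q) 0.
  have [sb0 sDF] := nbhs_singleton nDF.
  rewrite (near_eq_derive _ DFt).
  rewrite [LHS](derive_graph i (h := fun y => 'D_('e_i) F y) sb0 sDF).
  rewrite (nbhs_singleton Dib) mulr1.
  by rewrite eqxx addr0 b0 upd0.
have DFt0 : \forall q \near (0 : 'rV[R]_n), 'D_('e_i) Ft (upd i 0 q) = 0.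
  apply: filterS2 (near_pullback (upd0 i) s0 DFt) Dc => q -> Dcq.
  by rewrite -[RHS]Dcq upd_upd /b upd_ii cupd add0r.
(* Hadamard's lemma is used twice: the first quotient vanishes on q_i = 0, where it equals D_i Ft,
   so Ft differs from its restriction by q_i^2 k2. *)
have [k [sk kE kupd Dk]] := hadamard i sFt.
have [k2 [sk2 k2E k2upd _]] := hadamard i sk.
have k20 : k2 0 = 'D_('e_i) (fun x => 'D_('e_i) F x) 0 / 2.
  by have := k2upd 0; rewrite !upd0 Dk DDFt.
have FtE : \forall q \near (0 : 'rV[R]_n), Ft q = Ft (upd i 0 q) + q 0 i ^+ 2 * k2 q.
  apply: filterS DFt0 => q DFtq; rewrite [LHS]kE [k q]k2E kupd DFtq add0r.
  by rewrite mulrA expr2.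
pose s := k2 0 < 0; pose sg : R := (-1) ^+ s.
have sg2 : sg * sg = 1 by rewrite -expr2 sqrr_sign.
have sk20 : 0 < sg * k2 0.
  rewrite /sg /s -normrEsign normr_gt0 k20; apply: mulf_neq0; first exact: DDF0.
  by rewrite invr_eq0 pnatr_eq0.
(* The sign makes [sg * k2] positive near 0, so its root is smooth and v^2 = q_i^2 |k2| there; v
   becomes the new i-th coordinate. *)
pose v (q : 'rV[R]_n) := q 0 i * Num.sqrt (sg * k2 q).
have ssk2 : smooth_at (fun q => sg * k2 q) 0 := smooth_atM (smooth_at_cst sg 0) sk2.
have ssq : smooth_at (fun q => Num.sqrt (sg * k2 q)) 0 by exact: smooth_at_sqrt.
have sv : smooth_at v 0 := smooth_atM (smooth_at_proj 0 i) ssq.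
have v0 : v 0 = 0 by rewrite /v mxE mul0r.
have Dv : 'D_('e_i) v 0 != 0.
  rewrite [X in X != _]deriveM_at; [|exact/smooth_at_diff/smooth_at_proj|exact: smooth_at_diff].
  by rewrite mxE mul0r add0r derive_proj mxE !eqxx mulr1 sqrtr_eq0 -ltNge.
have [v' [sv' v'0 Dv' vv' _]] := upd_diffeo_inv sv v0 Dv.
pose F1 q := F (upd i (c q) q).
have [sF1 nF1] := graph_smooth F c sc c0 sF.
exists (fun q => v' q + c q), F1, s; split.
- split; first exact: smooth_atD.
    by rewrite v'0 c0 addr0.
  rewrite deriveD_at; [|exact: smooth_at_diff|exact: smooth_at_diff].
  by rewrite (derive_indep _ cupd) addr0.
- exact: sF1.
- by move=> r q; rewrite /F1 cupd upd_upd.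
- have su := smooth_at_upd i sv' (smooth_at_id 0).
  have u0 : upd i (v' 0) 0 = 0 by rewrite v'0 upd0.
  have near1 := near_pullback (p := fun q => upd i (v' q) q) u0 su FtE.
  have near2 := near_pullback (p := fun q => upd i (v' q) q) u0 su (smooth_at_gt0 ssk2 sk20).
  apply: filterS3 near1 near2 vv' => q E pos <-.
  have -> : F (upd i (v' q + c q) q) = Ft (upd i (v' q) q).
    by rewrite /Ft /b upd_ii cupd upd_upd.
  rewrite E; congr (_ + _).
    by rewrite /Ft /b upd_upd upd_ii !cupd upd_upd add0r.
  rewrite /v exprMn (sqr_sqrtr (ltW pos)) mulrCA; congr (_ * _).
  by rewrite mulrA sg2 mul1r.
(* D_i F vanishes on the graph of c, so the first derivatives of F1 are those of F on the graph.
   Differentiating D_i F = 0 along the graph gives D_j c = - F_ij / F_ii, and the second derivative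
   of F1 is the Schur complement. *)
- move=> j ji; have sDi := sD i; have sDj := sD j.
  have E1 : {near (0 : 'rV[R]_n), (fun q => 'D_('e_j) F1 q) =1
      (fun q => 'D_('e_j) F (upd i (c q) q))}.
    apply: filterS2 nF1 Dc => q [scq sFq] Dcq.
    by rewrite [LHS](derive_graph j scq sFq) Dcq mul0r add0r (negPf ji).
  have u0 : upd i (c 0) 0 = 0 by rewrite c0 upd0.
  split; first by rewrite (nbhs_singleton E1) u0.
  have [_ nDi] := graph_smooth _ c sc c0 (sD i).
  have [_ nDj] := graph_smooth _ c sc c0 (sD j).
  have [_ sDi0] := nbhs_singleton nDi; have [_ sDj0] := nbhs_singleton nDj.
  have E2 : {near (0 : 'rV[R]_n), (fun q => 'D_('e_i) F (upd i (c q) q)) =1 cst 0} := Dc.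
  have := near_eq_derive 'e_j E2; rewrite derive_cst.
  rewrite [X in X = _ -> _](derive_graph j (h := fun y => 'D_('e_i) F y) sc sDi0).
  rewrite u0 (negPf ji) => Djc.
  rewrite (near_eq_derive _ E1).
  rewrite [LHS](derive_graph j (h := fun y => 'D_('e_j) F y) sc sDj0) u0 (negPf ji).
  by rewrite -(derive_comm i j sF); exact: alg DDF0 Djc.
Qed.

End MorseLemma.

(** * The Morse lemma in two variables with parameters *)

Section TwoVariableMorse.
Context {R : realType}.
Implicit Types n : nat.

Definition hess n (f : 'rV[R]_n -> R) (i j : 'I_n) :=
  'D_('e_j) (fun x => 'D_('e_i) f x) 0.

Lemma hessE n (f : 'rV[R]_n -> R) i j :
  hess f i j = 'D_('e_j) (fun x => 'D_('e_i) f x) 0.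
Proof. by []. Qed.

Lemma hessC n (f : 'rV[R]_n -> R) i j : smooth_at f 0 -> hess f i j = hess f j i.
Proof. exact: derive_comm. Qed.

Definition hess_det n (f : 'rV[R]_n -> R) (i j : 'I_n) :=
  hess f i i * hess f j j - hess f i j ^+ 2.

(** The coordinates other than i and j act as parameters: P is fibred over them and f is a function
    of them alone. *)
Definition morse_form n (i j : 'I_n) (F : 'rV[R]_n -> R) :=
  exists (P : 'rV[R]_n -> 'rV[R]_n) (f : 'rV[R]_n -> R) (s1 s2 : bool),
  [/\ diffeo_germ P, smooth_at f 0,
    forall r q, f (upd i r q) = f q /\ f (upd j r q) = f q,
    forall q k, k != i -> k != j -> P q 0 k = q 0 k &
    \forall q \near (0 : 'rV[R]_n),
      F (P q) = f q + (-1) ^+ s1 * q 0 i ^+ 2 + (-1) ^+ s2 * q 0 j ^+ 2].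

Lemma morse_formC n (i j : 'I_n) (F : 'rV[R]_n -> R) :
  morse_form i j F -> morse_form j i F.
Proof.
move=> [P [f [s1 [s2 [dP sf fi PE FE]]]]]; exists P, f, s2, s1; split=> //.
- by move=> r q; have [] := fi r q.
- by move=> q k kj ki; exact: PE.
- by apply: filterS FE => q ->; rewrite addrAC.
Qed.

(** After a split in direction i, the remaining second derivative in direction j is the Schur
    complement, that is, the Hessian determinant divided by F_ii. It is nonzero, so a second split
    applies. *)
Lemma morse_form_neq0 n (i j : 'I_n) (F : 'rV[R]_n -> R) : i != j ->
  smooth_at F 0 -> 'D_('e_i) F 0 = 0 -> 'D_('e_j) F 0 = 0 ->
  hess_det F i j != 0 -> hess F i i != 0 -> morse_form i j F.
Proof.
have alg (A B C : R) : A != 0 -> A * B - C ^+ 2 != 0 -> B - C ^+ 2 / A != 0.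
  move=> A0; apply: contra_neq => E.
  have -> : A * B - C ^+ 2 = A * (B - C ^+ 2 / A) by field.
  by rewrite E mulr0.
move=> ij sF DiF DjF H Fii; have ji : j != i by rewrite eq_sym.
have [w1 [F1 [s1 [[sw1 w10 Dw1] sF1 F1i F1E DF1]]]] := morse_split sF DiF Fii.
have [DjF1 DjjF1] := DF1 j ji.
have {}DjF1 : 'D_('e_j) F1 0 = 0 by exact: etrans DjF1 DjF.
have {}DjjF1 : 'D_('e_j) (fun x => 'D_('e_j) F1 x) 0 != 0.
  by rewrite DjjF1; exact: alg Fii H.
have [w2 [F2 [s2 [[sw2 w20 Dw2] sF2 F2j F2E _]]]] := morse_split sF1 DjF1 DjjF1.
have s0 : smooth_at (upd i 0) (0 : 'rV[R]_n).
  by apply: smooth_at_upd; [exact: smooth_at_cst|exact: smooth_at_id].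
(* F1 does not depend on q_i, so the data of the second split can be frozen at q_i = 0. The second
   change then does not involve q_i, and the square already obtained is preserved. *)
pose w q := w2 (upd i 0 q); pose f q := F2 (upd i 0 q).
have sw : smooth_at w 0 by apply: (smooth_at_scalarcomp s0); rewrite upd0.
have sf : smooth_at f 0 by apply: (smooth_at_scalarcomp s0); rewrite upd0.
have w0 : w 0 = 0 by rewrite /w upd0.
have Dw : 'D_('e_j) w 0 != 0.
  have sw2' : smooth_at w2 (upd i 0 0) by rewrite upd0.
  rewrite [X in X != _](derive_graph j (c := fun=> 0) (smooth_at_cst (0 : R) _) sw2').
  by rewrite derive_cst mulr0 add0r (negPf ji) upd0.
pose P1 q := upd i (w1 q) q; pose P2 q := upd j (w q) q.
have dP1 : diffeo_germ P1 := upd_diffeo sw1 w10 Dw1.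
have dP2 : diffeo_germ P2 := upd_diffeo sw w0 Dw.
have [P20 sP2 _] := dP2.
exists (P1 \o P2), f, s1, s2; split=> //.
- exact: diffeo_germ_comp.
- by move=> r q; rewrite /f upd_upd updC// F2j.
- by move=> q k ki kj /=; rewrite /P1 /P2 !upd_neq.
- apply: filterS2 (near_pullback P20 sP2 F1E) (near_pullback (upd0 i) s0 F2E).
  move=> q E1 E2; rewrite /= -[F (P1 (P2 q))]/(F (upd i (w1 (P2 q)) (P2 q))) E1.
  rewrite {2}/P2 (upd_neq _ _ ij) addrAC; congr (_ + _).
  have -> : F1 (P2 q) = F1 (upd j (w2 (upd i 0 q)) (upd i 0 q)).
    by rewrite -updC// F1i.
  by rewrite E2 upd_neq.
Qed.

Opaque hess.

Lemma morse_lemma n (i j : 'I_n) (F : 'rV[R]_n -> R) : i != j ->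
  smooth_at F 0 -> 'D_('e_i) F 0 = 0 -> 'D_('e_j) F 0 = 0 ->
  hess_det F i j != 0 -> morse_form i j F.
Proof.
(* The Boolean constants are the entries of the differential of the shear L below. *)
have alg1 (a b c d : R) : a = 0 -> b = 0 -> d = c ->
    a * (false%:R + true%:R) + d + (c * (false%:R + true%:R) + b) = c *+ 2.
  by move=> -> -> ->; rewrite mulr0n mulr1n; ring.
have alg2 (a : R) : a = 0 -> a * (true%:R + false%:R) + 0 = 0.
  by move=> ->; rewrite mul0r addr0.
have alg3 (a b : R) : a = 0 ->
    a * (true%:R + false%:R) + 0 + (b * (true%:R + false%:R) + 0) = b.
  by move=> ->; rewrite mulr0n mulr1n; ring.
move=> ij sF DiF DjF H.
have [Fii|] := eqVneq (hess F i i) 0; last exact: morse_form_neq0.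
have ji : j != i by rewrite eq_sym.
have [Fjj|Fjj] := eqVneq (hess F j j) 0; last first.
  have H' : hess_det F j i != 0 by rewrite /hess_det mulrC (hessC j i sF).
  exact: morse_formC (morse_form_neq0 ji sF DjF DiF H' Fjj).
have Fij : hess F i j != 0.
  by move: H; rewrite /hess_det Fii mul0r sub0r oppr_eq0 sqrf_eq0.
(* Both diagonal entries vanish, so the quadratic part in q_i, q_j is a multiple of q_i q_j. The
   shear adding q_i to q_j turns the ii entry into 2 F_ij, which is nonzero. *)
pose w (q : 'rV[R]_n) := q 0 j + q 0 i.
have sw q : smooth_at w q by apply: smooth_atD; exact: smooth_at_proj.
have w0 : w 0 = 0 by rewrite /w !mxE addr0.
have Dw k q : 'D_('e_k) w q = (j == k)%:R + (i == k)%:R.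
  rewrite [LHS]deriveD_at; [|exact/smooth_at_diff/smooth_at_proj..].
  by rewrite !derive_proj !mxE !eqxx.
pose L q := upd j (w q) q.
have dL : diffeo_germ L.
  by apply: upd_diffeo => //; rewrite Dw eqxx (negPf ij) addr0 oner_neq0.
have [L0 sL _] := dL.
pose G q := F (L q).
have sG : smooth_at G 0 by apply: (smooth_at_scalarcomp sL); rewrite L0.
have DL (h : 'rV[R]_n -> R) k q : smooth_at h (L q) -> 'D_('e_k) (fun x => h (L x)) q =
    'D_('e_j) h (L q) * ((j == k)%:R + (i == k)%:R) +
    (if k == j then 0 else 'D_('e_k) h (L q)).
  by move=> sh; rewrite [LHS](derive_graph k (sw q) sh) Dw.
have near_sF := near_pullback L0 sL (smooth_at_near sF).
have DiG : {near (0 : 'rV[R]_n), (fun q => 'D_('e_i) G q) =1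
    (fun q => 'D_('e_j) F (L q) + 'D_('e_i) F (L q))}.
  apply: filterS near_sF => q sFq.
  by rewrite [LHS](DL F)// eqxx (negPf ji) (negPf ij) add0r mulr1.
have DjG : {near (0 : 'rV[R]_n), (fun q => 'D_('e_j) G q) =1
    (fun q => 'D_('e_j) F (L q))}.
  apply: filterS near_sF => q sFq.
  by rewrite [LHS](DL F)// eqxx (negPf ij) !addr0 mulr1.
have sD k : smooth_at (fun x => 'D_('e_k) F x) (L 0).
  by rewrite L0; exact: smooth_at_partial.
have dD k : differentiable (fun q => 'D_('e_k) F (L q)) 0.
  apply: smooth_at_diff.
  exact: (@smooth_at_scalarcomp _ _ _ (fun x => 'D_('e_k) F x) L).
have DDL k l : 'D_('e_k) (fun q => 'D_('e_l) F (L q)) 0 =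
    hess F l j * ((j == k)%:R + (i == k)%:R) + (if k == j then 0 else hess F l k).
  by rewrite !hessE (DL (fun x => 'D_('e_l) F x) k 0 (sD l)) L0.
have sym := hessC j i sF.
have Gii : hess G i i = hess F i j *+ 2.
  rewrite [LHS]hessE (near_eq_derive _ DiG) (deriveD_at _ (dD j) (dD i)) !DDL.
  by rewrite eqxx (negPf ji) (negPf ij); exact: alg1 Fjj Fii sym.
have Gjj : hess G j j = 0.
  rewrite [LHS]hessE (near_eq_derive _ DjG) DDL eqxx (negPf ij).
  exact: alg2 Fjj.
have Gij : hess G i j = hess F i j.
  rewrite [LHS]hessE (near_eq_derive _ DiG) (deriveD_at _ (dD j) (dD i)) !DDL.
  rewrite eqxx (negPf ij); exact: alg3 Fjj.
have [||||P [f [s1 [s2 [dP sf fi PE GE]]]]] := @morse_form_neq0 _ i j G ij sG.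
- by rewrite (nbhs_singleton DiG) L0 DiF DjF addr0.
- by rewrite (nbhs_singleton DjG) L0 DjF.
- by rewrite /hess_det Gii Gjj Gij mulr0 sub0r oppr_eq0 sqrf_eq0.
- by rewrite Gii mulrn_eq0.
exists (L \o P), f, s1, s2; split.
- exact: diffeo_germ_comp.
- exact: sf.
- exact: fi.
- by move=> q k ki kj; rewrite [LHS](upd_neq _ _ kj); exact: PE.
- exact: GE.
Qed.

End TwoVariableMorse.

(** * Versality of one-parameter unfoldings of nondegenerate critical points *)

Section Versality.
Context {R : realType}.
Implicit Types n m k : nat.

Lemma smooth_at_row_mx n m k (p : 'rV[R]_n -> 'rV[R]_m) (r : 'rV[R]_n -> 'rV[R]_k) a :
  smooth_at p a -> smooth_at r a -> smooth_at (fun x => row_mx (p x) (r x)) a.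
Proof.
move=> sp sr; apply/smooth_at_rowP => j; case: (splitP j) => l jl.
  have -> : j = lshift k l by exact: val_inj.
  apply: eq_smooth_at (smooth_at_coord l sp).
  by apply: filterE => x; rewrite row_mxEl.
have -> : j = rshift m l by exact: val_inj.
apply: eq_smooth_at (smooth_at_coord l sr).
by apply: filterE => x; rewrite row_mxEr.
Qed.

Lemma smooth_at_lsubmx n m k (p : 'rV[R]_n -> 'rV[R]_(m + k)) a :
  smooth_at p a -> smooth_at (fun x => lsubmx (p x)) a.
Proof.
move=> sp; apply/smooth_at_rowP => j; apply: eq_smooth_at (smooth_at_coord (lshift k j) sp).
by apply: filterE => x; rewrite mxE.
Qed.

Lemma smooth_at_rsubmx n m k (p : 'rV[R]_n -> 'rV[R]_(m + k)) a :
  smooth_at p a -> smooth_at (fun x => rsubmx (p x)) a.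
Proof.
move=> sp; apply/smooth_at_rowP => j; apply: eq_smooth_at (smooth_at_coord (rshift m j) sp).
by apply: filterE => x; rewrite mxE.
Qed.

Lemma derive_affine n m (W : normedModType R) (A B : 'rV[R]_n -> 'rV[R]_m)
    (h : 'rV[R]_m -> W) x v :
  (forall (s : R) y, A (s *: v + y) = s *: B v + A y) ->
  'D_v (fun y => h (A y)) x = 'D_(B v) h (A x).
Proof.
move=> AE; have E : (fun s : R => s^-1 *: (((fun y => h (A y)) \o shift x) (s *: v) - h (A x)))
   = (fun s : R => s^-1 *: ((h \o shift (A x)) (s *: B v) - h (A x))).
  by apply/funext => s /=; rewrite AE.
by rewrite /derive E.
Qed.

Lemma delta_lshift n m (i : 'I_n) : 'e_(lshift m i) = row_mx 'e_i 0 :> 'rV[R]_(n + m).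
Proof.
apply/rowP => j; case: (splitP j) => l jl.
  have -> : j = lshift m l by exact: val_inj.
  by rewrite row_mxEl !mxE eq_lshift.
have -> : j = rshift n l by exact: val_inj.
by rewrite row_mxEr !mxE eq_rlshift.
Qed.

Lemma delta_rshift n m (i : 'I_m) : 'e_(rshift n i) = row_mx 0 'e_i :> 'rV[R]_(n + m).
Proof.
apply/rowP => j; case: (splitP j) => l jl.
  have -> : j = lshift m l by exact: val_inj.
  by rewrite row_mxEl !mxE eq_lrshift.
have -> : j = rshift n l by exact: val_inj.
by rewrite row_mxEr !mxE eq_rshift.
Qed.

Lemma derive_row_mx0 n m (W : normedModType R) (h : 'rV[R]_(n + m) -> W) t q i :
  'D_('e_i) (fun q => h (row_mx q t)) q = 'D_('e_(lshift m i)) h (row_mx q t).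
Proof.
rewrite delta_lshift (@derive_affine _ _ _ (fun y => row_mx y t) (fun y => row_mx y 0))//.
by move=> s y; rewrite scale_row_mx add_row_mx scaler0 add0r.
Qed.

Lemma hess_row_mx0 n m (h : 'rV[R]_(n + m) -> R) i j :
  hess (fun q => h (row_mx q 0)) i j = hess h (lshift m i) (lshift m j).
Proof.
rewrite !hessE.
have -> : (fun x : 'rV[R]_n => 'D_('e_i) (fun q => h (row_mx q 0)) x) =
          fun x => 'D_('e_(lshift m i)) h (row_mx x 0).
  by apply/funext => x; rewrite derive_row_mx0.
by rewrite (derive_row_mx0 (fun y => 'D_('e_(lshift m i)) h y)) row_mx0.
Qed.

Lemma near_eq_hess n (f g : 'rV[R]_n -> R) i j :
  {near (0 : 'rV[R]_n), f =1 g} -> hess f i j = hess g i j.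
Proof. by move=> fg; rewrite !hessE; apply: near_eq_derive; exact: (near_partials [:: i] fg). Qed.

Lemma ord2_cases (l : 'I_2) : l = 0 \/ l = 1.
Proof. by case: l => -[|[|//]] lt; [left|right]; exact: val_inj. Qed.

Lemma indep_row_mx n (f : 'rV[R]_(2 + n) -> R) y u :
  (forall r q, f (upd (lshift n 0) r q) = f q /\ f (upd (lshift n 1) r q) = f q) ->
  f (row_mx y u) = f (row_mx 0 u).
Proof.
move=> fi; have -> : row_mx y u = upd (lshift n 0) (y 0 0) (upd (lshift n 1) (y 0 1) (row_mx 0 u)).
  apply/rowP => j; rewrite !updE; case: (splitP j) => l jl; last first.
    have -> : j = rshift 2 l by exact: val_inj.
    by rewrite !row_mxEr !eq_rlshift.
  have -> : j = lshift n l by exact: val_inj.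
  rewrite !row_mxEl !eq_lshift.
  by case: (ord2_cases l) => ->.
by have [-> _] := fi (y 0 0) (upd (lshift n 1) (y 0 1) (row_mx 0 u));
   have [_ ->] := fi (y 0 1) (row_mx 0 u).
Qed.

Lemma preserve_rsubmx n (P : 'rV[R]_(2 + n) -> 'rV[R]_(2 + n)) q :
  (forall q (k : 'I_(2 + n)), k != lshift n 0 -> k != lshift n 1 -> P q 0 k = q 0 k) ->
  rsubmx (P q) = rsubmx q.
Proof. by move=> PE; apply/rowP => j; rewrite !mxE PE// eq_rlshift. Qed.

(** F and the given G are merged into Gh(q, t, s) = F(q, t) + G(q, s) - F(q, 0), which is F for s =
    0 and G for t = 0. The Morse lemma with parameters (t, s) brings Gh to f(t, s) plus signed
    squares. As f_t is nonzero, f(b(s), 0) = f(0, s) has a solution b, and moving a point from the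
    fibre (0, s) to the fibre (b(s), 0) with the same Morse coordinates induces G from F. *)
Lemma versal_of_transverse (F : 'rV[R]_(2 + 1) -> R) : smooth_at F 0 ->
  (forall i : 'I_2, 'D_('e_(lshift 1 i)) F 0 = 0) ->
  hess_det (fun q => F (row_mx q 0)) 0 1 != 0 ->
  'D_('e_(rshift 2 0)) F 0 != 0 -> R_versal F.
Proof.
move=> sF DF HF DtF k G sG GF.
pose a1 (z : 'rV[R]_(2 + (1 + k))) : 'rV[R]_(2 + 1) :=
  row_mx (lsubmx z) (lsubmx (rsubmx z)).
pose a2 (z : 'rV[R]_(2 + (1 + k))) : 'rV[R]_(2 + k) :=
  row_mx (lsubmx z) (rsubmx (rsubmx z)).
pose a3 (z : 'rV[R]_(2 + (1 + k))) : 'rV[R]_(2 + 1) := row_mx (lsubmx z) 0.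
have sa1 z : smooth_at a1 z.
  apply: smooth_at_row_mx; first exact/smooth_at_lsubmx/smooth_at_id.
  exact/smooth_at_lsubmx/smooth_at_rsubmx/smooth_at_id.
have sa2 z : smooth_at a2 z.
  apply: smooth_at_row_mx; first exact/smooth_at_lsubmx/smooth_at_id.
  exact/smooth_at_rsubmx/smooth_at_rsubmx/smooth_at_id.
have sa3 z : smooth_at a3 z.
  apply: smooth_at_row_mx; first exact/smooth_at_lsubmx/smooth_at_id.
  exact: smooth_at_cst.
have a10 : a1 0 = 0 by rewrite /a1 !linear0 row_mx0.
have a20 : a2 0 = 0 by rewrite /a2 !linear0 row_mx0.
have a30 : a3 0 = 0 by rewrite /a3 !linear0 row_mx0.
pose Gh z := F (a1 z) + G (a2 z) - F (a3 z).
have sFa1 : smooth_at (fun z => F (a1 z)) 0 by apply: (smooth_at_scalarcomp (sa1 0)); rewrite a10.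
have sGa2 : smooth_at (fun z => G (a2 z)) 0 by apply: (smooth_at_scalarcomp (sa2 0)); rewrite a20.
have sFa3 : smooth_at (fun z => F (a3 z)) 0 by apply: (smooth_at_scalarcomp (sa3 0)); rewrite a30.
have sGh : smooth_at Gh 0 := smooth_atB (smooth_atD sFa1 sGa2) sFa3.
have GhE q t s : Gh (row_mx q (row_mx t s)) = F (row_mx q t) + G (row_mx q s) - F (row_mx q 0).
  by rewrite /Gh /a1 /a2 /a3 !(row_mxKl, row_mxKr).
have Gh0 : {near (0 : 'rV[R]_2), (fun q => Gh (row_mx q 0)) =1 (fun q => F (row_mx q 0))}.
  apply: filterS GF => q GFq; rewrite -[X in row_mx q X]row_mx0 GhE GFq.
  by rewrite addrK.
have DGh i : 'D_('e_(lshift (1 + k) i)) Gh 0 = 0.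
  have := derive_row_mx0 Gh 0 0 i; rewrite row_mx0 => <-.
  by rewrite (near_eq_derive _ Gh0) derive_row_mx0 row_mx0 DF.
have HGh : hess_det Gh (lshift (1 + k) 0) (lshift (1 + k) 1) != 0.
  by rewrite /hess_det -!hess_row_mx0 !(near_eq_hess _ _ Gh0).
have I01 : lshift (1 + k) (0 : 'I_2) != lshift (1 + k) 1 by rewrite eq_lshift.
have [P [f [s1 [s2 [dP sf fi PE GhP]]]]] := morse_lemma I01 sGh (DGh 0) (DGh 1) HGh.
have [P0 sP _] := dP.
have [T [[T0 sT _] TP PT]] := diffeo_germ_inv dP.
have rP q := preserve_rsubmx q PE.
have rT : \forall q \near (0 : 'rV[R]_(2 + (1 + k))), rsubmx (T q) = rsubmx q.
  by apply: filterS PT => q PTq; rewrite -{2}PTq rP.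
pose I2 := rshift 2 (lshift k (0 : 'I_1)).
(* P preserves the parameters, the q-derivatives of Gh vanish at 0, and so do the first derivatives
   of the squares; hence the t-derivative survives the coordinate change. *)
have Dtf : 'D_('e_I2) f 0 = 'D_('e_(rshift 2 0)) F 0.
  have DGhT : 'D_('e_I2) Gh 0 = 'D_('e_(rshift 2 0)) F 0.
    have d1 := smooth_at_diff sFa1; have d2 := smooth_at_diff sGa2.
    have d3 := smooth_at_diff sFa3.
    rewrite [LHS]deriveB; [|exact/diff_derivable/differentiableD|exact: diff_derivable].
    rewrite (deriveD_at _ d1 d2).
    rewrite (@derive_affine _ _ _ a1 a1); last first.
      by move=> u y; rewrite /a1 !linearP scale_row_mx add_row_mx.
    rewrite (@derive_affine _ _ _ a2 a2); last first.
      by move=> u y; rewrite /a2 !linearP scale_row_mx add_row_mx.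
    rewrite (@derive_affine _ _ _ a3 a3); last first.
      by move=> u y; rewrite /a3 !linearP scale_row_mx add_row_mx scaler0 add0r.
    have eI : 'e_I2 = row_mx 0 (row_mx 'e_0 0) :> 'rV[R]_(2 + (1 + k)).
      by rewrite delta_rshift delta_lshift.
    rewrite a10 eI /a1 /a2 /a3 !(row_mxKl, row_mxKr) !row_mx0 !derive0.
    by rewrite addr0 subr0 delta_rshift.
  have sfd : differentiable f 0 := smooth_at_diff sf.
  have dsq i c : differentiable (fun q : 'rV[R]_(2 + (1 + k)) => c * q 0 i ^+ 2) 0.
    apply/smooth_at_diff/smooth_atM; first exact: smooth_at_cst.
    exact/smooth_atX/smooth_at_proj.
  have Dsq i c v : 'D_v (fun q : 'rV[R]_(2 + (1 + k)) => c * q 0 i ^+ 2) 0 = 0.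
    rewrite (deriveM_at _ (smooth_at_diff (smooth_at_cst (c : R) 0))); last first.
      exact/smooth_at_diff/smooth_atX/smooth_at_proj.
    rewrite derive_cst (deriveX_at _ _ (smooth_at_diff (smooth_at_proj 0 i))).
    by rewrite mxE expr1 !(mulr0, mul0r) addr0.
  have := near_eq_derive 'e_I2 GhP.
  have dff := differentiableD sfd (dsq (lshift (1 + k) 0) ((-1) ^+ s1)).
  rewrite [X in _ = X -> _](deriveD_at _ dff (dsq _ _)).
  rewrite (deriveD_at _ sfd (dsq _ _)) !Dsq !addr0 => <-; rewrite -DGhT.
  rewrite (derive_chain _ (smooth_at_diff sP)); last by rewrite P0; exact: smooth_at_diff.
  rewrite big_split_ord /= big1 => [|i _]; last by rewrite P0 DGh mul0r.
  rewrite add0r (bigD1 (lshift k (0 : 'I_1)))//= big1 => [|j jI].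
    rewrite addr0 P0 (_ : 'D_('e_I2) (fun y => P y 0 I2) 0 = 1) ?mulr1//.
    rewrite (_ : (fun y => P y 0 I2) = fun y => y 0 I2).
      by rewrite derive_proj mxE !eqxx.
    by apply/funext => y; rewrite PE// eq_rlshift.
  rewrite (_ : (fun y => P y 0 (rshift 2 j)) = fun y => y 0 (rshift 2 j)).
    by rewrite derive_proj mxE eq_rshift (negPf jI) mulr0.
  by apply/funext => y; rewrite PE// eq_rlshift.
(* The equation wf(t, s) = f(t, 0) - f(0, s) = 0 is to be solved for t = b(s). *)
pose wf (u : 'rV[R]_(1 + k)) := f (row_mx 0 (row_mx (lsubmx u) 0)) -
  f (row_mx 0 (row_mx 0 (rsubmx u))).
have sl1 : smooth_at (fun u : 'rV[R]_(1 + k) => row_mx (0 : 'rV[R]_2) (row_mx (lsubmx u) (0 : 'rV[R]_k))) 0.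
  apply: smooth_at_row_mx; first exact: smooth_at_cst.
  apply: smooth_at_row_mx; last exact: smooth_at_cst.
  exact/smooth_at_lsubmx/smooth_at_id.
have sl2 : smooth_at (fun u : 'rV[R]_(1 + k) => row_mx (0 : 'rV[R]_2) (row_mx (0 : 'rV[R]_1) (rsubmx u))) 0.
  apply: smooth_at_row_mx; first exact: smooth_at_cst.
  apply: smooth_at_row_mx; first exact: smooth_at_cst.
  exact/smooth_at_rsubmx/smooth_at_id.
have sf1 : smooth_at (fun u : 'rV[R]_(1 + k) => f (row_mx 0 (row_mx (lsubmx u) 0))) 0.
  by apply: (smooth_at_scalarcomp sl1); rewrite linear0 !row_mx0.
have sf2 : smooth_at (fun u : 'rV[R]_(1 + k) => f (row_mx 0 (row_mx 0 (rsubmx u)))) 0.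
  by apply: (smooth_at_scalarcomp sl2); rewrite linear0 !row_mx0.
have swf : smooth_at wf 0 := smooth_atB sf1 sf2.
have wf0 : wf 0 = 0 by rewrite /wf !linear0 !row_mx0 subrr.
have Dwf : 'D_('e_(lshift k 0)) wf 0 != 0.
  rewrite [X in X != _]deriveB; [|exact: smooth_at_derivable|exact: smooth_at_derivable].
  rewrite (@derive_affine _ _ _ (fun u : 'rV[R]_(1 + k) => row_mx (0 : 'rV[R]_2) (row_mx (lsubmx u) (0 : 'rV[R]_k)))
    (fun u => row_mx 0 (row_mx (lsubmx u) 0))); last first.
    by move=> u y; rewrite linearP !scale_row_mx !add_row_mx !scaler0 !add0r.
  rewrite (@derive_affine _ _ _ (fun u : 'rV[R]_(1 + k) => row_mx (0 : 'rV[R]_2) (row_mx (0 : 'rV[R]_1) (rsubmx u)))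
    (fun u => row_mx 0 (row_mx 0 (rsubmx u)))); last first.
    by move=> u y; rewrite linearP !scale_row_mx !add_row_mx !scaler0 !add0r.
  rewrite delta_lshift row_mxKl row_mxKr !linear0 !row_mx0 derive0 subr0.
  by rewrite -delta_lshift -delta_rshift Dtf.
have [v [sv v0 _ vwf _]] := upd_diffeo_inv swf wf0 Dwf.
pose b (s : 'rV[R]_k) : 'rV[R]_1 := \row_j v (row_mx 0 s).
have s0s : smooth_at (fun s : 'rV[R]_k => row_mx (0 : 'rV[R]_1) s) 0.
  by apply: smooth_at_row_mx; [exact: smooth_at_cst|exact: smooth_at_id].
have r00 : row_mx (0 : 'rV[R]_1) (0 : 'rV[R]_k) = 0 by rewrite row_mx0.
have b0 : b 0 = 0 by apply/rowP => j; rewrite !mxE row_mx0 v0.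
have sb : smooth_at b 0.
  apply/smooth_at_rowP => j; apply: (@eq_smooth_at _ _ _ (fun s => v (row_mx 0 s))).
    by apply: filterE => s; rewrite mxE.
  by apply: (smooth_at_scalarcomp s0s); rewrite r00.
have fb : \forall s \near (0 : 'rV[R]_k),
    f (row_mx 0 (row_mx (b s) 0)) = f (row_mx 0 (row_mx 0 s)).
  apply: filterS (near_pullback (p := fun s : 'rV[R]_k => row_mx 0 s) r00 s0s vwf) => s.
  have -> : upd (lshift k 0) (v (row_mx 0 s)) (row_mx 0 s) = row_mx (b s) s.
    apply/rowP => j; rewrite updE; case: (splitP j) => l jl.
      have -> : j = lshift k l by exact: val_inj.
      by rewrite (ord1 l) eqxx row_mxEl mxE.
    have -> : j = rshift 1 l by exact: val_inj.
    by rewrite eq_rlshift !row_mxEr.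
  rewrite /wf row_mxKl row_mxKr row_mxEl mxE => /eqP.
  by rewrite subr_eq0 => /eqP.
(* [ze] gives the Morse coordinates of (q, 0, s); [xi] keeps the first two of them and replaces the
   parameters by (b(s), 0); p returns to the original coordinates by P. *)
pose ze (z : 'rV[R]_(2 + k)) := T (row_mx (lsubmx z) (row_mx 0 (rsubmx z))).
pose xi (z : 'rV[R]_(2 + k)) := row_mx (lsubmx (ze z)) (row_mx (b (rsubmx z)) (0 : 'rV[R]_k)).
pose p (z : 'rV[R]_(2 + k)) := lsubmx (P (xi z)).
pose em (z : 'rV[R]_(2 + k)) := row_mx (lsubmx z) (row_mx (0 : 'rV[R]_1) (rsubmx z)).
have sid : smooth_at (@id 'rV[R]_(2 + k)) 0 by exact: smooth_at_id.
have sem : smooth_at em 0.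
  apply: smooth_at_row_mx; first exact: smooth_at_lsubmx.
  by apply: smooth_at_row_mx; [exact: smooth_at_cst|exact: smooth_at_rsubmx].
have em0 : em 0 = 0 by rewrite /em !linear0 !row_mx0.
have sze : smooth_at ze 0 by apply: (smooth_at_comp sem); rewrite em0.
have ze0 : ze 0 = 0 by rewrite /ze !linear0 !row_mx0 T0.
have sbz : smooth_at (fun z : 'rV[R]_(2 + k) => b (rsubmx z)) 0.
  by apply: (smooth_at_comp (smooth_at_rsubmx sid)); rewrite linear0.
have sxi : smooth_at xi 0.
  apply: smooth_at_row_mx; first exact: smooth_at_lsubmx.
  by apply: smooth_at_row_mx => //; exact: smooth_at_cst.
have xi0 : xi 0 = 0 by rewrite /xi ze0 !linear0 b0 !row_mx0.
have sp : smooth_at p 0.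
  apply: smooth_at_lsubmx; apply: (@smooth_at_comp _ _ _ _ P xi); first exact: sxi.
  by rewrite xi0.
have p0 : p 0 = 0 by rewrite /p xi0 P0 linear0.
have rxi z : row_mx (p z) (row_mx (b (rsubmx z)) 0) = P (xi z).
  by rewrite -[RHS]hsubmxK rP /xi row_mxKr.
have rze : \forall z \near (0 : 'rV[R]_(2 + k)), rsubmx (ze z) = row_mx 0 (rsubmx z).
  apply: filterS (near_pullback em0 sem rT) => z.
  by rewrite /em row_mxKr.
have Pze : \forall z \near (0 : 'rV[R]_(2 + k)), P (ze z) = em z.
  exact: near_pullback em0 sem PT.
exists p, b; split=> //.
- have e0 : row_mx (0 : 'rV[R]_2) (0 : 'rV[R]_k) = 0 by rewrite row_mx0.
  have se : smooth_at (fun q : 'rV[R]_2 => row_mx q (0 : 'rV[R]_k)) 0.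
    by apply: smooth_at_row_mx; [exact: smooth_at_id|exact: smooth_at_cst].
  apply: filterS2 (near_pullback (p := fun q => row_mx q 0) e0 se rze)
    (near_pullback (p := fun q => row_mx q 0) e0 se Pze) => q.
  rewrite /p /xi row_mxKr b0 row_mx0 => zr; rewrite -zr hsubmxK => ->.
  by rewrite /em !row_mxKl.
- have GFp := near_pullback p0 sp GF.
  have E1 := near_pullback ze0 sze GhP.
  have E2 := near_pullback xi0 sxi GhP.
  have rs0 : rsubmx (0 : 'rV[R]_(2 + k)) = 0 by rewrite linear0.
  have fbz := near_pullback rs0 (smooth_at_rsubmx sid) fb.
  apply: filterS3 (filterI GFp fbz) (filterI E1 E2) (filterI rze Pze).
  move=> z [Gp fz] [e1 e2] [zr Pz].
  have -> : G z = Gh (P (ze z)).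
    by rewrite Pz /em GhE hsubmxK addrAC subrr add0r.
  have -> : F (row_mx (p z) (b (rsubmx z))) = Gh (P (xi z)).
    by rewrite -rxi GhE Gp addrK.
  rewrite e1 e2; congr (_ + _ * _ ^+ 2 + _ * _ ^+ 2).
  + rewrite -[ze z]hsubmxK zr !(indep_row_mx _ _ fi); exact: esym.
  + by rewrite /xi row_mxEl [in RHS]mxE.
  + by rewrite /xi row_mxEl [in RHS]mxE.
Qed.

(** Test unfolding: F(q, 0) + t has t-derivative 1 at 0, while the derivative of any unfolding
    induced from F is a combination of the partials of F at 0, all zero if the t-derivative is. *)
Lemma versal_transverse (F : 'rV[R]_(2 + 1) -> R) : smooth_at F 0 ->
  (forall i : 'I_2, 'D_('e_(lshift 1 i)) F 0 = 0) ->
  R_versal F -> 'D_('e_(rshift 2 0)) F 0 != 0.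
Proof.
move=> sF DF vF; apply/eqP => DtF.
pose t : 'I_(2 + 1) := rshift 2 0.
pose G (z : 'rV[R]_(2 + 1)) := F (row_mx (lsubmx z) 0) + z 0 t.
have sid : smooth_at (@id 'rV[R]_(2 + 1)) 0 by exact: smooth_at_id.
have sa : smooth_at (fun z : 'rV[R]_(2 + 1) => row_mx (lsubmx z) (0 : 'rV[R]_1)) 0.
  by apply: smooth_at_row_mx; [exact: smooth_at_lsubmx|exact: smooth_at_cst].
have sFa : smooth_at (fun z : 'rV[R]_(2 + 1) => F (row_mx (lsubmx z) 0)) 0.
  by apply: (smooth_at_scalarcomp sa); rewrite linear0 row_mx0.
have sG : smooth_at G 0 by apply: smooth_atD => //; exact: smooth_at_proj.
have [|p [b [sp pq sb b0 GE]]] := vF 1%N G sG.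
  by apply: filterE => q; rewrite /G row_mxKl row_mxEr mxE addr0.
have p0 : p 0 = 0 by have := nbhs_singleton pq; rewrite row_mx0.
pose h z := row_mx (p z) (b (rsubmx z)).
have sh : smooth_at h 0.
  apply: smooth_at_row_mx => //; apply: (smooth_at_comp (smooth_at_rsubmx sid)).
  by rewrite linear0.
have h0 : h 0 = 0 by rewrite /h p0 linear0 b0 row_mx0.
have := near_eq_derive 'e_t GE.
rewrite (deriveD_at _ (smooth_at_diff sFa) (smooth_at_diff (smooth_at_proj 0 t))).
rewrite (@derive_affine _ _ _ (fun z : 'rV[R]_(2 + 1) => row_mx (lsubmx z) (0 : 'rV[R]_1))
  (fun z => row_mx (lsubmx z) 0)); last first.
  by move=> u y; rewrite linearP scale_row_mx add_row_mx scaler0 add0r.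
rewrite {1}delta_rshift row_mxKl row_mx0 derive0 add0r derive_proj mxE !eqxx.
rewrite (derive_chain (p := h) _ (smooth_at_diff sh)); last first.
  by rewrite h0; exact: smooth_at_diff.
rewrite h0 big1 => [|j _]; first by move/eqP; rewrite oner_eq0.
suff -> : 'D_('e_j) F 0 = 0 by rewrite mul0r.
case: (splitP j) => l jl.
  by have -> : j = lshift 1 l by [exact: val_inj]; exact: DF.
have -> : j = rshift 2 l by exact: val_inj.
by rewrite (ord1 l); exact: DtF.
Qed.

End Versality.

(** * Jets at 0: continuous dependence on a parameter, and congruence to finite order *)

Section Jets.
Context {R : realType} {n : nat}.
Implicit Types (f g : 'rV[R]_n -> R).

Lemma partials_cat (W : normedModType R) (f : 'rV[R]_n -> W) s s' :
  partials (partials f s) s' = partials f (s ++ s').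
Proof. by elim: s f => [//|i s IH] f /=; rewrite IH. Qed.

Lemma near_eq_partials (W : normedModType R) (f g : 'rV[R]_n -> W) s
    (a : 'rV[R]_n) :
  {near a, f =1 g} -> partials f s a = partials g s a.
Proof. by move=> /(near_partials s)/nbhs_singleton. Qed.

Lemma partialsD f g s a : smooth_at f a -> smooth_at g a ->
  partials (fun q => f q + g q) s a = partials f s a + partials g s a.
Proof.
elim: s f g => [//|i s IH] f g sf sg /=.
rewrite -IH; [|exact: smooth_at_partial..].
apply: near_eq_partials.
apply: filterS2 (smooth_at_near sf) (smooth_at_near sg) => q sfq sgq.
by apply: deriveD_at; exact: smooth_at_diff.
Qed.

Lemma near_deriveM f g a i : smooth_at f a -> smooth_at g a ->
  {near a, (fun q => 'D_('e_i) (fun q => f q * g q) q) =1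
           (fun q => f q * 'D_('e_i) g q + g q * 'D_('e_i) f q)}.
Proof.
move=> sf sg; apply: filterS2 (smooth_at_near sf) (smooth_at_near sg) => q sfq sgq.
by apply: deriveM_at; exact: smooth_at_diff.
Qed.

Lemma near_deriveD f g a i : smooth_at f a -> smooth_at g a ->
  {near a, (fun q => 'D_('e_i) (fun q => f q + g q) q) =1
           (fun q => 'D_('e_i) f q + 'D_('e_i) g q)}.
Proof.
move=> sf sg; apply: filterS2 (smooth_at_near sf) (smooth_at_near sg) => q sfq sgq.
by apply: deriveD_at; exact: smooth_at_diff.
Qed.

Section Continuity.
Context {X : topologicalType}.
Implicit Types T : X -> 'rV[R]_n -> R.

(** Continuity of a family of germs for the Whitney topology, stated so as to be stable under sums,
    products and partials; it therefore passes to polynomials in partials, such as Hbar. *)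
Definition jet_continuous T :=
  (forall x, smooth_at (T x) 0) /\ forall s, continuous (fun x => partials (T x) s 0).

Lemma jet_continuous_cst f : smooth_at f 0 -> jet_continuous (fun=> f).
Proof. by move=> sf; split=> // s; exact: cst_continuous. Qed.

Lemma jet_continuous_partial T i :
  jet_continuous T -> jet_continuous (fun x q => 'D_('e_i) (T x) q).
Proof.
by move=> [sT cT]; split=> [x|s]; [exact: smooth_at_partial|exact: (cT (i :: s))].
Qed.

Lemma jet_continuousD T1 T2 : jet_continuous T1 -> jet_continuous T2 ->
  jet_continuous (fun x q => T1 x q + T2 x q).
Proof.
move=> [s1 c1] [s2 c2]; split=> [x|s x]; first exact: smooth_atD.
have -> : (fun x => partials (fun q => T1 x q + T2 x q) s 0) =
    fun x => partials (T1 x) s 0 + partials (T2 x) s 0.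
  by apply/funext => y; rewrite partialsD.
by apply: cvgD; [exact: c1|exact: c2].
Qed.

Lemma jet_continuousM T1 T2 : jet_continuous T1 -> jet_continuous T2 ->
  jet_continuous (fun x q => T1 x q * T2 x q).
Proof.
move=> j1 j2; split=> [x|s]; first by apply: smooth_atM; [exact: j1.1|exact: j2.1].
elim: s T1 T2 j1 j2 => [|i s IH] T1 T2 j1 j2 x.
  by apply: cvgM; [exact: (j1.2 [::])|exact: (j2.2 [::])].
have [s1 _] := j1; have [s2 _] := j2.
have [d1 _] := jet_continuous_partial i j1; have [d2 _] := jet_continuous_partial i j2.
have -> : (fun x => partials (fun q => T1 x q * T2 x q) (i :: s) 0) =
    fun x => partials (fun q => T1 x q * 'D_('e_i) (T2 x) q) s 0 +
             partials (fun q => T2 x q * 'D_('e_i) (T1 x) q) s 0.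
  apply/funext => y; rewrite -partialsD; [|exact: smooth_atM..].
  rewrite -[LHS]/(partials (fun q => 'D_('e_i) (fun q => T1 y q * T2 y q) q) s 0).
  by apply: near_eq_partials; exact: near_deriveM.
apply: cvgD; first exact: (IH T1 _ j1 (jet_continuous_partial i j2)).
exact: (IH T2 _ j2 (jet_continuous_partial i j1)).
Qed.

Lemma jet_continuousN T : jet_continuous T -> jet_continuous (fun x q => - T x q).
Proof.
move=> jT; have -> : (fun x q => - T x q) = fun x q => (-1) * T x q.
  by apply/funext => x; apply/funext => q; rewrite mulN1r.
by apply: jet_continuousM => //; apply: jet_continuous_cst; exact: smooth_at_cst.
Qed.

End Continuity.

(** For smooth f: the partials of order less than k vanish at 0, that is, f lies in the k-th power
    of the maximal ideal. *)
Fixpoint vanish k f := if k is k'.+1 then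
  f 0 = 0 /\ forall i, vanish k' (fun q => 'D_('e_i) f q) else True.

Lemma near_vanish k f g : {near (0 : 'rV[R]_n), f =1 g} -> vanish k f -> vanish k g.
Proof.
elim: k f g => [//|k IH] f g fg [f0 Df]; split; first by rewrite -(nbhs_singleton fg).
by move=> i; apply: IH (Df i); exact: (near_partials [:: i] fg).
Qed.

Lemma vanishW k f : vanish k.+1 f -> vanish k f.
Proof. by elim: k f => [//|k IH] f [f0 Df]; split=> // i; exact/IH/Df. Qed.

Lemma vanish0 k : vanish k (fun=> 0).
Proof.
elim: k => [//|k IH]; split=> // i.
by rewrite (_ : (fun q => _) = fun=> 0)//; apply/funext => q; rewrite derive_cst.
Qed.

Lemma vanishD k f g : smooth_at f 0 -> smooth_at g 0 ->
  vanish k f -> vanish k g -> vanish k (fun q => f q + g q).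
Proof.
elim: k f g => [//|k IH] f g sf sg [f0 Df] [g0 Dg]; split; first by rewrite f0 g0 addr0.
move=> i; apply: (@near_vanish k (fun q => 'D_('e_i) f q + 'D_('e_i) g q)).
  by apply: filterS (near_deriveD i sf sg) => q ->.
by apply: IH; [exact: smooth_at_partial..|exact: Df|exact: Dg].
Qed.

Lemma vanishM k f g : smooth_at f 0 -> smooth_at g 0 ->
  vanish k g -> vanish k (fun q => f q * g q).
Proof.
elim: k f g => [//|k IH] f g sf sg Dg; have [g0 Dgi] := Dg.
split; first by rewrite g0 mulr0.
move=> i; apply: (@near_vanish k (fun q => f q * 'D_('e_i) g q + 'D_('e_i) f q * g q)).
  by apply: filterS (near_deriveM i sf sg) => q ->; rewrite [g q * _]mulrC.
have sfi := smooth_at_partial i sf; have sgi := smooth_at_partial i sg.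
apply: vanishD; [exact: smooth_atM..| |]; apply: IH => //; first exact: Dgi.
exact: vanishW.
Qed.

(** Equality of jets of order k - 1: [jet_eq 2] determines the first derivatives at 0 and [jet_eq 3]
    the Hessian. Smoothness is included so that it is a congruence for the ring operations. *)
Definition jet_eq k f g :=
  [/\ smooth_at f 0, smooth_at g 0 & vanish k (fun q => f q - g q)].

Lemma near_jet_eq k f g : smooth_at f 0 -> {near (0 : 'rV[R]_n), f =1 g} -> jet_eq k f g.
Proof.
move=> sf fg; have sg := eq_smooth_at fg sf; split=> //.
apply: near_vanish (vanish0 k).
by apply: filterS fg => q ->; rewrite subrr.
Qed.

Lemma jet_eq_refl k f : smooth_at f 0 -> jet_eq k f f.
Proof. by move=> sf; apply: near_jet_eq => //; exact: filterE. Qed.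

Lemma jet_eq_trans k g f h : jet_eq k f g -> jet_eq k g h -> jet_eq k f h.
Proof.
move=> [sf sg fg] [_ sh gh]; split=> //.
rewrite (_ : (fun q => _) = fun q => (f q - g q) + (g q - h q)).
  by apply: vanishD => //; exact: smooth_atB.
by apply/funext => q; rewrite addrA subrK.
Qed.

Lemma jet_eqD k f f' g g' : jet_eq k f f' -> jet_eq k g g' ->
  jet_eq k (fun q => f q + g q) (fun q => f' q + g' q).
Proof.
move=> [sf sf' ff] [sg sg' gg]; split; [exact: smooth_atD..|].
rewrite (_ : (fun q => _) = fun q => (f q - f' q) + (g q - g' q)).
  by apply: vanishD => //; exact: smooth_atB.
by apply/funext => q; ring.
Qed.

Lemma jet_eqM k f f' g g' : jet_eq k f f' -> jet_eq k g g' ->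
  jet_eq k (fun q => f q * g q) (fun q => f' q * g' q).
Proof.
move=> [sf sf' ff] [sg sg' gg]; split; [exact: smooth_atM..|].
rewrite (_ : (fun q => _) = fun q => f q * (g q - g' q) + g' q * (f q - f' q)).
  have sfB := smooth_atB sf sf'; have sgB := smooth_atB sg sg'.
  by apply: vanishD; [exact: smooth_atM..|exact: vanishM|exact: vanishM].
by apply/funext => q; ring.
Qed.

Lemma jet_eqN k f f' : jet_eq k f f' -> jet_eq k (fun q => - f q) (fun q => - f' q).
Proof.
move=> ff; have c : jet_eq k (fun=> -1 : R) (fun=> -1 : R).
  by apply: jet_eq_refl; exact: smooth_at_cst.
by have := jet_eqM c ff; congr jet_eq; apply/funext => q; rewrite mulN1r.
Qed.

Lemma jet_eq_addr k f g : smooth_at f 0 -> smooth_at g 0 -> vanish k g ->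
  jet_eq k (fun q => f q + g q) f.
Proof.
move=> sf sg vg; split=> //; first exact: smooth_atD.
by rewrite (_ : (fun q => _) = g)//; apply/funext => q; rewrite addrAC subrr add0r.
Qed.

Lemma jet_eqS k f g : jet_eq k.+1 f g ->
  f 0 = g 0 /\ forall i, jet_eq k (fun q => 'D_('e_i) f q) (fun q => 'D_('e_i) g q).
Proof.
move=> [sf sg [fg0 Dfg]]; split; first by apply/eqP; rewrite -subr_eq0 fg0.
move=> i; have sfi := smooth_at_partial i sf; have sgi := smooth_at_partial i sg.
split=> //; apply: near_vanish (Dfg i).
apply: filterS2 (smooth_at_near sf) (smooth_at_near sg) => q sfq sgq.
by rewrite [LHS]deriveB//; exact: smooth_at_derivable.
Qed.

Lemma jet_eq2_derive f g i : jet_eq 2 f g -> 'D_('e_i) f 0 = 'D_('e_i) g 0.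
Proof. by move=> /jet_eqS[_ /(_ i)/jet_eqS[]]. Qed.

Lemma jet_eq3_hess f g i j : jet_eq 3 f g -> hess f i j = hess g i j.
Proof. by rewrite !hessE => /jet_eqS[_ /(_ i)/jet_eqS[_ /(_ j)/jet_eqS[]]]. Qed.

Lemma jet_eqW k f g : jet_eq k.+1 f g -> jet_eq k f g.
Proof. by move=> [sf sg /vanishW]. Qed.

Lemma hessM_vanish f g i j : smooth_at f 0 -> smooth_at g 0 -> vanish 2 g ->
  hess (fun q => f q * g q) i j = f 0 * hess g i j.
Proof.
move=> sf sg [g0 Dg]; have [gi0 _] := Dg i; have [gj0 _] := Dg j.
have sfi := smooth_at_partial i sf; have sgi := smooth_at_partial i sg.
rewrite hessE (near_eq_derive _ (near_deriveM i sf sg)).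
rewrite (deriveD_at _ (smooth_at_diff (smooth_atM sf sgi)) (smooth_at_diff (smooth_atM sg sfi))).
rewrite (deriveM_at _ (smooth_at_diff sf) (smooth_at_diff sgi)).
rewrite (deriveM_at _ (smooth_at_diff sg) (smooth_at_diff sfi)).
by rewrite g0 gi0 gj0 !(mul0r, mulr0) !addr0 -hessE.
Qed.

Lemma hessD f g i j : smooth_at f 0 -> smooth_at g 0 ->
  hess (fun q => f q + g q) i j = hess f i j + hess g i j.
Proof.
move=> sf sg; rewrite hessE (near_eq_derive _ (near_deriveD i sf sg)) !hessE.
by apply: deriveD_at; exact: smooth_at_partial_diff.
Qed.

End Jets.

(** * Hbar as a polynomial in first and second derivatives *)

Section HbarAlgebra.
Context {R : realType}.
Local Notation space := 'rV[R]_3.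

Lemma det_mx22 (M : 'M[R]_2) : \det M = M 0 0 * M 1 1 - M 0 1 * M 1 0.
Proof.
rewrite (expand_det_row _ 0) !big_ord_recl big_ord0 /cofactor !det_mx11 !mxE.
rewrite (_ : lift ord0 ord0 = 1); last exact: val_inj.
rewrite (_ : lift 1 0 = 0); last exact: val_inj.
by rewrite /= !add0n expr0 expr1 /=; ring.
Qed.

Lemma det_mx33 (M : 'M[R]_3) : \det M =
  M 0 0 * (M 1 1 * M 2 2 - M 1 2 * M 2 1) - M 0 1 * (M 1 0 * M 2 2 - M 1 2 * M 2 0)
  + M 0 2 * (M 1 0 * M 2 1 - M 1 1 * M 2 0).
Proof.
have e1 : lift ord0 ord0 = 1 :> 'I_3 by exact: val_inj.
have e2 : lift ord0 (lift ord0 ord0) = 2 :> 'I_3 by exact: val_inj.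
rewrite (expand_det_row _ 0) !big_ord_recl big_ord0 !e1 !e2 /cofactor !det_mx22 !mxE.
have l11 : lift 1 (1 : 'I_2) = 2 :> 'I_3 by exact: val_inj.
have l10 : lift 1 (0 : 'I_2) = 0 :> 'I_3 by exact: val_inj.
have l20 : lift 2 (0 : 'I_2) = 0 :> 'I_3 by exact: val_inj.
have l21 : lift 2 (1 : 'I_2) = 1 :> 'I_3 by exact: val_inj.
have l00 : lift 0 (0 : 'I_2) = 1 :> 'I_3 by exact: val_inj.
have l01 : lift 0 (1 : 'I_2) = 2 :> 'I_3 by exact: val_inj.
rewrite !l00 !l01 !l10 !l11 !l20 !l21.
by rewrite /= !add0n expr0 expr1 sqrrN expr1n; ring.
Qed.

Lemma det3E (a b c : space) : det3 a b c =
  a 0 0 * (b 0 1 * c 0 2 - b 0 2 * c 0 1) - a 0 1 * (b 0 0 * c 0 2 - b 0 2 * c 0 0)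
  + a 0 2 * (b 0 0 * c 0 1 - b 0 1 * c 0 0).
Proof.
pose M : 'M[R]_(1 + (1 + 1), 3) := col_mx a (col_mx b c).
have M0 j : (M : 'M_3) 0 j = a 0 j.
  have -> : M 0 j = M (lshift (1 + 1) 0) j by congr (M _ _); exact: val_inj.
  by rewrite /M col_mxEu.
have M1 j : (M : 'M_3) 1 j = b 0 j.
  have -> : M 1 j = M (rshift 1 (lshift 1 0)) j by congr (M _ _); exact: val_inj.
  by rewrite /M col_mxEd col_mxEu.
have M2 j : (M : 'M_3) 2 j = c 0 j.
  have -> : M 2 j = M (rshift 1 (rshift 1 0)) j by congr (M _ _); exact: val_inj.
  by rewrite /M !col_mxEd.
by rewrite /det3 -/M det_mx33 !M0 !M1 !M2.
Qed.

(** Hbar in terms of x_u, x_v, x_uu, x_uv, x_vv; by the defining property of the vector product only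
    determinants and scalar products remain. *)
Definition Hpoly (a b A B C : space) : R :=
  det3 a b A * mdot b b - 2 * det3 a b B * mdot a b + det3 a b C * mdot a a.

Lemma Hbar_Hpoly (x : 'rV[R]_2 -> space) q : Hbar x q =
  Hpoly ('D_('e_0) x q) ('D_('e_1) x q) (partials x [:: 0; 0] q)
    (partials x [:: 0; 1] q) (partials x [:: 1; 1] q).
Proof.
have N V : mdot (normal x q) V = det3 ('D_('e_0) x q) ('D_('e_1) x q) V := mcrossP _ _ _.
by rewrite /Hbar [lbar x q]N [mbar x q]N [nbar x q]N.
Qed.

(** One traversal of the polynomial serves several properties K: smoothness, continuity of jets, and
    congruence of jets. The type Y may carry an extra component, namely the parameter of a family or
    a choice between two versions. *)
Lemma Hpoly_closed (Y : Type) (K : set (Y -> R)) (a b A B C : Y -> space) :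
  (forall f g, K f -> K g -> K (fun y => f y + g y)) ->
  (forall f g, K f -> K g -> K (fun y => f y * g y)) ->
  (forall f, K f -> K (fun y => - f y)) -> K (fun=> 2) ->
  (forall j, K (fun y => a y 0 j)) -> (forall j, K (fun y => b y 0 j)) ->
  (forall j, K (fun y => A y 0 j)) -> (forall j, K (fun y => B y 0 j)) ->
  (forall j, K (fun y => C y 0 j)) ->
  K (fun y => Hpoly (a y) (b y) (A y) (B y) (C y)).
Proof.
move=> KD KM KN K2 Ka Kb KA KB' KC.
have KB f g : K f -> K g -> K (fun y => f y - g y).
  by move=> Kf Kg; exact: KD Kf (KN _ Kg).
have Kdet (c : Y -> space) : (forall j, K (fun y => c y 0 j)) ->
    K (fun y => det3 (a y) (b y) (c y)).
  move=> Kc; have minor i j : K (fun y => b y 0 i * c y 0 j - b y 0 j * c y 0 i).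
    exact: KB (KM _ _ (Kb i) (Kc j)) (KM _ _ (Kb j) (Kc i)).
  have := KD _ _ (KB _ _ (KM _ _ (Ka 0) (minor 1 2)) (KM _ _ (Ka 1) (minor 0 2)))
    (KM _ _ (Ka 2) (minor 0 1)).
  by congr K; apply/funext => y; rewrite det3E.
have Kdot (c d : Y -> space) : (forall j, K (fun y => c y 0 j)) ->
    (forall j, K (fun y => d y 0 j)) -> K (fun y => mdot (c y) (d y)).
  move=> Kc Kd.
  exact: KB (KD _ _ (KM _ _ (Kc 0) (Kd 0)) (KM _ _ (Kc 1) (Kd 1))) (KM _ _ (Kc 2) (Kd 2)).
exact: KD (KB _ _ (KM _ _ (Kdet _ KA) (Kdot _ _ Kb Kb))
  (KM _ _ (KM _ _ K2 (Kdet _ KB')) (Kdot _ _ Ka Kb))) (KM _ _ (Kdet _ KC) (Kdot _ _ Ka Ka)).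
Qed.

Lemma HpolyD (a b A B C N : space) (r s t : R) :
  Hpoly a b (A + r *: N) (B + s *: N) (C + t *: N) = Hpoly a b A B C +
  det3 a b N * (r * mdot b b - 2 * s * mdot a b + t * mdot a a).
Proof.
have lin (V W : space) (c : R) : det3 a b (V + c *: W) = det3 a b V + c * det3 a b W.
  by rewrite !det3E !mxE; ring.
by rewrite /Hpoly !lin; ring.
Qed.

(** The terms with u, v, w come from the second derivatives of the reparametrization; they are
    tangent and the determinant kills them. One Jacobian factor comes from the normal, two from the
    contraction of the second form with the first. *)
Lemma Hpoly_change (a b A B C : space) (p0 p1 r0 r1 u0 u1 v0 v1 w0 w1 : R) :
  Hpoly (p0 *: a + p1 *: b) (r0 *: a + r1 *: b)
    (u0 *: a + u1 *: b + ((p0 * p0) *: A + (p0 * p1 + p1 * p0) *: B + (p1 * p1) *: C))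
    (v0 *: a + v1 *: b + ((p0 * r0) *: A + (p0 * r1 + p1 * r0) *: B + (p1 * r1) *: C))
    (w0 *: a + w1 *: b + ((r0 * r0) *: A + (r0 * r1 + r1 * r0) *: B + (r1 * r1) *: C)) =
  (p0 * r1 - p1 * r0) ^+ 3 * Hpoly a b A B C.
Proof.
have det_change (V : space) : det3 (p0 *: a + p1 *: b) (r0 *: a + r1 *: b) V =
    (p0 * r1 - p1 * r0) * det3 a b V by rewrite !det3E !mxE; ring.
have det_lin (s t c d e : R) : det3 a b
    (s *: a + t *: b + (c *: A + d *: B + e *: C)) =
    c * det3 a b A + d * det3 a b B + e * det3 a b C.
  by rewrite !det3E !mxE; ring.
have dot_change (c d c' d' : R) : mdot (c *: a + d *: b) (c' *: a + d' *: b) =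
    c * c' * mdot a a + (c * d' + d * c') * mdot a b + d * d' * mdot b b.
  by rewrite /mdot !mxE; ring.
rewrite /Hpoly !det_change !det_lin !dot_change.
move: (det3 a b A) (det3 a b B) (det3 a b C) (mdot a a) (mdot a b) (mdot b b).
by move=> l m n E F G; ring.
Qed.

(** Both sides are the scalar square of the vector product of a and b, that is, Lagrange's identity
    in signature (2, 1). *)
Lemma det3_Gram (a b : space) : mdot a b ^+ 2 - mdot a a * mdot b b =
  det3 a b 'e_0 ^+ 2 + det3 a b 'e_1 ^+ 2 - det3 a b 'e_2 ^+ 2.
Proof. by rewrite !det3E /mdot !mxE /=; ring. Qed.

End HbarAlgebra.

(** * Behaviour of Hbar and delta under reparametrization *)

Section SurfaceGerms.
Context {R : realType}.
Local Notation plane := 'rV[R]_2.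
Local Notation space := 'rV[R]_3.
Implicit Types (x y : plane -> space).

Lemma near_comp n m (p : 'rV[R]_n -> 'rV[R]_m) q (Q : set 'rV[R]_m) :
  smooth_at p q -> (\forall z \near p q, Q z) -> \forall z \near q, Q (p z).
Proof. by move=> /smooth_at_continuous cp; exact: cp. Qed.

Lemma partials_coord n m (f : 'rV[R]_n -> 'rV[R]_m) a s j : smooth_at f a ->
  partials (fun q => f q 0 j) s a = partials f s a 0 j.
Proof.
elim: s f => [//|i s IH] f sf; rewrite [RHS]/=.
rewrite -(IH (fun q => 'D_('e_i) f q)); last exact: smooth_at_partial.
rewrite -[LHS]/(partials (fun q => 'D_('e_i) (fun q => f q 0 j) q) s a).
apply: near_eq_partials; apply: filterS (smooth_at_near sf) => q sfq.
by rewrite derive_coord//; exact: smooth_at_diff.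
Qed.

Lemma smooth_Hbar x a : smooth_at x a -> smooth_at (Hbar x) a.
Proof.
move=> sx; have sc s j : smooth_at (fun q => partials x s q 0 j) a.
  exact/smooth_at_coord/smooth_at_partials.
have := @Hpoly_closed R plane [set f | smooth_at f a] (partials x [:: 0])
  (partials x [:: 1]) (partials x [:: 0; 0]) (partials x [:: 0; 1]) (partials x [:: 1; 1])
  (fun f g => @smooth_atD _ _ _ f g a) (fun f g => @smooth_atM _ _ f g a)
  (fun f => @smooth_atN _ _ f a) (smooth_at_cst (2 : R) a)
  (sc _) (sc _) (sc _) (sc _) (sc _).
apply: eq_smooth_at; apply: filterE => q.
by rewrite Hbar_Hpoly.
Qed.

Lemma near_eq_Hbar x y (a : plane) : {near a, x =1 y} -> {near a, Hbar x =1 Hbar y}.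
Proof.
move=> xy; apply: filterS (near_join xy) => q xyq.
have E s := near_eq_partials s xyq.
by rewrite !Hbar_Hpoly !E -[ 'D_('e_0) x q]/(partials x [:: 0] q)
   -['D_('e_1) x q]/(partials x [:: 1] q) !E.
Qed.

Lemma singular_germP (g : plane -> R) : smooth_at g 0 ->
  singular_germ g <-> g 0 = 0 /\ forall i, 'D_('e_i) g 0 = 0.
Proof.
move=> sg; have dg := smooth_at_diff sg; split=> [[g0 Dg]|[g0 Dg]]; split=> //.
  by move=> i; rewrite deriveE// Dg.
apply/funext => v; rewrite -deriveE// derive_sumE// big1// => j _.
by rewrite Dg scaler0.
Qed.

Lemma sum_ord2 (f : 'I_2 -> R) : \sum_i f i = f 0 + f 1.
Proof. by rewrite !big_ord_recl big_ord0 addr0; congr (_ + f _); exact: val_inj. Qed.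

Section ChangeOfParameters.
Context (p : plane -> plane).
Let P i k q : R := 'D_('e_i) (fun q => p q 0 k) q.

Lemma derive_plane_comp (f : plane -> R) q i : smooth_at p q -> smooth_at f (p q) ->
  'D_('e_i) (fun q => f (p q)) q =
  P i 0 q * 'D_('e_0) f (p q) + P i 1 q * 'D_('e_1) f (p q).
Proof.
move=> sp sf; rewrite (derive_chain _ (smooth_at_diff sp) (smooth_at_diff sf)).
by rewrite sum_ord2 mulrC ['D_('e_1) f _ * _]mulrC.
Qed.

Lemma derive2_plane_comp (f : plane -> R) q k l : smooth_at p q -> smooth_at f (p q) ->
  'D_('e_l) (fun q => 'D_('e_k) (fun q => f (p q)) q) q =
  'D_('e_l) (P k 0) q * 'D_('e_0) f (p q) + 'D_('e_l) (P k 1) q * 'D_('e_1) f (p q) +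
  (P k 0 q * P l 0 q * partials f [:: 0; 0] (p q) +
   (P k 0 q * P l 1 q + P k 1 q * P l 0 q) * partials f [:: 0; 1] (p q) +
   P k 1 q * P l 1 q * partials f [:: 1; 1] (p q)).
Proof.
have alg (a0 a1 b0 b1 d0 d1 f0 f1 f00 f01 f10 f11 : R) : f10 = f01 ->
  a0 * (b0 * f00 + b1 * f01) + f0 * d0 + (a1 * (b0 * f10 + b1 * f11) + f1 * d1) =
  d0 * f0 + d1 * f1 + (a0 * b0 * f00 + (a0 * b1 + a1 * b0) * f01 + a1 * b1 * f11).
  by move=> ->; ring.
move=> sp sf; have sP i j : smooth_at (P i j) q by exact/smooth_at_partial/smooth_at_coord.
have sD i : smooth_at (fun z => 'D_('e_i) f z) (p q) by exact: smooth_at_partial.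
have sDp i : smooth_at (fun z => 'D_('e_i) f (p z)) q.
  exact: (smooth_at_scalarcomp (f := fun z => 'D_('e_i) f z) sp (sD i)).
have near1 : {near q, (fun q => 'D_('e_k) (fun q => f (p q)) q) =1
    (fun q => P k 0 q * 'D_('e_0) f (p q) + P k 1 q * 'D_('e_1) f (p q))}.
  apply: filterS2 (smooth_at_near sp) (near_comp sp (smooth_at_near sf)) => z spz sfz.
  exact: derive_plane_comp.
rewrite (near_eq_derive _ near1).
have d0 := smooth_at_diff (smooth_atM (sP k 0) (sDp 0)).
have d1 := smooth_at_diff (smooth_atM (sP k 1) (sDp 1)).
rewrite (deriveD_at _ d0 d1).
rewrite (deriveM_at _ (smooth_at_diff (sP k 0)) (smooth_at_diff (sDp 0))).
rewrite (deriveM_at _ (smooth_at_diff (sP k 1)) (smooth_at_diff (sDp 1))).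
rewrite (derive_plane_comp l sp (sD 0)) (derive_plane_comp l sp (sD 1)).
exact: alg (esym (derive_comm 0 1 sf)).
Qed.

Definition jacobian2 q := P 0 0 q * P 1 1 q - P 0 1 q * P 1 0 q.

Lemma smooth_jacobian2 q : smooth_at p q -> smooth_at jacobian2 q.
Proof.
move=> sp; have sP i j : smooth_at (P i j) q by exact/smooth_at_partial/smooth_at_coord.
by apply: smooth_atB; exact: smooth_atM.
Qed.

Lemma Hbar_delta_comp x q : smooth_at p q -> smooth_at x (p q) ->
  Hbar (fun q => x (p q)) q = jacobian2 q ^+ 3 * Hbar x (p q) /\
  delta (fun q => x (p q)) q = jacobian2 q ^+ 2 * delta x (p q).
Proof.
move=> sp sx; have sxp : smooth_at (fun q => x (p q)) q by exact: (smooth_at_comp sp).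
have sxj j : smooth_at (fun z => x z 0 j) (p q) by exact: smooth_at_coord.
have D1 k : 'D_('e_k) (fun q => x (p q)) q =
    P k 0 q *: 'D_('e_0) x (p q) + P k 1 q *: 'D_('e_1) x (p q).
  apply/rowP => j; rewrite -(derive_coord 'e_k j (smooth_at_diff sxp)).
  have E (a b : R) (u v : space) : (a *: u + b *: v) 0 j = a * u 0 j + b * v 0 j.
    by rewrite !mxE.
  rewrite E (derive_plane_comp k sp (sxj j)).
  by congr (P k 0 q * _ + P k 1 q * _); exact: (derive_coord _ j (smooth_at_diff sx)).
have D2 k l : partials (fun q => x (p q)) [:: k; l] q =
    'D_('e_l) (P k 0) q *: 'D_('e_0) x (p q) + 'D_('e_l) (P k 1) q *: 'D_('e_1) x (p q) +
    ((P k 0 q * P l 0 q) *: partials x [:: 0; 0] (p q) +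
     (P k 0 q * P l 1 q + P k 1 q * P l 0 q) *: partials x [:: 0; 1] (p q) +
     (P k 1 q * P l 1 q) *: partials x [:: 1; 1] (p q)).
  apply/rowP => j; rewrite -(partials_coord [:: k; l] j sxp).
  have E (a b c d e : R) (u v w z r : space) :
    (a *: u + b *: v + (c *: w + d *: z + e *: r)) 0 j =
    a * u 0 j + b * v 0 j + (c * w 0 j + d * z 0 j + e * r 0 j) by rewrite !mxE.
  rewrite E; apply: (eq_trans (derive2_plane_comp k l sp (sxj j))).
  congr ('D_('e_l) (P k 0) q * _ + 'D_('e_l) (P k 1) q * _ +
    (P k 0 q * P l 0 q * _ + (P k 0 q * P l 1 q + P k 1 q * P l 0 q) * _ +
     P k 1 q * P l 1 q * _)).
  - exact: (derive_coord _ j (smooth_at_diff sx)).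
  - exact: (derive_coord _ j (smooth_at_diff sx)).
  - exact: (partials_coord _ j sx).
  - exact: (partials_coord _ j sx).
  - exact: (partials_coord _ j sx).
split.
  by rewrite !Hbar_Hpoly !D1 !D2; exact: Hpoly_change.
rewrite /delta /Efun /Ffun /Gfun !D1 /jacobian2.
move: (P 0 0 q) (P 0 1 q) (P 1 0 q) (P 1 1 q) ('D_('e_0) x (p q)) ('D_('e_1) x (p q)).
by move=> a b c d u v; rewrite /mdot !mxE; ring.
Qed.

End ChangeOfParameters.

End SurfaceGerms.

(** * Nondegenerate critical germs in the plane and type A1 *)

Section CriticalGerms.
Context {R : realType}.
Local Notation plane := 'rV[R]_2.
Local Notation space := 'rV[R]_3.

Definition critical (g : plane -> R) := g 0 = 0 /\ forall i, 'D_('e_i) g 0 = 0.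

Definition nondegenerate (g : plane -> R) := hess_det g 0 1 != 0.

Section Pullback.
Context (g : plane -> R) (p : plane -> plane).
Context (sg : smooth_at g 0) (cg : critical g) (sp : smooth_at p 0) (p0 : p 0 = 0).

Let sgp : smooth_at g (p 0). Proof. by rewrite p0. Qed.

Let P i k := 'D_('e_i) (fun q => p q 0 k) 0.

Lemma critical_comp : critical (fun q => g (p q)).
Proof.
split=> [|i]; first by rewrite p0 cg.1.
by rewrite (derive_plane_comp i sp sgp) p0 !cg.2 !mulr0 addr0.
Qed.

Lemma hess_comp k l : hess (fun q => g (p q)) k l =
  P k 0 * P l 0 * hess g 0 0 + (P k 0 * P l 1 + P k 1 * P l 0) * hess g 0 1 +
  P k 1 * P l 1 * hess g 1 1.
Proof.
have alg (a b c d t : R) : c = 0 -> d = 0 -> a * c + b * d + t = t.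
  by move=> -> ->; ring.
rewrite hessE; apply: (eq_trans (derive2_plane_comp k l sp sgp)); rewrite p0.
by rewrite !hessE; exact: alg (cg.2 0) (cg.2 1).
Qed.

Lemma hess_det_comp :
  hess_det (fun q => g (p q)) 0 1 = jacobian2 p 0 ^+ 2 * hess_det g 0 1.
Proof.
rewrite /hess_det !hess_comp /jacobian2 -!/(P _ _).
move: (hess g 0 0) (hess g 0 1) (hess g 1 1) (P 0 0) (P 0 1) (P 1 0) (P 1 1).
by move=> a b c d e f h; ring.
Qed.

(** At a critical point of value 0 the derivatives of m and the second derivatives of p drop out of
    the Hessian of m (g o p). Under reparametrization Hbar has this form with m the cube of the
    Jacobian. *)
Lemma hess_det_mul_comp (m : plane -> R) : smooth_at m 0 ->
  critical (fun q => m q * g (p q)) /\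
  hess_det (fun q => m q * g (p q)) 0 1 =
  m 0 ^+ 2 * jacobian2 p 0 ^+ 2 * hess_det g 0 1.
Proof.
move=> sm; have [gp0 Dgp] := critical_comp.
have sgpq : smooth_at (fun q => g (p q)) 0 by exact: (smooth_at_scalarcomp sp).
have v2 : vanish 2 (fun q => g (p q)) by split=> // i; split.
split; last first.
  rewrite -mulrA -hess_det_comp /hess_det !(hessM_vanish _ _ sm sgpq v2).
  by move: (m 0) (hess _ 0 0) (hess _ 1 1) (hess _ 0 1) => a b c d; ring.
split=> [|i]; first by rewrite gp0 mulr0.
rewrite (deriveM_at _ (smooth_at_diff sm) (smooth_at_diff sgpq)) Dgp gp0.
by rewrite mulr0 mul0r addr0.
Qed.

End Pullback.

Lemma near_critical (f g : plane -> R) : {near (0 : plane), f =1 g} ->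
  critical f -> critical g.
Proof.
move=> fg [f0 Df]; split=> [|i]; first by rewrite -(nbhs_singleton fg).
by rewrite -(near_eq_derive _ fg).
Qed.

Lemma near_hess_det (f g : plane -> R) : {near (0 : plane), f =1 g} ->
  hess_det f 0 1 = hess_det g 0 1.
Proof. by move=> fg; rewrite /hess_det !(near_eq_hess _ _ fg). Qed.

Lemma param_smooth (x : @param R) : smooth_at x 0.
Proof. by have [] := germP x. Qed.

Lemma reparam_Hbar (x y : @param R) : reparam x y -> exists p : plane -> plane,
  [/\ p 0 = 0, smooth_at p 0,
    {near (0 : plane), Hbar y =1 fun q => jacobian2 p q ^+ 3 * Hbar x (p q)} &
    delta y 0 = jacobian2 p 0 ^+ 2 * delta x 0].
Proof.
move=> [p [p0 sp _] yx]; exists p.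
have sxp : smooth_at x (p 0) by rewrite p0; exact: param_smooth.
split=> //.
  apply: filterS3 (near_eq_Hbar yx) (smooth_at_near sp)
    (near_comp sp (smooth_at_near sxp)) => q -> spq sxq.
  by have [-> _] := Hbar_delta_comp spq sxq.
have [_ E] := Hbar_delta_comp sp sxp; rewrite -[in delta x 0]p0 -E.
rewrite /delta /Efun /Ffun /Gfun.
have D i : 'D_('e_i) y 0 = 'D_('e_i) (fun q => x (p q)) 0 by exact: near_eq_derive.
by rewrite !D.
Qed.

(** The determinant itself is multiplied by the eighth power of the Jacobian at 0; what passes to
    the quotient is its vanishing. *)
Lemma reparam_critical (x y : @param R) : reparam x y -> critical (Hbar x) ->
  critical (Hbar y) /\ (hess_det (Hbar x) 0 1 = 0 -> hess_det (Hbar y) 0 1 = 0).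
Proof.
move=> /reparam_Hbar[p [p0 sp E _]] cx.
have E' : {near (0 : plane), (fun q => jacobian2 p q ^+ 3 * Hbar x (p q)) =1 Hbar y}.
  by apply: filterS E => q ->.
have sJ : smooth_at (fun q => jacobian2 p q ^+ 3) 0.
  exact/smooth_atX/smooth_jacobian2.
have [c2 H] := hess_det_mul_comp (smooth_Hbar (param_smooth x)) cx sp p0 sJ.
split; first exact: near_critical E' c2.
by rewrite -(near_hess_det E') H => ->; rewrite mulr0.
Qed.

(** The normal form has Hessian determinant 4 or -4, and this is the determinant of g times a
    squared Jacobian. *)
Lemma A1_nondegenerate (g : plane -> R) : smooth_at g 0 -> critical g ->
  A1_germ g -> nondegenerate g.
Proof.
move=> sg cg [p [p0 sp _] [s1 [s2 E]]].
have H := hess_det_comp sg cg sp p0; rewrite /nondegenerate.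
apply: contra_eq_neq (H) => ->; rewrite mulr0 (near_hess_det E).
pose m (k : nat) : R := if k == 0%N then (-1) ^+ s1 else (-1) ^+ s1 * (-1) ^+ s2.
pose sq (i : 'I_2) (q : plane) := q 0 i ^+ 2.
have ssq i : smooth_at (sq i) 0 by exact/smooth_atX/smooth_at_proj.
have hsq i k l : hess (sq i) k l = 2 * (i == k)%:R * (i == l)%:R.
  rewrite hessE (_ : (fun q => _) = fun q : plane => 2 * (i == k)%:R * q 0 i); last first.
    apply/funext => q; rewrite (deriveX_at _ _ (smooth_at_diff (smooth_at_proj q i))).
    by rewrite derive_proj mxE eqxx /= expr1 mulrAC.
  rewrite (deriveM_at _ (smooth_at_diff (smooth_at_cst (2 * (i == k)%:R : R) 0))
    (smooth_at_diff (smooth_at_proj 0 i))).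
  by rewrite derive_cst mulr0 addr0 derive_proj mxE eqxx.
have hm (c : R) i k l : hess (fun q => c * sq i q) k l = c * hess (sq i) k l.
  apply: (hessM_vanish k l (smooth_at_cst c 0) (ssq i)); split=> [|j].
    by rewrite /sq mxE expr0n.
  split=> //; rewrite (deriveX_at _ _ (smooth_at_diff (smooth_at_proj 0 i))).
  by rewrite mxE expr1 mulr0 mul0r.
have hE k l : hess (fun q : plane => (-1) ^+ s1 * (q 0 0 ^+ 2 + (-1) ^+ s2 * q 0 1 ^+ 2)) k l
    = (-1) ^+ s1 * hess (sq 0) k l + (-1) ^+ s1 * (-1) ^+ s2 * hess (sq 1) k l.
  rewrite (_ : (fun q => _) = fun q => (-1) ^+ s1 * sq 0 q + (-1) ^+ s1 * (-1) ^+ s2 * sq 1 q).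
    rewrite hessD ?hm//; apply: smooth_atM; by [exact: smooth_at_cst|exact: ssq].
  by apply/funext => q; rewrite mulrDr mulrA.
rewrite /hess_det !hE !hsq /= !(mulr1, mulr0, addr0, add0r) expr0n subr0.
by rewrite !mulf_neq0// ?signr_eq0 ?pnatr_eq0.
Qed.

Lemma nondegenerate_A1 (g : plane -> R) : smooth_at g 0 -> critical g ->
  nondegenerate g -> A1_germ g.
Proof.
move=> sg [g0 Dg] H; have i01 : (0 : 'I_2) != 1 by [].
have [P [f [s1 [s2 [dP sf fi _ E]]]]] := morse_lemma i01 sg (Dg 0) (Dg 1) H.
(* The plane has no parameter coordinates, so the residual term of the Morse form is constant. *)
have fc q : f q = f 0.
  have -> : f q = f (upd 0 0 (upd 1 0 q)).
    by rewrite (fi 0 (upd 1 0 q)).1 (fi 0 q).2.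
  congr f; apply/rowP => j; rewrite !updE mxE.
  by case: (ord2_cases j) => ->.
have f0 : f 0 = 0.
  have := nbhs_singleton E; have [-> _ _] := dP.
  by rewrite g0 !mxE expr0n /= !mulr0 !addr0.
(* [A1_germ] factors out the first sign, so the inner sign is the product of the two Morse signs. *)
exists P => //; exists s1, (s1 (+) s2); apply: filterS E => q ->.
rewrite fc f0 add0r mulrDr mulrA -signr_addb; congr (_ + (-1) ^+ _ * _).
by case: (s1); case: (s2).
Qed.

End CriticalGerms.

(** * Continuity into and out of spaces of germs *)

Section WhitneyContinuity.
Context {R : realType} {n : nat} {W : normedModType R} {P : set ('rV[R]_n -> W)}.

Lemma germs_partials_continuous s : continuous (fun f : germs P => partials f s 0).
Proof.
move=> f; have c1 : continuous (@jet R n W P : germs P -> _) := @initial_continuous _ _ _.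
exact: (continuous_comp (c1 f) (@proj_continuous _ _ s (jet f))).
Qed.

Lemma germs_continuous (X : topologicalType) (u : X -> germs P) :
  (forall s, continuous (fun t => partials (u t) s 0)) -> continuous u.
Proof.
move=> cu; apply: continuous_comp_initial => t; apply/cvg_sup => s.
move: t; apply/(@continuousP _ (initial_topology (@^~ s))) => A [B oB <-].
rewrite -comp_preimage; apply: open_comp => // t _; exact: cu.
Qed.

End WhitneyContinuity.

(** * Density by moving along an affine line of germs *)

Section Perturbation.
Context {R : realType}.

Lemma partials_line n (W : normedModType R) (f u : 'rV[R]_n -> W) (t : R) s a :
  smooth_at f a -> smooth_at u a ->
  partials (fun q => f q + t *: u q) s a = partials f s a + t *: partials u s a.
Proof.
elim: s f u => [//|i s IH] f u sf su; rewrite [RHS]/=.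
rewrite -(IH (fun q => 'D_('e_i) f q) (fun q => 'D_('e_i) u q));
  [|exact: smooth_at_partial..].
rewrite -[LHS]/(partials (fun q => 'D_('e_i) (fun q => f q + t *: u q) q) s a).
apply: near_eq_partials.
apply: filterS2 (smooth_at_near sf) (smooth_at_near su) => q sfq suq.
rewrite [LHS](@deriveD _ _ _ f (fun q => t *: u q)).
- by rewrite [X in _ + X](deriveZ t (smooth_at_derivable (v := 'e_i) suq)).
- exact: smooth_at_derivable.
- exact/derivableZ/smooth_at_derivable.
Qed.

Lemma germs_line_continuous n (W : normedModType R) (P : set ('rV[R]_n -> W))
    (f u : 'rV[R]_n -> W) (Pf : forall t : R, P (fun q => f q + t *: u q)) :
  smooth_at f 0 -> smooth_at u 0 -> continuous (fun t => Germ (Pf t)).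
Proof.
move=> sf su; apply: germs_continuous => s.
have -> : (fun t => partials (Germ (Pf t)) s 0) =
    fun t => partials f s 0 + t *: partials u s 0.
  by apply/funext => t; rewrite -partials_line.
move=> t; apply: cvgD; first exact: cvg_cst.
exact: cvgZr_tmp.
Qed.

(** A polynomial of degree at most 2 that vanishes at 0, d/2 and -d/2 has only zero coefficients. *)
Lemma quadratic_neq0 (a b c d : R) : 0 < d -> (b != 0) || (c != 0) ->
  exists2 t : R, `|t| < d & a + b * t + c * t ^+ 2 != 0.
Proof.
move=> d0 bc; apply: contrapT => none.
have z t : `|t| < d -> a + b * t + c * t ^+ 2 = 0.
  by move=> td; apply/eqP; apply: contrapT => /negP nz; apply: none; exists t.
have d2 : 0 < d / 2 by rewrite divr_gt0.
have dd : `|d / 2| < d by rewrite gtr0_norm// ltr_pdivrMr// ltr_pMr// ltr1n.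
have := z 0; rewrite normr0 => /(_ d0); rewrite !mulr0 expr0n mulr0 !addr0 => a0.
have := z _ dd; have := z (- (d / 2)); rewrite normrN => /(_ dd).
rewrite a0 !add0r sqrrN mulrN => e1 e2.
have ct : c * (d / 2) ^+ 2 = 0 by lra.
have bt : b * (d / 2) = 0 by lra.
have c0 : c = 0.
  by apply/eqP; move/eqP: ct; rewrite mulf_eq0 sqrf_eq0 (gt_eqF d2) orbF.
have b0 : b = 0 by apply/eqP; move/eqP: bt; rewrite mulf_eq0 (gt_eqF d2) orbF.
by move: bc; rewrite b0 c0 eqxx.
Qed.

(** The line t -> f + t u is continuous for the Whitney topology, so it stays in O for small t,
    while the quantity e, a nonconstant polynomial along it, is nonzero for arbitrarily small t. *)
Lemma germs_line_dense n (W : normedModType R) (P : set ('rV[R]_n -> W))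
    (f u : 'rV[R]_n -> W) (Pf : forall t : R, P (fun q => f q + t *: u q))
    (O : set (germs P)) (e : R -> R) a b c :
  smooth_at f 0 -> smooth_at u 0 -> open O -> O (Germ (Pf 0)) ->
  (forall t, e t = a + b * t + c * t ^+ 2) -> (b != 0) || (c != 0) ->
  exists2 t, O (Germ (Pf t)) & e t != 0.
Proof.
move=> sf su oO O0 eE bc.
have cl := germs_line_continuous (Pf := Pf) sf su.
have /nbhs_normP[d d0 dP] : \forall t \near (0 : R), O (Germ (Pf t)).
  by apply: cl; exact: open_nbhs_nbhs.
have [t td et] := quadratic_neq0 a d0 bc.
exists t; last by rewrite eE.
by apply: dP; rewrite /= sub0r normrN.
Qed.

End Perturbation.

(** * Effect of a perturbation on the jets of Hbar *)

Section SurfacePerturbation.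
Context {R : realType}.
Local Notation plane := 'rV[R]_2.
Local Notation space := 'rV[R]_3.

Lemma Hpoly_congr (a b A B C a' b' A' B' C' : space) :
  a = a' -> b = b' -> A = A' -> B = B' -> C = C' ->
  Hpoly a b A B C = Hpoly a' b' A' B' C'.
Proof. by move=> -> -> -> -> ->. Qed.

Lemma Hpoly_smooth n (a b A B C : 'rV[R]_n -> space) z :
  smooth_at a z -> smooth_at b z -> smooth_at A z -> smooth_at B z -> smooth_at C z ->
  smooth_at (fun q => Hpoly (a q) (b q) (A q) (B q) (C q)) z.
Proof.
move=> sa sb sA sB sC; apply: (@Hpoly_closed R 'rV[R]_n [set f | smooth_at f z]) => /=.
- by move=> f g; exact: smooth_atD.
- by move=> f g; exact: smooth_atM.
- by move=> f; exact: smooth_atN.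
- exact: smooth_at_cst.
- by move=> j; exact: smooth_at_coord.
- by move=> j; exact: smooth_at_coord.
- by move=> j; exact: smooth_at_coord.
- by move=> j; exact: smooth_at_coord.
- by move=> j; exact: smooth_at_coord.
Qed.

Lemma smooth_at_det3 n (a b c : 'rV[R]_n -> space) z :
  smooth_at a z -> smooth_at b z -> smooth_at c z ->
  smooth_at (fun q => det3 (a q) (b q) (c q)) z.
Proof.
move=> sa sb sc; apply: (@eq_smooth_at _ _ _ (fun q =>
    a q 0 0 * (b q 0 1 * c q 0 2 - b q 0 2 * c q 0 1) -
    a q 0 1 * (b q 0 0 * c q 0 2 - b q 0 2 * c q 0 0) +
    a q 0 2 * (b q 0 0 * c q 0 1 - b q 0 1 * c q 0 0))).
  by apply: filterE => q; rewrite det3E.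
have minor i j : smooth_at (fun q => b q 0 i * c q 0 j - b q 0 j * c q 0 i) z.
  by apply: smooth_atB; apply: smooth_atM; exact: smooth_at_coord.
apply: smooth_atD; last by apply: smooth_atM; [exact: smooth_at_coord|exact: minor].
by apply: smooth_atB; apply: smooth_atM; by [exact: smooth_at_coord|exact: minor].
Qed.

Lemma smooth_at_mdot n (a b : 'rV[R]_n -> space) z :
  smooth_at a z -> smooth_at b z -> smooth_at (fun q => mdot (a q) (b q)) z.
Proof.
move=> sa sb; have s j : smooth_at (fun q => a q 0 j * b q 0 j) z.
  by apply: smooth_atM; exact: smooth_at_coord.
exact: smooth_atB (smooth_atD (s 0) (s 1)) (s 2).
Qed.

Lemma smooth_at_scale n m (f : 'rV[R]_n -> R) (w : 'rV[R]_m) z :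
  smooth_at f z -> smooth_at (fun q => f q *: w) z.
Proof.
move=> sf; apply/smooth_at_rowP => j.
apply: (@eq_smooth_at _ _ _ (fun q => f q * w 0 j)).
  by apply: filterE => q; rewrite !mxE.
by apply: smooth_atM => //; exact: smooth_at_cst.
Qed.

Lemma partials_scale n m (f : 'rV[R]_n -> R) (w : 'rV[R]_m) s z : smooth_at f z ->
  partials (fun q => f q *: w) s z = partials f s z *: w.
Proof.
elim: s f => [//|i s IH] f sf; rewrite [RHS]/=.
rewrite -(IH (fun q => 'D_('e_i) f q)); last exact: smooth_at_partial.
rewrite -[LHS]/(partials (fun q => 'D_('e_i) (fun q => f q *: w) q) s z).
apply: near_eq_partials; apply: filterS (smooth_at_near sf) => q sfq.
apply/rowP => j; rewrite -derive_coord; last exact/smooth_at_diff/smooth_at_scale.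
rewrite mxE (_ : (fun y => _) = fun y => f y * w 0 j); last first.
  by apply/funext => y; rewrite mxE.
rewrite (deriveM_at _ (smooth_at_diff sfq) (smooth_at_diff (smooth_at_cst (w 0 j) q))).
by rewrite derive_cst mulr0 add0r mulrC.
Qed.

(** [Hpoly] is affine in the change of the second derivatives, by [HpolyD], while the changes of the
    first derivatives vanish to order k and are invisible in the congruence. *)
Lemma Hpoly_perturb n k (a b A B C : 'rV[R]_n -> space) (N : space)
    (al be r s t : 'rV[R]_n -> R) :
  smooth_at a 0 -> smooth_at b 0 -> smooth_at A 0 -> smooth_at B 0 -> smooth_at C 0 ->
  smooth_at al 0 -> smooth_at be 0 -> smooth_at r 0 -> smooth_at s 0 -> smooth_at t 0 ->
  vanish k al -> vanish k be ->
  jet_eq k (fun z => Hpoly (a z + al z *: N) (b z + be z *: N) (A z + r z *: N)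
                           (B z + s z *: N) (C z + t z *: N))
    (fun z => Hpoly (a z) (b z) (A z) (B z) (C z) + det3 (a z) (b z) N *
      (r z * mdot (b z) (b z) - 2 * s z * mdot (a z) (b z) + t z * mdot (a z) (a z))).
Proof.
move=> sa sb sA sB sC sal sbe sr ss st val vbe.
have sN (f : 'rV[R]_n -> R) : smooth_at f 0 -> smooth_at (fun z => f z *: N) 0.
  exact: smooth_at_scale.
have perturbed (V : 'rV[R]_n -> space) f j : smooth_at V 0 -> smooth_at f 0 ->
    vanish k f -> jet_eq k (fun z => (V z + f z *: N) 0 j) (fun z => V z 0 j).
  move=> sV sf vf; have sfN : smooth_at (fun z => f z * N 0 j) 0.
    by apply: smooth_atM => //; exact: smooth_at_cst.
  apply: (@jet_eq_trans _ _ _ (fun z => V z 0 j + f z * N 0 j)).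
    apply: near_jet_eq; first exact/smooth_at_coord/smooth_atD/sN.
    by apply: filterE => z; rewrite !mxE.
  apply: jet_eq_addr => //; first exact: smooth_at_coord.
  apply: near_vanish (vanishM (smooth_at_cst (N 0 j) 0) sf vf).
  by apply: filterE => z; rewrite mulrC.
have same (V : 'rV[R]_n -> space) (f : 'rV[R]_n -> R) j : smooth_at V 0 -> smooth_at f 0 ->
    jet_eq k (fun z => (V z + f z *: N) 0 j) (fun z => (V z + f z *: N) 0 j).
  by move=> sV sf; apply/jet_eq_refl/smooth_at_coord/smooth_atD/sN.
apply: (@jet_eq_trans _ _ _ (fun z => Hpoly (a z) (b z) (A z + r z *: N)
    (B z + s z *: N) (C z + t z *: N))); last first.
  apply: near_jet_eq; last by apply: filterE => z; rewrite HpolyD.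
  by apply: Hpoly_smooth => //; apply: smooth_atD => //; exact: sN.
(* The Boolean selects the perturbed or the unperturbed first derivatives; K relates the two
   choices, so closure under the operations of [Hpoly] is the wanted congruence. *)
have := @Hpoly_closed R (bool * 'rV[R]_n)
  [set f | jet_eq k (fun z => f (true, z)) (fun z => f (false, z))]
  (fun y => if y.1 then a y.2 + al y.2 *: N else a y.2)
  (fun y => if y.1 then b y.2 + be y.2 *: N else b y.2)
  (fun y => A y.2 + r y.2 *: N) (fun y => B y.2 + s y.2 *: N) (fun y => C y.2 + t y.2 *: N).
apply => /=.
- by move=> f g; exact: jet_eqD.
- by move=> f g; exact: jet_eqM.
- by move=> f; exact: jet_eqN.
- exact/jet_eq_refl/smooth_at_cst.
- by move=> j; exact: perturbed.
- by move=> j; exact: perturbed.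
- by move=> j; exact: same.
- by move=> j; exact: same.
- by move=> j; exact: same.
Qed.

Definition monom (c : R) (k l : nat) (q : plane) := c * (q 0 0 ^+ k * q 0 1 ^+ l).

Lemma smooth_monom c k l z : smooth_at (monom c k l) z.
Proof.
apply: smooth_atM; first exact: smooth_at_cst.
by apply: smooth_atM; exact/smooth_atX/smooth_at_proj.
Qed.

Lemma derive_monom c k l i : (fun q => 'D_('e_i) (monom c k l) q) =
  if i == 0 then monom (c * k%:R) k.-1 l else monom (c * l%:R) k l.-1.
Proof.
apply/funext => q; have sp (j : 'I_2) m : smooth_at (fun q : plane => q 0 j ^+ m) q.
  exact/smooth_atX/smooth_at_proj.
have Dp (j : 'I_2) m : 'D_('e_i) (fun q : plane => q 0 j ^+ m) q =
    m%:R * q 0 j ^+ m.-1 * (j == i)%:R.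
  rewrite (deriveX_at _ _ (smooth_at_diff (smooth_at_proj q j))).
  by rewrite derive_proj mxE eqxx.
rewrite (deriveM_at _ (smooth_at_diff (smooth_at_cst (c : R) q))
  (smooth_at_diff (smooth_atM (sp 0 k) (sp 1 l)))).
rewrite (deriveM_at _ (smooth_at_diff (sp 0 k)) (smooth_at_diff (sp 1 l))) !Dp.
rewrite derive_cst mulr0 addr0 /monom.
by case: (ord2_cases i) => -> /=; ring.
Qed.

Lemma vanish_monom m c k l : (m <= k + l)%N -> vanish m (monom c k l).
Proof.
elim: m c k l => [//|m IH] c k l mkl; split.
  rewrite /monom !mxE !expr0n; case: k mkl => [|k] /=; last by rewrite mul0r mulr0.
  by case: l => [|l] //=; rewrite mulr0 mulr0.
(* A derivative in an absent variable keeps the exponent 0, since [0.-1] is 0; it is the coefficient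
   c * 0 that vanishes. *)
have zero k' l' : vanish m (monom (c * 0) k' l').
  rewrite (_ : monom _ _ _ = fun=> 0); first exact: vanish0.
  by apply/funext => q; rewrite /monom mulr0 mul0r.
move=> i; rewrite derive_monom; case: (ord2_cases i) => -> /=.
  by case: k mkl => [|k] mkl /=; [exact: zero|exact: IH].
case: l mkl => [|l] mkl /=; first exact: zero.
by apply: IH; rewrite addnS in mkl.
Qed.

Lemma monom0 c k l : monom c k l 0 = if (k == 0%N) && (l == 0%N) then c else 0.
Proof.
by rewrite /monom !mxE !expr0n; case: k => [|k]; case: l => [|l]; rewrite /= ?(mulr0, mul0r, mulr1).
Qed.

(* Adding [t u^2 v^2 N] to a parametrization changes the Hessian of Hbar at 0 by
   [4 t det3 x_u x_v N] times the matrix [[E, -2F], [-2F, G]]. *)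
Lemma hess_Hbar_perturb (x : plane -> space) (N : space) (t : R) :
  smooth_at x 0 -> let y q := x q + t *: (monom 1 2 2 q *: N) in
  let c := det3 ('D_('e_0) x 0) ('D_('e_1) x 0) N in
  [/\ jet_eq 2 (Hbar y) (Hbar x),
    hess (Hbar y) 0 0 = hess (Hbar x) 0 0 + 4 * t * c * Efun x 0,
    hess (Hbar y) 0 1 = hess (Hbar x) 0 1 - 8 * t * c * Ffun x 0 &
    hess (Hbar y) 1 1 = hess (Hbar x) 1 1 + 4 * t * c * Gfun x 0].
Proof.
have alg (h d e f g u v w : R) :
    h + d * (t * u * g - 2 * (t * v) * f + t * w * e) =
    h + t * (d * g) * u + - (2 * t) * (d * f) * v + t * (d * e) * w by ring.
move=> sx y c; pose psi := monom 1 2 2.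
have spsi z : smooth_at psi z by exact: smooth_monom.
have spN z : smooth_at (fun q => psi q *: N) z by exact: smooth_at_scale.
have yE s : {near (0 : plane), partials y s =1
    fun q => partials x s q + (t * partials psi s q) *: N}.
  apply: filterS (smooth_at_near sx) => q sxq.
  by rewrite partials_line// partials_scale// scalerA.
have st s : smooth_at (fun q => t * partials psi s q) 0.
  by apply: smooth_atM; [exact: smooth_at_cst|exact: smooth_at_partials].
have sxs s : smooth_at (partials x s) 0 by exact: smooth_at_partials.
have psi0 : partials psi [:: 0] = monom (1 * 2) 1 2.
  by rewrite [LHS]derive_monom.
have psi1 : partials psi [:: 1] = monom (1 * 2) 2 1.
  by rewrite [LHS]derive_monom.
have psi00 : partials psi [:: 0; 0] = monom (1 * 2 * 1) 0 2.
  rewrite -[LHS]/(fun q => 'D_('e_0) (partials psi [:: 0]) q) psi0.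
  by rewrite derive_monom.
have psi01 : partials psi [:: 0; 1] = monom (1 * 2 * 2) 1 1.
  rewrite -[LHS]/(fun q => 'D_('e_1) (partials psi [:: 0]) q) psi0.
  by rewrite derive_monom.
have psi11 : partials psi [:: 1; 1] = monom (1 * 2 * 1) 2 0.
  rewrite -[LHS]/(fun q => 'D_('e_1) (partials psi [:: 1]) q) psi1.
  by rewrite derive_monom.
have v3 s : vanish 3 (partials psi s) -> vanish 3 (fun q => t * partials psi s q).
  apply: vanishM; first exact: smooth_at_cst.
  exact: smooth_at_partials.
(* The first derivatives of u^2 v^2 are cubic and do not reach the 2-jet of Hbar. The second
   derivatives are quadratic, so they leave the 1-jet alone and enter the Hessian through their
   coefficients at 0. *)
have v30 : vanish 3 (fun q => t * partials psi [:: 0] q).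
  by apply: v3; rewrite psi0; exact: vanish_monom.
have v31 : vanish 3 (fun q => t * partials psi [:: 1] q).
  by apply: v3; rewrite psi1; exact: vanish_monom.
have J := Hpoly_perturb N (sxs [:: 0]) (sxs [:: 1]) (sxs [:: 0; 0]) (sxs [:: 0; 1])
  (sxs [:: 1; 1]) (st [:: 0]) (st [:: 1]) (st [:: 0; 0]) (st [:: 0; 1]) (st [:: 1; 1])
  v30 v31.
pose c' q := det3 ('D_('e_0) x q) ('D_('e_1) x q) N.
have sc' : smooth_at c' 0.
  by apply: smooth_at_det3; [exact: (sxs [:: 0])|exact: (sxs [:: 1])|exact: smooth_at_cst].
have sE : smooth_at (Efun x) 0 by apply: smooth_at_mdot; exact: (sxs [:: 0]).
have sF : smooth_at (Ffun x) 0.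
  by apply: smooth_at_mdot; [exact: (sxs [:: 0])|exact: (sxs [:: 1])].
have sG : smooth_at (Gfun x) 0 by apply: smooth_at_mdot; exact: (sxs [:: 1]).
(* The factor of psi_uu = 2 v^2 contains G and that of psi_vv = 2 u^2 contains E, so G lands in the
   vv entry of the Hessian and E in the uu entry. *)
pose m00 q := t * (c' q * Gfun x q); pose m01 q := - (2 * t) * (c' q * Ffun x q).
pose m11 q := t * (c' q * Efun x q).
have sm00 : smooth_at m00 0 := smooth_atM (smooth_at_cst t 0) (smooth_atM sc' sG).
have sm01 : smooth_at m01 0 := smooth_atM (smooth_at_cst (- (2 * t)) 0) (smooth_atM sc' sF).
have sm11 : smooth_at m11 0 := smooth_atM (smooth_at_cst t 0) (smooth_atM sc' sE).
pose p00 := monom (1 * 2 * 1) 0 2; pose p01 := monom (1 * 2 * 2) 1 1.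
pose p11 := monom (1 * 2 * 1) 2 0.
have sp00 : smooth_at p00 0 by exact: smooth_monom.
have sp01 : smooth_at p01 0 by exact: smooth_monom.
have sp11 : smooth_at p11 0 by exact: smooth_monom.
have s00 := smooth_atM sm00 sp00; have s01 := smooth_atM sm01 sp01.
have s11 := smooth_atM sm11 sp11.
have sH := smooth_Hbar sx.
have JH : jet_eq 3 (Hbar y) (fun q => Hbar x q + m00 q * p00 q + m01 q * p01 q + m11 q * p11 q).
  apply: (@jet_eq_trans _ _ _ (fun q => Hpoly
    (partials x [:: 0] q + (t * partials psi [:: 0] q) *: N)
    (partials x [:: 1] q + (t * partials psi [:: 1] q) *: N)
    (partials x [:: 0; 0] q + (t * partials psi [:: 0; 0] q) *: N)
    (partials x [:: 0; 1] q + (t * partials psi [:: 0; 1] q) *: N)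
    (partials x [:: 1; 1] q + (t * partials psi [:: 1; 1] q) *: N))).
    have sy : smooth_at y 0.
      apply: smooth_atD => //; apply/smooth_at_rowP => j.
      apply: (@eq_smooth_at _ _ _ (fun q => t * (psi q * N 0 j))).
        by apply: filterE => q; rewrite !mxE.
      apply: smooth_atM; first exact: smooth_at_cst.
      by apply: smooth_atM; [exact: smooth_monom|exact: smooth_at_cst].
    apply: near_jet_eq; first exact: smooth_Hbar.
    apply: filterS2 (filterI (yE [:: 0]) (yE [:: 1]))
      (filterI (yE [:: 0; 0]) (filterI (yE [:: 0; 1]) (yE [:: 1; 1]))).
    move=> q [e0 e1] [e00 [e01 e11]]; rewrite Hbar_Hpoly.
    exact: Hpoly_congr e0 e1 e00 e01 e11.
  have [_ sJ _] := J; apply: jet_eq_trans J _; apply: near_jet_eq; last first.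
    apply: filterE => q; rewrite psi00 psi01 psi11 -Hbar_Hpoly.
    exact: alg.
  exact: sJ.
have vp00 : vanish 2 p00 by exact: vanish_monom.
have vp01 : vanish 2 p01 by exact: vanish_monom.
have vp11 : vanish 2 p11 by exact: vanish_monom.
have hmono i j : hess (fun q => Hbar x q + m00 q * p00 q + m01 q * p01 q + m11 q * p11 q) i j
    = hess (Hbar x) i j + m00 0 * hess p00 i j + m01 0 * hess p01 i j + m11 0 * hess p11 i j.
  rewrite (hessD _ _ (smooth_atD (smooth_atD sH s00) s01) s11).
  rewrite (hessD _ _ (smooth_atD sH s00) s01) (hessD _ _ sH s00).
  rewrite (hessM_vanish _ _ sm00 sp00 vp00) (hessM_vanish _ _ sm01 sp01 vp01).
  by rewrite (hessM_vanish _ _ sm11 sp11 vp11).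
have hm c0 k l i j : hess (monom c0 k l) i j =
    (fun q => 'D_('e_j) (fun q => 'D_('e_i) (monom c0 k l) q) q) 0 by rewrite hessE.
have dm c0 k l j := congr1 (@^~ 0) (derive_monom c0 k l j).
rewrite /= in dm.
have hp i j : hess p00 i j = (if (i == 1) && (j == 1) then 4 else 0) /\
    hess p01 i j = (if i != j then 4 else 0) /\
    hess p11 i j = (if (i == 0) && (j == 0) then 4 else 0).
  rewrite !hm !derive_monom.
  by case: (ord2_cases i) => ->; case: (ord2_cases j) => -> /=;
    rewrite /= !dm /= !monom0 /=; do ?split; ring.
have final i j := etrans (jet_eq3_hess i j JH) (hmono i j).
split.
- apply: jet_eq_trans (jet_eqW JH) _.
  apply: (@jet_eq_trans _ _ _ (fun q => Hbar x q + m00 q * p00 q + m01 q * p01 q)).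
    exact: jet_eq_addr (smooth_atD (smooth_atD sH s00) s01) s11 (vanishM sm11 sp11 vp11).
  apply: (@jet_eq_trans _ _ _ (fun q => Hbar x q + m00 q * p00 q)).
    exact: jet_eq_addr (smooth_atD sH s00) s01 (vanishM sm01 sp01 vp01).
  exact: jet_eq_addr sH s00 (vanishM sm00 sp00 vp00).
- rewrite final; have [-> [-> ->]] := hp 0 0; rewrite /= /m11 -/c.
  by move: (hess _ 0 0) (Efun x 0) (m00 0) (m01 0) => h e u v; rewrite /c' -/c; ring.
- rewrite final; have [-> [-> ->]] := hp 0 1; rewrite /= /m01 -/c.
  by move: (hess _ 0 1) (Ffun x 0) (m00 0) (m11 0) => h e u v; rewrite /c' -/c; ring.
- rewrite final; have [-> [-> ->]] := hp 1 1; rewrite /= /m00 -/c.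
  by move: (hess _ 1 1) (Gfun x 0) (m01 0) (m11 0) => h e u v; rewrite /c' -/c; ring.
Qed.

End SurfacePerturbation.

(** * Surfaces in Monge form and their deformations *)

Section MongeFamilies.
Context {R : realType}.
Local Notation plane := 'rV[R]_2.
Local Notation space := 'rV[R]_3.

(** Derivative of the Monge parametrization along the k-th axis, without its e_i component. *)
Definition monge_base (i : 'I_3) (k : 'I_2) : space :=
  \row_j (if unlift i j is Some l then (k == l)%:R else 0).

Lemma monge_base_lift i k l : monge_base i k 0 (lift i l) = (k == l)%:R.
Proof. by rewrite mxE liftK. Qed.

Lemma monge_base_self i k : monge_base i k 0 i = 0.
Proof. by rewrite mxE unlift_none. Qed.

(** The last row e_i absorbs the e_i components of the other two rows, so the determinant is that of
    a permuted identity matrix. Thus e_i is never tangent to a graph in that direction. *)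
Lemma det3_monge_base i (s t : R) :
  det3 (monge_base i 0 + s *: 'e_i) (monge_base i 1 + t *: 'e_i) 'e_i != 0.
Proof.
have E k (c : R) j : (monge_base i k + c *: 'e_i) 0 j = monge_base i k 0 j + c * (j == i)%:R.
  by rewrite !mxE eqxx.
have D j : ('e_i : space) 0 j = (j == i)%:R by rewrite mxE eqxx.
have BL l := @monge_base_lift i ^~ l; have BS := @monge_base_self i.
have [i0|[i1|i2]] : i = 0 \/ i = 1 \/ i = 2.
  case: (i) => -[|[|[|//]]] lt; [left|right; left|right; right]; exact: val_inj.
- subst i; have l0 : lift 0 0 = 1 :> 'I_3 by exact: val_inj.
  have l1 : lift 0 1 = 2 :> 'I_3 by exact: val_inj.
  have B0 k := BL 0 k; have B1 k := BL 1 k; rewrite /= ?l0 ?l1 in B0 B1.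
  suff -> : det3 (monge_base 0 0 + s *: 'e_0) (monge_base 0 1 + t *: 'e_0) 'e_0 = 1
    by rewrite oner_neq0.
  by rewrite det3E !E !D !B0 !B1 !BS /=; ring.
- subst i; have l0 : lift 1 0 = 0 :> 'I_3 by exact: val_inj.
  have l1 : lift 1 1 = 2 :> 'I_3 by exact: val_inj.
  have B0 k := BL 0 k; have B1 k := BL 1 k; rewrite /= ?l0 ?l1 in B0 B1.
  suff -> : det3 (monge_base 1 0 + s *: 'e_1) (monge_base 1 1 + t *: 'e_1) 'e_1 = - 1
    by rewrite oppr_eq0 oner_neq0.
  by rewrite det3E !E !D !B0 !B1 !BS /=; ring.
- subst i; have l0 : lift 2 0 = 0 :> 'I_3 by exact: val_inj.
  have l1 : lift 2 1 = 1 :> 'I_3 by exact: val_inj.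
  have B0 k := BL 0 k; have B1 k := BL 1 k; rewrite /= ?l0 ?l1 in B0 B1.
  suff -> : det3 (monge_base 2 0 + s *: 'e_2) (monge_base 2 1 + t *: 'e_2) 'e_2 = 1
    by rewrite oner_neq0.
  by rewrite det3E !E !D !B0 !B1 !BS /=; ring.
Qed.

Section Monge.
Context (i : 'I_3) (a : plane).

Lemma monge_coord (f : plane -> R) j : (fun q => monge i a f q 0 j) =
  if unlift i j is Some l then fun q => a 0 l + q 0 l else f.
Proof.
by apply/funext => q; rewrite mxE; case: unliftP => [l|] _; rewrite ?mxE.
Qed.

Lemma smooth_monge (f : plane -> R) q : smooth_at f q -> smooth_at (monge i a f) q.
Proof.
move=> sf; apply/smooth_at_rowP => j; rewrite monge_coord.
case: unliftP => [l|] _ //; apply: smooth_atD; first exact: smooth_at_cst.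
exact: smooth_at_proj.
Qed.

Lemma derive_monge (f : plane -> R) q k : smooth_at f q ->
  'D_('e_k) (monge i a f) q = monge_base i k + 'D_('e_k) f q *: ('e_i : space).
Proof.
move=> sf; apply/rowP => j.
rewrite -(derive_coord 'e_k j (smooth_at_diff (smooth_monge sf))) monge_coord.
have -> : (monge_base i k + 'D_('e_k) f q *: 'e_i) 0 j =
    monge_base i k 0 j + 'D_('e_k) f q * ('e_i : space) 0 j by rewrite !mxE.
rewrite [X in _ + _ * X]mxE eqxx /=.
case: unliftP => [l|] ->.
  rewrite monge_base_lift [lift i l == i]eq_sym (negPf (neq_lift _ _)) mulr0 addr0.
  rewrite (deriveD_at _ (smooth_at_diff (smooth_at_cst (a 0 l) q))
    (smooth_at_diff (smooth_at_proj q l))).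
  by rewrite derive_cst add0r derive_proj mxE eqxx [l == k]eq_sym.
by rewrite monge_base_self eqxx mulr1 add0r.
Qed.

Lemma derive2_monge (f : plane -> R) q k l : smooth_at f q ->
  partials (monge i a f) [:: k; l] q = partials f [:: k; l] q *: 'e_i.
Proof.
move=> sf; have E : {near q, (fun z => 'D_('e_k) (monge i a f) z) =1
    (fun z => monge_base i k + 'D_('e_k) f z *: 'e_i)}.
  by apply: filterS (smooth_at_near sf) => z; exact: derive_monge.
have sfk := smooth_at_partial k sf.
rewrite -[LHS]/('D_('e_l) (fun z => 'D_('e_k) (monge i a f) z) q).
rewrite (near_eq_derive _ E).
rewrite (deriveD_at _ (smooth_at_diff (smooth_at_cst (monge_base i k) q))
  (smooth_at_diff (smooth_at_scale 'e_i sfk))) derive_cst add0r.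
exact: (partials_scale 'e_i [:: l] sfk).
Qed.

Definition Hmonge (f0 f1 f00 f01 f11 : R) :=
  Hpoly (monge_base i 0 + f0 *: 'e_i) (monge_base i 1 + f1 *: 'e_i)
    (f00 *: 'e_i) (f01 *: 'e_i) (f11 *: 'e_i).

Lemma Hbar_monge (f : plane -> R) q : smooth_at f q -> Hbar (monge i a f) q =
  Hmonge ('D_('e_0) f q) ('D_('e_1) f q) (partials f [:: 0; 0] q)
    (partials f [:: 0; 1] q) (partials f [:: 1; 1] q).
Proof.
move=> sf; rewrite Hbar_Hpoly; apply: Hpoly_congr.
- exact: (derive_monge 0 sf).
- exact: (derive_monge 1 sf).
- exact: (derive2_monge 0 0 sf).
- exact: (derive2_monge 0 1 sf).
- exact: (derive2_monge 1 1 sf).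
Qed.

Let L (k : 'I_2) : 'I_(2 + 1) := lshift 1 k.

(** [Hbar_family] differentiates in the plane with t frozen. Here the same value is a polynomial in
    partials of one function of (q, t), which makes its smoothness in (q, t) and its continuity in
    the deformation accessible. *)
Definition Hunfold (f : 'rV[R]_(2 + 1) -> R) (z : 'rV[R]_(2 + 1)) :=
  Hmonge (partials f [:: L 0] z) (partials f [:: L 1] z) (partials f [:: L 0; L 0] z)
    (partials f [:: L 0; L 1] z) (partials f [:: L 1; L 1] z).

Lemma Hbar_family_unfold g (h : 'rV[R]_(2 + 1) -> R) z :
  smooth_at (fun z => g (lsubmx z) + h z) z ->
  Hbar_family i a g h z = Hunfold (fun z => g (lsubmx z) + h z) z.
Proof.
set f := fun z => _; move=> sf.
pose ft q := f (row_mx q (rsubmx z)).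
have ftE : (fun q => g q + h (row_mx q (rsubmx z))) = ft.
  by apply/funext => q; rewrite /ft /f row_mxKl.
rewrite /Hbar_family ftE.
have srow : smooth_at (fun q : plane => row_mx q (rsubmx z)) (lsubmx z).
  by apply: smooth_at_row_mx; [exact: smooth_at_id|exact: smooth_at_cst].
have sft : smooth_at ft (lsubmx z).
  by apply: (smooth_at_scalarcomp srow); rewrite hsubmxK.
have D k q : 'D_('e_k) ft q = partials f [:: L k] (row_mx q (rsubmx z)).
  exact: derive_row_mx0.
have D2 k l q : partials ft [:: k; l] q = partials f [:: L k; L l] (row_mx q (rsubmx z)).
  rewrite -[LHS]/('D_('e_l) (fun q => 'D_('e_k) ft q) q).
  have -> : (fun q => 'D_('e_k) ft q) = fun q => partials f [:: L k] (row_mx q (rsubmx z)).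
    by apply/funext => y.
  exact: derive_row_mx0.
rewrite (Hbar_monge sft) /Hunfold (D 0) (D 1) (D2 0 0) (D2 0 1) (D2 1 1).
by rewrite [row_mx _ _]hsubmxK.
Qed.

Lemma near_Hbar_family g (h : 'rV[R]_(2 + 1) -> R) :
  smooth_at (fun z => g (lsubmx z) + h z) 0 ->
  {near (0 : 'rV[R]_(2 + 1)), Hunfold (fun z => g (lsubmx z) + h z) =1 Hbar_family i a g h}.
Proof.
by move=> sf; apply: filterS (smooth_at_near sf) => z sfz; rewrite Hbar_family_unfold.
Qed.

Lemma smooth_Hunfold (f : 'rV[R]_(2 + 1) -> R) z : smooth_at f z -> smooth_at (Hunfold f) z.
Proof.
move=> sf; have se s : smooth_at (fun z => partials f s z *: ('e_i : space)) z.
  exact/smooth_at_scale/smooth_at_partials.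
by apply: Hpoly_smooth => //; apply: smooth_atD => //; exact: smooth_at_cst.
Qed.

Lemma Hunfold_jet_continuous (X : topologicalType) (T : X -> 'rV[R]_(2 + 1) -> R) :
  jet_continuous T -> jet_continuous (fun x => Hunfold (T x)).
Proof.
move=> jT; have jTs s : jet_continuous (fun x q => partials (T x) s q).
  split=> [x|s']; first exact/smooth_at_partials/jT.1.
  have -> : (fun x => partials (partials (T x) s) s' 0) =
      fun x => partials (T x) (s ++ s') 0.
    by apply/funext => x; rewrite partials_cat.
  exact: jT.2.
have js s j : jet_continuous (fun x q => (partials (T x) s q *: ('e_i : space)) 0 j).
  have -> : (fun x q => (partials (T x) s q *: ('e_i : space)) 0 j) =
      fun x q => partials (T x) s q * ('e_i : space) 0 j.
    by apply/funext => x; apply/funext => q; rewrite mxE.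
  apply: jet_continuousM; first exact: jTs.
  exact/jet_continuous_cst/smooth_at_cst.
have jb k s j : jet_continuous (fun x q =>
    (monge_base i k + partials (T x) s q *: 'e_i) 0 j).
  have -> : (fun x q => (monge_base i k + partials (T x) s q *: 'e_i) 0 j) =
      fun x q => monge_base i k 0 j + (partials (T x) s q *: ('e_i : space)) 0 j.
    by apply/funext => x; apply/funext => q; rewrite mxE.
  apply: jet_continuousD; last exact: js.
  exact/jet_continuous_cst/smooth_at_cst.
apply: (@Hpoly_closed R (X * 'rV[R]_(2 + 1))
  [set f | jet_continuous (fun x q => f (x, q))]
  (fun y => monge_base i 0 + partials (T y.1) [:: L 0] y.2 *: 'e_i)
  (fun y => monge_base i 1 + partials (T y.1) [:: L 1] y.2 *: 'e_i)
  (fun y => partials (T y.1) [:: L 0; L 0] y.2 *: 'e_i)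
  (fun y => partials (T y.1) [:: L 0; L 1] y.2 *: 'e_i)
  (fun y => partials (T y.1) [:: L 1; L 1] y.2 *: 'e_i)) => /=.
- by move=> f g; exact: jet_continuousD.
- by move=> f g; exact: jet_continuousM.
- by move=> f; exact: jet_continuousN.
- exact/jet_continuous_cst/smooth_at_cst.
- exact: (jb 0 [:: L 0]).
- exact: (jb 1 [:: L 1]).
- exact: (js [:: L 0; L 0]).
- exact: (js [:: L 0; L 1]).
- exact: (js [:: L 1; L 1]).
Qed.

End Monge.

End MongeFamilies.

(** * The perturbation that changes the speed of a Monge family *)

Section QuadraticUnfolding.
Context {R : realType}.
Local Notation space := 'rV[R]_3.
Let L (k : 'I_2) : 'I_(2 + 1) := lshift 1 k.
Let T : 'I_(2 + 1) := rshift 2 0.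
Let p k (z : 'rV[R]_(2 + 1)) : R := z 0 (L k).

Let smooth_cpp (c : R) k l z : smooth_at (fun z => c * (p k z * p l z)) z.
Proof.
apply: smooth_atM; first exact: smooth_at_cst.
by apply: smooth_atM; exact: smooth_at_proj.
Qed.

Let smooth_cp (c : R) k z : smooth_at (fun z => c * p k z) z.
Proof. by apply: smooth_atM; [exact: smooth_at_cst|exact: smooth_at_proj]. Qed.

Let derive_p k j z : 'D_('e_(L j)) (p k) z = (k == j)%:R.
Proof. by rewrite derive_proj mxE eqxx /= eq_lshift. Qed.

Let derive_cp (c : R) k j z : 'D_('e_(L j)) (fun z => c * p k z) z = c * (k == j)%:R.
Proof.
rewrite (deriveM_at _ (smooth_at_diff (smooth_at_cst c z))
  (smooth_at_diff (smooth_at_proj z (L k)))) derive_cst mulr0 addr0.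
by congr (c * _); exact: derive_p.
Qed.

Let derive_cpp (c : R) k l j z : 'D_('e_(L j)) (fun z => c * (p k z * p l z)) z =
  c * (p k z * (l == j)%:R + p l z * (k == j)%:R).
Proof.
have spp : smooth_at (fun z => p k z * p l z) z.
  by apply: smooth_atM; exact: smooth_at_proj.
rewrite (deriveM_at _ (smooth_at_diff (smooth_at_cst c z)) (smooth_at_diff spp)).
rewrite derive_cst mulr0 addr0 (deriveM_at _ (smooth_at_diff (smooth_at_proj z (L k)))
  (smooth_at_diff (smooth_at_proj z (L l)))).
by congr (c * (_ * _ + _ * _)); exact: derive_p.
Qed.

Let derive_T (f : 'rV[R]_(2 + 1) -> R) k z : smooth_at f z ->
  'D_('e_(L k)) (fun z : 'rV[R]_(2 + 1) => z 0 T * f z) z = z 0 T * 'D_('e_(L k)) f z.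
Proof.
move=> sf; rewrite (deriveM_at _ (smooth_at_diff (smooth_at_proj z T)) (smooth_at_diff sf)).
by rewrite derive_proj mxE eqxx /= eq_rlshift mulr0 addr0.
Qed.

(* The height perturbation [t (G u^2 / 2 - F u v + E v^2 / 2)]: to first order it adds
   [t (E^2 + 2 F^2 + G^2)] times a nonzero factor to Hbar. *)
Definition quad_unfold (e f g : R) (z : 'rV[R]_(2 + 1)) : R := z 0 T *
  (2^-1 * g * (p 0 z * p 0 z) + - f * (p 0 z * p 1 z) + 2^-1 * e * (p 1 z * p 1 z)).

Lemma smooth_quad_unfold e f g z : smooth_at (quad_unfold e f g) z.
Proof.
apply: smooth_atM; first exact: smooth_at_proj.
by apply: smooth_atD; first apply: smooth_atD; exact: smooth_cpp.
Qed.

Let derive_quad_unfold e f g k z : 'D_('e_(L k)) (quad_unfold e f g) z = z 0 T *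
  (2^-1 * g * (p 0 z * (0 == k)%:R + p 0 z * (0 == k)%:R) +
   - f * (p 0 z * (1 == k)%:R + p 1 z * (0 == k)%:R) +
   2^-1 * e * (p 1 z * (1 == k)%:R + p 1 z * (1 == k)%:R)).
Proof.
have s1 := smooth_cpp (2^-1 * g) 0 0 z; have s2 := smooth_cpp (- f) 0 1 z.
have s3 := smooth_cpp (2^-1 * e) 1 1 z.
rewrite (derive_T k (smooth_atD (smooth_atD s1 s2) s3)).
rewrite (deriveD_at _ (smooth_at_diff (smooth_atD s1 s2)) (smooth_at_diff s3)).
rewrite (deriveD_at _ (smooth_at_diff s1) (smooth_at_diff s2)).
by rewrite (derive_cpp (2^-1 * g) 0 0) (derive_cpp (- f) 0 1) (derive_cpp (2^-1 * e) 1 1).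
Qed.

Lemma partials_quad_unfold0 e f g : partials (quad_unfold e f g) [:: L 0] =
  fun z : 'rV[R]_(2 + 1) => z 0 T * (g * p 0 z + - f * p 1 z).
Proof.
apply/funext => z; rewrite [LHS]derive_quad_unfold /= mulr0n mulr1n.
by field.
Qed.

Lemma partials_quad_unfold1 e f g : partials (quad_unfold e f g) [:: L 1] =
  fun z : 'rV[R]_(2 + 1) => z 0 T * (- f * p 0 z + e * p 1 z).
Proof.
apply/funext => z; rewrite [LHS]derive_quad_unfold /= mulr0n mulr1n.
by field.
Qed.

Let derive_Tlin (b c : R) k z :
  'D_('e_(L k)) (fun z : 'rV[R]_(2 + 1) => z 0 T * (b * p 0 z + c * p 1 z)) z =
  z 0 T * (b * (0 == k)%:R + c * (1 == k)%:R).
Proof.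
have s1 := smooth_cp b 0 z; have s2 := smooth_cp c 1 z.
rewrite (derive_T k (smooth_atD s1 s2)).
rewrite (deriveD_at _ (smooth_at_diff s1) (smooth_at_diff s2)).
by rewrite (derive_cp b 0) (derive_cp c 1).
Qed.

Let vanish_Tlin (t b c : R) : vanish 2 (fun z : 'rV[R]_(2 + 1) => t * (z 0 T * (b * p 0 z + c * p 1 z))).
Proof.
have s1 := smooth_cp b 0 0; have s2 := smooth_cp c 1 0.
have sT := smooth_at_proj (0 : 'rV[R]_(2 + 1)) T.
apply: vanishM; [exact: smooth_at_cst|exact/smooth_atM/smooth_atD|].
have z0 : b * p 0 0 + c * p 1 0 = 0 by rewrite /p !mxE !mulr0 addr0.
split=> [|i]; first by rewrite mxE mul0r.
split=> // ; rewrite (deriveM_at _ (smooth_at_diff sT) (smooth_at_diff (smooth_atD s1 s2))).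
by rewrite z0 mxE !mul0r addr0.
Qed.

(** The second derivatives of u in q are [z 0 T] times the constants G, -F, E taken at 0; pairing
    them at 0 with G, -2F, E gives the sum of squares. The first derivatives of u in q vanish to
    order 2, so they do not affect the first derivatives of [Hunfold] at 0. *)
Lemma Hunfold_perturb i (f : 'rV[R]_(2 + 1) -> R) (t : R) : smooth_at f 0 ->
  let a := monge_base i 0 + 'D_('e_(L 0)) f 0 *: 'e_i in
  let b := monge_base i 1 + 'D_('e_(L 1)) f 0 *: 'e_i in
  let u := quad_unfold (mdot a a) (mdot a b) (mdot b b) in
  [/\ forall k, 'D_('e_(L k)) (Hunfold i (fun z => f z + t *: u z)) 0 =
                'D_('e_(L k)) (Hunfold i f) 0 &
      'D_('e_T) (Hunfold i (fun z => f z + t *: u z)) 0 = 'D_('e_T) (Hunfold i f) 0 +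
      t * (det3 a b 'e_i * (mdot b b ^+ 2 + 2 * mdot a b ^+ 2 + mdot a a ^+ 2))].
Proof.
have alg (c z t' e f' g F E G : R) : c * (t' * (z * g) * G - 2 * (t' * (z * - f')) * F + t' * (z * e) * E) =
  z * (t' * c * (g * G + 2 * f' * F + e * E)) by ring.
have alg0 (c t' e f' g : R) : t' * c * (g * g + 2 * f' * f' + e * e) =
  t' * (c * (g ^+ 2 + 2 * f' ^+ 2 + e ^+ 2)) by ring.
move=> sf a b u; set ft := fun z => f z + t *: u z.
have su z : smooth_at u z by exact: smooth_quad_unfold.
have sft : smooth_at ft 0.
  apply: (@eq_smooth_at _ _ _ (fun z => f z + t * u z)); first exact: filterE.
  by apply: smooth_atD => //; apply: smooth_atM => //; exact: smooth_at_cst.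
have sfs s : smooth_at (partials f s) 0 by exact: smooth_at_partials.
pose az z : space := monge_base i 0 + partials f [:: L 0] z *: 'e_i.
pose bz z : space := monge_base i 1 + partials f [:: L 1] z *: 'e_i.
have sfe s : smooth_at (fun z => partials f s z *: ('e_i : space)) 0.
  exact: smooth_at_scale.
have saz : smooth_at az 0 by apply: smooth_atD => //; exact: smooth_at_cst.
have sbz : smooth_at bz 0 by apply: smooth_atD => //; exact: smooth_at_cst.
have st s : smooth_at (fun z => t * partials u s z) 0.
  by apply: smooth_atM; [exact: smooth_at_cst|exact: smooth_at_partials].
have v0 : vanish 2 (fun z => t * partials u [:: L 0] z).
  by rewrite partials_quad_unfold0; exact: vanish_Tlin.
have v1 : vanish 2 (fun z => t * partials u [:: L 1] z).
  by rewrite partials_quad_unfold1; exact: vanish_Tlin.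
have J := Hpoly_perturb ('e_i : space) saz sbz (sfe [:: L 0; L 0]) (sfe [:: L 0; L 1])
  (sfe [:: L 1; L 1]) (st [:: L 0]) (st [:: L 1]) (st [:: L 0; L 0]) (st [:: L 0; L 1])
  (st [:: L 1; L 1]) v0 v1.
have u00 z : partials u [:: L 0; L 0] z = z 0 T * mdot b b.
  rewrite -[LHS]/('D_('e_(L 0)) (partials u [:: L 0]) z) partials_quad_unfold0.
  by rewrite derive_Tlin /= mulr1 mulr0 addr0.
have u01 z : partials u [:: L 0; L 1] z = z 0 T * - mdot a b.
  rewrite -[LHS]/('D_('e_(L 1)) (partials u [:: L 0]) z) partials_quad_unfold0.
  by rewrite derive_Tlin /= mulr1 mulr0 add0r.
have u11 z : partials u [:: L 1; L 1] z = z 0 T * mdot a a.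
  rewrite -[LHS]/('D_('e_(L 1)) (partials u [:: L 1]) z) partials_quad_unfold1.
  by rewrite derive_Tlin /= mulr1 mulr0 add0r.
pose M z := t * det3 (az z) (bz z) 'e_i *
  (mdot b b * mdot (bz z) (bz z) + 2 * mdot a b * mdot (az z) (bz z) + mdot a a * mdot (az z) (az z)).
have sc (c : R) : smooth_at (fun=> c : R) (0 : 'rV[R]_(2 + 1)) by exact: smooth_at_cst.
have sM : smooth_at M 0.
  apply: smooth_atM.
    by apply: smooth_atM => //; apply: smooth_at_det3 => //; exact: smooth_at_cst.
  by apply: smooth_atD; first apply: smooth_atD; apply: smooth_atM => //; exact: smooth_at_mdot.
have sT := smooth_at_proj (0 : 'rV[R]_(2 + 1)) T.
have sH : smooth_at (Hunfold i f) 0 by exact: smooth_Hunfold.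
have JH : jet_eq 2 (Hunfold i ft) (fun z => Hunfold i f z + z 0 T * M z).
  have [sJ sJ' _] := J; apply: jet_eq_trans (jet_eq_trans J _).
    apply: near_jet_eq; first exact: smooth_Hunfold.
    apply: filterS (smooth_at_near sf) => z sfz.
    have E k s : monge_base i k + partials ft s z *: 'e_i =
        monge_base i k + partials f s z *: 'e_i + (t * partials u s z) *: ('e_i : space).
      by rewrite (partials_line t s sfz (su z)) scalerDl addrA.
    have E0 s : partials ft s z *: 'e_i =
        partials f s z *: 'e_i + (t * partials u s z) *: ('e_i : space).
      by rewrite (partials_line t s sfz (su z)) scalerDl.
    exact: Hpoly_congr (E 0 [:: L 0]) (E 1 [:: L 1]) (E0 [:: L 0; L 0]) (E0 [:: L 0; L 1])
      (E0 [:: L 1; L 1]).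
  apply: near_jet_eq => //; apply: filterE => z; rewrite (u00 z) (u01 z) (u11 z).
  by congr (_ + _); exact: alg.
have sTM : smooth_at (fun z : 'rV[R]_(2 + 1) => z 0 T * M z) 0 by exact: smooth_atM.
have DH j : 'D_('e_j) (Hunfold i ft) 0 = 'D_('e_j) (Hunfold i f) 0 + M 0 * (T == j)%:R.
  rewrite (jet_eq2_derive j JH) (deriveD_at _ (smooth_at_diff sH) (smooth_at_diff sTM)).
  rewrite (deriveM_at _ (smooth_at_diff sT) (smooth_at_diff sM)) derive_proj.
  by rewrite [(0 : 'rV[R]_(2 + 1)) 0 T]mxE mul0r add0r [X in M 0 * X]mxE eqxx.
split=> [k|]; first by rewrite (DH (L k)) eq_rlshift mulr0 addr0.
by rewrite (DH T) eqxx mulr1; congr (_ + _); exact: alg0.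
Qed.

End QuadraticUnfolding.

Lemma germ_eq (R : realType) n (W : normedModType R) (P : set ('rV[R]_n -> W)) (f g : germs P) :
  germ_fun f = germ_fun g -> f = g.
Proof. by case: f g => f Pf [g Pg] /= fg; subst g; congr Germ; exact: Prop_irrelevance. Qed.

Lemma sum_sq_neq0 (R : realFieldType) (e f g : R) : f ^+ 2 - e * g != 0 ->
  g ^+ 2 + 2 * f ^+ 2 + e ^+ 2 != 0.
Proof.
apply: contra_neq => s0.
have [g0 f0 e0] : [/\ 0 <= g ^+ 2, 0 <= f ^+ 2 & 0 <= e ^+ 2] by rewrite !sqr_ge0.
have [F0 E0] : f ^+ 2 = 0 /\ e ^+ 2 = 0 by lra.
by move/eqP: E0; rewrite sqrf_eq0 => /eqP ->; rewrite F0 mul0r subr0.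
Qed.

(** * Generic versality for a fixed nondegenerate Monge germ *)

Section MongeGeneric.
Context {R : realType} (i : 'I_3) (a : 'rV[R]_2) (g : 'rV[R]_2 -> R) (x : @param R).
Hypotheses (xE : germ_fun x = monge i a g) (cx : critical (Hbar x)).
Hypotheses (nx : nondegenerate (Hbar x)) (dx : delta x 0 != 0).
Local Notation plane := 'rV[R]_2.
Local Notation space := 'rV[R]_3.
Let L (k : 'I_2) : 'I_(2 + 1) := lshift 1 k.
Let T : 'I_(2 + 1) := rshift 2 0.

Let sg : smooth_at g 0.
Proof.
have [sx _] := germP x; apply: eq_smooth_at (smooth_at_coord i sx).
by apply: filterE => q; rewrite xE mxE unlift_none.
Qed.

Let unfold_germ (h : 'rV[R]_(2 + 1) -> R) (z : 'rV[R]_(2 + 1)) := g (lsubmx z) + h z.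

Let smooth_glsub : smooth_at (fun z : 'rV[R]_(2 + 1) => g (lsubmx z)) 0.
Proof.
apply: (smooth_at_scalarcomp (smooth_at_lsubmx (smooth_at_id 0))).
by rewrite linear0.
Qed.

Let smooth_unfold (h : deformation) : smooth_at (unfold_germ h) 0.
Proof. by apply: smooth_atD => //; case: (germP h). Qed.

Let family_slice (h : deformation) :
  {near (0 : plane), (fun q => Hbar_family i a g h (row_mx q 0)) =1 Hbar x}.
Proof.
have [_ h0] := germP h.
have E : {near (0 : plane), monge i a (fun q => g q + h (row_mx q 0)) =1 monge i a g}.
  by apply: filterS h0 => q hq; apply/rowP => j; rewrite !mxE hq addr0.
apply: filterS (near_eq_Hbar E) => q; rewrite /Hbar_family row_mxKl row_mxKr xE.
exact.
Qed.

Let smooth_family (h : deformation) : smooth_at (Hbar_family i a g h) 0.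
Proof.
exact: eq_smooth_at (near_Hbar_family i a (smooth_unfold h)) (smooth_Hunfold i (smooth_unfold h)).
Qed.

Let derive_family (h : deformation) k : 'D_('e_(L k)) (Hbar_family i a g h) 0 = 0.
Proof.
rewrite -[X in 'D__ _ X](row_mx0 R 1 2 1) -derive_row_mx0.
by rewrite (near_eq_derive _ (family_slice h)) cx.2.
Qed.

(** The t-derivative of Hbar_t at the singular point, written with [Hunfold] because its jets are
    known to depend continuously on h. *)
Let speed (h : deformation) := 'D_('e_T) (Hunfold i (unfold_germ h)) 0.

Let versalE (h : deformation) : R_versal (Hbar_family i a g h) <-> speed h != 0.
Proof.
rewrite /speed (near_eq_derive _ (near_Hbar_family i a (smooth_unfold h))).
split; first exact: (versal_transverse (smooth_family h) (derive_family h)).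
apply: (versal_of_transverse (smooth_family h) (derive_family h)).
by rewrite (near_hess_det (family_slice h)).
Qed.

Let speed_continuous : continuous speed.
Proof.
have J : jet_continuous (fun h : deformation => unfold_germ h).
  apply: jet_continuousD; first exact: jet_continuous_cst.
  by split=> [h|s]; [case: (germP h)|exact: germs_partials_continuous].
exact: (Hunfold_jet_continuous i J).2 [:: T].
Qed.

Lemma monge_generic : generic [set h : deformation | R_versal (Hbar_family i a g h)].
Proof.
have -> : [set h : deformation | R_versal (Hbar_family i a g h)] = speed @^-1` [set y | y != 0].
  apply/seteqP; split=> h hh; first exact/(versalE h).1.
  exact/(versalE h).2.
split.
  move/continuousP : speed_continuous; apply.
  exact: open_neq.
move=> O [h Oh] oO.
(* Deformations vanish at t = 0, so the tangent vectors at the origin, and with them E, F and G, are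
   the same for all h. *)
have Dg k : 'D_('e_k) g 0 = 'D_('e_(L k)) (unfold_germ h) 0.
  rewrite -[X in 'D__ (unfold_germ h) X](row_mx0 R 1 2 1) -derive_row_mx0.
  apply: near_eq_derive; have [_ h0] := germP h; apply: filterS h0 => q hq.
  by rewrite /unfold_germ row_mxKl hq addr0.
have D k : 'D_('e_k) x 0 = monge_base i k + 'D_('e_(L k)) (unfold_germ h) 0 *: 'e_i.
  by rewrite xE (derive_monge i a k sg) Dg.
pose u := quad_unfold (Efun x 0) (Ffun x 0) (Gfun x 0).
have su : smooth_at u 0 by exact: smooth_quad_unfold.
have [sh h0] := germP h.
have Pf t : deformation_germ (fun z => h z + t *: u z).
  split.
    apply: (@eq_smooth_at _ _ _ (fun z => h z + t * u z)); first exact: filterE.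
    by apply: smooth_atD => //; apply: smooth_atM => //; exact: smooth_at_cst.
  apply: filterS h0 => q ->; rewrite /u /quad_unfold row_mxEr mxE mul0r scaler0.
  by rewrite addr0.
pose K := det3 ('D_('e_0) x 0) ('D_('e_1) x 0) 'e_i *
  (Gfun x 0 ^+ 2 + 2 * Ffun x 0 ^+ 2 + Efun x 0 ^+ 2).
(* The speed is affine along the line; the zero quadratic term fits it to [germs_line_dense]. *)
have e t : speed (Germ (Pf t)) = speed h + K * t + 0 * t ^+ 2.
  rewrite mul0r addr0 [K * t]mulrC.
  have uE : unfold_germ (Germ (Pf t)) = fun z => unfold_germ h z + t *: u z.
    by apply/funext => z; rewrite /unfold_germ /= addrA.
  have [_ E] := Hunfold_perturb i t (smooth_unfold h); rewrite -(D 0) -(D 1) in E.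
  by rewrite /speed uE; exact: E.
have K0 : K != 0.
  apply: mulf_neq0; first by rewrite (D 0) (D 1); exact: det3_monge_base.
  exact: sum_sq_neq0.
have h0E : Germ (Pf 0) = h.
  by apply: germ_eq; apply/funext => z /=; rewrite scale0r addr0.
have [||t Ot et] := germs_line_dense (Pf := Pf) (O := O) (e := fun t => speed (Germ (Pf t)))
  sh su oO _ e.
- by rewrite h0E.
- by rewrite K0.
by exists (Germ (Pf t)); split.
Qed.

End MongeGeneric.

(** * Degenerate germs form a closed set of parametrizations *)

Section GenericGerms.
Context {R : realType}.
Local Notation plane := 'rV[R]_2.
Local Notation space := 'rV[R]_3.

Lemma param_jet_continuous s j :
  jet_continuous (fun (x : @param R) q => partials x s q 0 j).
Proof.
split=> [x|s']; first exact/smooth_at_coord/smooth_at_partials/param_smooth.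
have -> : (fun x : @param R => partials (fun q => partials x s q 0 j) s' 0) =
    (fun v : space => v 0 j) \o (fun x : @param R => partials x (s ++ s') 0).
  apply/funext => x /=; rewrite -partials_cat.
  exact: (partials_coord s' j (smooth_at_partials s (param_smooth x))).
move=> x; apply: continuous_comp; first exact: germs_partials_continuous.
exact: coord_continuous.
Qed.

Lemma Hbar_jet_continuous : jet_continuous (fun x : @param R => Hbar x).
Proof.
have -> : (fun x : @param R => Hbar x) = fun (x : @param R) q =>
    Hpoly (partials x [:: 0] q) (partials x [:: 1] q)
      (partials x [:: 0; 0] q) (partials x [:: 0; 1] q) (partials x [:: 1; 1] q).
  by apply/funext => x; apply/funext => q; exact: Hbar_Hpoly.
have js := param_jet_continuous.
apply: (@Hpoly_closed R (@param R * plane)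
  [set f | jet_continuous (fun x q => f (x, q))]
  (fun y => partials y.1 [:: 0] y.2) (fun y => partials y.1 [:: 1] y.2)
  (fun y => partials y.1 [:: 0; 0] y.2) (fun y => partials y.1 [:: 0; 1] y.2)
  (fun y => partials y.1 [:: 1; 1] y.2)) => /=.
- by move=> f g; exact: jet_continuousD.
- by move=> f g; exact: jet_continuousM.
- by move=> f; exact: jet_continuousN.
- exact/jet_continuous_cst/smooth_at_cst.
- exact: (js [:: 0]).
- exact: (js [:: 1]).
- exact: (js [:: 0; 0]).
- exact: (js [:: 0; 1]).
- exact: (js [:: 1; 1]).
Qed.

(** Criticality is part of the condition: it makes the set closed and invariant under
    reparametrization among all parametrizations, so openness can be proved before restricting to
    [G4]. *)
Definition degenerate (x : @param R) := critical (Hbar x) /\ hess_det (Hbar x) 0 1 = 0.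

Lemma open_nondegenerate : open (~` [set x : @param R | degenerate x]).
Proof.
have cH s : continuous (fun x : @param R => partials (Hbar x) s 0).
  exact: Hbar_jet_continuous.2.
have open_neq_pre (f : @param R -> R) : continuous f -> open [set x | f x != 0].
  by move=> /continuousP cf; exact: (cf _ (open_neq (y := 0))).
have -> : ~` [set x : @param R | degenerate x] =
    [set x : @param R | partials (Hbar x) [::] 0 != 0] `|`
    [set x : @param R | partials (Hbar x) [:: 0] 0 != 0] `|`
    [set x : @param R | partials (Hbar x) [:: 1] 0 != 0] `|`
    [set x : @param R | hess_det (Hbar x) 0 1 != 0].
  apply/seteqP; split=> x.
    move=> nd; apply: contrapT => none; apply: nd.
    have z (b : bool) : ~ b -> ~~ b by move/negP.
    split; first split.
    - by apply/eqP/negPn/z => H; apply: none; left; left; left.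
    - move=> i; apply/eqP/negPn/z => H; apply: none; left.
      by move: H; case: (ord2_cases i) => -> H; [left; right|right].
    - by apply/eqP/negPn/z => H; apply: none; right.
  case=> [[[]|]|] /eqP nz [[H0 HD] Hd]; apply: nz.
  - exact: H0.
  - exact: HD.
  - exact: HD.
  - exact: Hd.
apply: openU; first apply: openU; first apply: openU; apply: open_neq_pre.
- exact: cH.
- exact: cH.
- exact: cH.
- have cM (f g : @param R -> R) : continuous f -> continuous g ->
      continuous (fun x => f x * g x).
    by move=> cf cg x; exact: (continuousM (cf x) (cg x)).
  have c1 := cM _ _ (cH [:: 0; 0]) (cH [:: 1; 1]).
  have c2 := cM _ _ (cH [:: 0; 1]) (cH [:: 0; 1]).
  by move=> x; exact: (continuousB (c1 x) (c2 x)).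
Qed.

Lemma is_param_of_reparam (x y : @param R) M :
  is_param_of x M -> is_param_of y M -> reparam x y.
Proof.
move=> xM yM; have E := etrans xM (esym yM).
exact/asboolP/(@eqmodP _ reparam_equiv x y).
Qed.

(** [G4] provides one suitable parametrization, whereas the two claims of the theorem quantify over
    all of them. *)
Lemma G4_param (M : G4 R) (y : @param R) : is_param_of y (set_val M) ->
  critical (Hbar y) /\ delta y 0 != 0.
Proof.
case: (set_valP M) => x [xM dx sx] yM.
have /singular_germP cx := sx; have {}cx := cx (smooth_Hbar (param_smooth x)).
split; first exact: (reparam_critical (is_param_of_reparam xM yM) cx).1.
have [p [_ _ _ dE]] := reparam_Hbar (is_param_of_reparam yM xM).
by apply: contraTneq dx => d0; rewrite dE d0 mulr0 ltxx.
Qed.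

End GenericGerms.

(** * Density of nondegenerate germs *)

Section Density.
Context {R : realType}.
Local Notation plane := 'rV[R]_2.
Local Notation space := 'rV[R]_3.

(** From EG < F^2 one gets EG - 4F^2 < - 3F^2 <= 0, so the quadratic term never disappears, whatever
    the Hessian at t = 0. *)
Lemma hess_det_quadratic (h00 h01 h11 e f g c : R) : e * g < f ^+ 2 -> c != 0 ->
  16 * c ^+ 2 * (e * g - 4 * f ^+ 2) != 0 /\ forall t,
  (h00 + 4 * t * c * e) * (h11 + 4 * t * c * g) - (h01 - 8 * t * c * f) ^+ 2 =
  (h00 * h11 - h01 ^+ 2) + 4 * c * (e * h11 + g * h00 + 4 * f * h01) * t +
  16 * c ^+ 2 * (e * g - 4 * f ^+ 2) * t ^+ 2.
Proof.
move=> egf c0; split; last by move=> t; ring.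
have f0 := sqr_ge0 f.
rewrite !mulf_neq0 ?sqrf_eq0// ?pnatr_eq0//.
by apply/ltr0_neq0; lra.
Qed.

Lemma delta_neq0_normal (x : plane -> space) q : delta x q != 0 ->
  exists j, det3 ('D_('e_0) x q) ('D_('e_1) x q) 'e_j != 0.
Proof.
move=> d0; apply: contrapT => none; move/eqP: d0; apply.
have z j : det3 ('D_('e_0) x q) ('D_('e_1) x q) 'e_j = 0.
  by apply/eqP; apply: contrapT => /negP nz; apply: none; exists j.
rewrite /delta /Ffun /Efun /Gfun det3_Gram !z.
by rewrite expr0n !addr0 subr0.
Qed.

Lemma derive_perturb (x : plane -> space) (N : space) t i : smooth_at x 0 ->
  'D_('e_i) (fun q => x q + t *: (monom 1 2 2 q *: N)) 0 = 'D_('e_i) x 0.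
Proof.
move=> sx; have sm := smooth_monom (R := R) 1 2 2 0.
have sN : smooth_at (fun q => monom 1 2 2 q *: N) 0 by exact: smooth_at_scale.
rewrite [LHS](partials_line t [:: i] sx sN) (partials_scale N [:: i] sm).
have -> : partials (monom (1 : R) 2 2) [:: i] 0 = 0.
  by rewrite [LHS](congr1 (@^~ 0) (derive_monom 1 2 2 i)); case: eqP; rewrite monom0.
by rewrite scale0r scaler0 addr0.
Qed.

Lemma hess_det_perturb (x : plane -> space) (N : space) t : smooth_at x 0 ->
  let c := det3 ('D_('e_0) x 0) ('D_('e_1) x 0) N in
  hess_det (Hbar (fun q => x q + t *: (monom 1 2 2 q *: N))) 0 1 =
  (hess (Hbar x) 0 0 + 4 * t * c * Efun x 0) * (hess (Hbar x) 1 1 + 4 * t * c * Gfun x 0) -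
  (hess (Hbar x) 0 1 - 8 * t * c * Ffun x 0) ^+ 2.
Proof.
have congr_det (u v w u' v' w' : R) : u = u' -> v = v' -> w = w' ->
  u * w - v ^+ 2 = u' * w' - v' ^+ 2 by move=> -> -> ->.
move=> sx c; have [_ h00 h01 h11] := hess_Hbar_perturb N t sx.
exact: congr_det h00 h01 h11.
Qed.

Lemma degenerate_perturb (x : @param R) (O : set (@param R)) :
  open O -> O x -> critical (Hbar x) -> 0 < delta x 0 -> exists y : @param R,
  [/\ O y, critical (Hbar y), 0 < delta y 0 & nondegenerate (Hbar y)].
Proof.
move=> oO Ox [H0 DH] dx; have sx := param_smooth x.
(* An axis transverse to the tangent plane serves as the direction N of the perturbation. *)
have [j c0] := delta_neq0_normal (lt0r_neq0 dx).
pose u q : space := monom 1 2 2 q *: 'e_j.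
have su : smooth_at u 0 by apply: smooth_at_scale; exact: smooth_monom.
have D t i : 'D_('e_i) (fun q => x q + t *: u q) 0 = 'D_('e_i) x 0.
  exact: derive_perturb.
have Pf t : immersion_germ (fun q => x q + t *: u q).
  split.
    apply: smooth_atD => //.
    apply: (@eq_smooth_at _ _ _ (fun q => (t * monom 1 2 2 q) *: ('e_j : space))).
      by apply: filterE => q; rewrite /u scalerA.
    apply: smooth_at_scale; apply: smooth_atM; first exact: smooth_at_cst.
    exact: smooth_monom.
  have -> : \matrix_(i < 2) 'D_('e_i) (fun q => x q + t *: u q) 0 = \matrix_(i < 2) 'D_('e_i) x 0.
    by apply/row_matrixP => i; rewrite !rowK.
  by have [] := germP x.
have egf : Efun x 0 * Gfun x 0 < Ffun x 0 ^+ 2 by rewrite -subr_gt0.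
have [lead quad] := hess_det_quadratic (hess (Hbar x) 0 0) (hess (Hbar x) 0 1)
  (hess (Hbar x) 1 1) egf c0.
have e t : hess_det (Hbar (Germ (Pf t))) 0 1 = _ :=
  etrans (hess_det_perturb 'e_j t sx) (quad t).
have Px : Germ (Pf 0) = x.
  by apply: germ_eq; apply/funext => q /=; rewrite scale0r addr0.
have [||t Ot et] := germs_line_dense (Pf := Pf) (O := O)
  (e := fun t => hess_det (Hbar (Germ (Pf t))) 0 1) sx su oO _ e.
- by rewrite Px.
- by rewrite lead orbT.
have [J _ _ _] := hess_Hbar_perturb 'e_j t sx.
have cy : critical (Hbar (Germ (Pf t))).
  split; first by rewrite -H0; exact: (jet_eqS J).1.
  by move=> i; rewrite -(DH i); exact: jet_eq2_derive.
have dy : delta (Germ (Pf t)) 0 = delta x 0.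
  by rewrite /delta /Ffun /Efun /Gfun (D t 0) (D t 1).
by exists (Germ (Pf t)); rewrite dy; split; [exact: Ot|exact: cy|exact: dx|exact: et].
Qed.

End Density.

Theorem theorem4p6 (R : realType) :
  generic [set M : G4 R |
    MCNC_A1 (set_val M) /\ MCNC_generically_versal (set_val M)].
Proof.
(* On [G4] both claims together amount to nondegeneracy: the first implies it, and it implies both.
   A single open and dense set is therefore enough. *)
have -> : [set M : G4 R | MCNC_A1 (set_val M) /\ MCNC_generically_versal (set_val M)] =
    set_val @^-1` [set M : surface_germ R | forall x, is_param_of x M -> ~ degenerate x].
  apply/seteqP; split=> M.
    move=> [A1 _] x xM [cx Hx]; have := A1_nondegenerate (smooth_Hbar (param_smooth x)) cx (A1 x xM).
    by rewrite /nondegenerate Hx eqxx.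
  move=> nd; have good x : is_param_of x (set_val M) -> nondegenerate (Hbar x).
    by move=> xM; apply/eqP => Hx; apply: (nd x xM); split=> //; have [] := G4_param xM.
  split=> [x xM|i a g x xM xE].
    have [cx _] := G4_param xM.
    exact: nondegenerate_A1 (smooth_Hbar (param_smooth x)) cx (good x xM).
  have [cx dx] := G4_param xM.
  exact: (monge_generic xE cx (good x xM) dx).
set V := [set M : surface_germ R | _].
(* V asks for all parametrizations of M to be good; by invariance one is enough, so the preimage of
   V is the complement of a closed set. *)
have piV : (\pi_(surface_germ R) @^-1` V)%qT = ~` [set x : @param R | degenerate x].
  apply/seteqP; split=> x; first exact.
  move=> nd y yx dy; apply: nd.
  have r : reparam y x by exact: is_param_of_reparam yx _.
  have [cy Hy] := dy; have [cx Hx] := reparam_critical r cy.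
  exact: conj cx (Hx Hy).
split.
  have cv : continuous (set_val : G4 R -> surface_germ R) := @initial_continuous _ _ _.
  move/continuousP : cv; apply.
  rewrite -[open V]/(open (\pi_(surface_germ R)%qT @^-1` V)) piV.
  exact: open_nondegenerate.
move=> O [M OM] [U oU UE].
case: (set_valP M) => x [xM dx sx].
have cx := (singular_germP (smooth_Hbar (param_smooth x))).1 sx.
have Ux : (\pi_(surface_germ R)%qT @^-1` U) x.
  by rewrite /preimage /= xM; move: OM; rewrite -UE.
(* The perturbation is made in the preimage of U among parametrizations. It keeps the 1-jet of Hbar
   and delta at 0, so the new germ is again in [G4]. *)
have [y [Uy cy dy ny]] := degenerate_perturb oU Ux cx dx.
have yG : G4 R (\pi_(surface_germ R) y)%qT.
  exists y; split; [by []|exact: dy|].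
  exact: (singular_germP (smooth_Hbar (param_smooth y))).2 cy.
exists (SigSub (mem_set yG)); split; first by rewrite -UE.
rewrite /preimage /=; have : (~` [set x : @param R | degenerate x]) y.
  by move=> [_ Hy]; move/eqP: ny; apply.
by rewrite -piV.
Qed.
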